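(* Let $f(x)=\mathbb{E}_\xi[F(x,\xi)]$ on $\mathbb{R}^d$ be bounded below, and assume $\mathbb{E}[(F(x,\xi)-f(x))^2]\le\sigma^2$ for all $x\in\mathbb{R}^d$, for some $\sigma>0$. Assume that for every $\xi$ the function $F(\cdot,\xi)$ is Lipschitz continuous with constant $L_0(\xi)\le L_0$, where $L_0>0$. Run the zeroth-order iteration $x_{t+1}=x_t-\eta\,\tilde g(x_t)$ with stochastic one-point residual feedback (defined in the context) for $T$ iterations, and let $\tilde x$ be selected uniformly at random from the $T$ iterates $x_0,\dots,x_{T-1}$. (i) Let $\epsilon_f>0$, $T>1/(d\,\epsilon_f)$, $\eta=\frac{\epsilon_f^{1.5}}{2\sqrt2\,L_0^2\,d^{1.5}\sqrt T}$ and $\delta=\frac{\epsilon_f}{L_0\sqrt d}$. Then $$\mathbb{E}\big[\|\nabla f_\delta(\tilde x)\|^2\big]=\mathcal{O}\big(d^{1.5}\,\epsilon_f^{-1.5}\,T^{-0.5}\big).$$ (ii) Assume additionally that for every $\xi$ the function $F(\cdot,\xi)$ is differentiable with Lipschitz continuous gradient with constant $L_1(\xi)\le L_1$, where $L_1>0$. Let $T>2$, $\eta=\frac{1}{2L_0d^{4/3}T^{2/3}}$ and $\delta=\frac{1}{d^{5/6}T^{1/6}}$. Then $$\mathbb{E}\big[\|\nabla f(\tilde x)\|^2\big]=\mathcal{O}\big(d^{4/3}\,T^{-1/3}\big).$$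
   Context: Stochastic residual feedback: $x_0\in\mathbb{R}^d$ is a given point, $u_0,u_1,\dots$ are independent standard Gaussian vectors in $\mathbb{R}^d$, $\xi_0,\xi_1,\dots$ are independent random data samples distributed as $\xi$ and independent of the $u_t$, $\delta>0$ is the exploration parameter and $\eta>0$ the stepsize. For $t\ge1$, $$\tilde g(x_t)=\frac{u_t}{\delta}\big(F(x_t+\delta u_t,\xi_t)-F(x_{t-1}+\delta u_{t-1},\xi_{t-1})\big),$$ and at $t=0$ the ordinary one-point estimate $\tilde g(x_0)=\frac{u_0}{\delta}F(x_0+\delta u_0,\xi_0)$ is used. The iterates are $x_{t+1}=x_t-\eta\,\tilde g(x_t)$. Smoothed function: $f_\delta(x):=\mathbb{E}_{u}[f(x+\delta u)]$, with $u$ a standard Gaussian vector in $\mathbb{R}^d$. In (i), $\epsilon_f$ is the prescribed tolerance for the approximation error: the choice of $\delta$ gives $|f(x)-f_\delta(x)|\le\epsilon_f$ for all $x$. The $\mathcal{O}$ notation displays the dependence on the dimension $d$, the tolerance $\epsilon_f$ and the number of iterations $T$; it suppresses constants formed from $L_0$, $\sigma$, the initial gap $f_\delta(x_0)-\inf f_\delta$, $\mathbb{E}[\|\tilde g(x_0)\|^2]$ and, in (ii), $L_1$.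
   Formalization: In (i) the constant hidden in O may also depend on an arbitrary upper bound for ε_f, since uniformity as ε_f → ∞ fails (d = T = 1, F(x,ξ) = |x|, x_0 = √ε_f). *)

(* Defs.v *)
From HB Require Import structures.
From mathcomp Require Import all_boot all_order all_algebra finmap.
From mathcomp Require Import all_classical all_reals all_analysis.

Set Implicit Arguments.
Unset Strict Implicit.
Unset Printing Implicit Defensive.

Import Order.TTheory GRing.Theory Num.Theory.
Import numFieldNormedType.Exports.

Local Open Scope classical_set_scope.
Local Open Scope ring_scope.

(* The library norm `|x| on 'rV[R]_d is the sup norm (it induces the same
   topology, so differentiability is unaffected); the Euclidean norm is needed
   here. *)
Definition l2norm (R : realType) (d : nat) (x : 'rV[R]_d) : R :=
  Num.sqrt (\sum_(i < d) x ord0 i ^+ 2).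

Definition grad (R : realType) (d : nat) (f : 'rV[R]_d -> R) (x : 'rV[R]_d) :
    'rV[R]_d :=
  \row_(i < d) 'D_(delta_mx ord0 i) f x.

(* Random vectors take values in d.-tuple R, which carries the product Borel
   sigma-algebra; 'rV[R]_d carries the vector space structure. *)
Definition rowof (R : realType) (d : nat) (t : d.-tuple R) : 'rV[R]_d :=
  \row_(i < d) tnth t i.

Definition mutual_independence (R : realType) (dO : measure_display)
    (Omega : measurableType dO) (P : probability Omega R) (I : choiceType)
    (S : I -> set (set Omega)) : Prop :=
  forall (J : {fset I}) (E : I -> set Omega),
    (forall i, i \in J -> S i (E i)) ->
    P (\bigcap_(i in [set` J]) E i) = (\prod_(i <- J) P (E i))%E.

Definition std_gaussian (R : realType) (d : nat) (dO : measure_display)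
    (Omega : measurableType dO) (P : probability Omega R)
    (v : {RV P >-> d.-tuple R}) : Prop :=
  (forall (i : 'I_d) (B : set R), measurable B ->
     P [set w | B (tnth (v w) i)] = normal_prob 0 1 B) /\
  mutual_independence P (fun i : 'I_d => g_sigma_algebra_preimage (fun w => tnth (v w) i)).

Definition objective (R : realType) (d : nat) (dX : measure_display)
    (Xi : measurableType dX) (D : probability Xi R)
    (F : 'rV[R]_d -> Xi -> R) (x : 'rV[R]_d) : R :=
  fine ('E_D[F x])%E.

Definition smoothed (R : realType) (d : nat) (dG : measure_display)
    (Gamma : measurableType dG) (Q : probability Gamma R)
    (v : {RV Q >-> d.-tuple R}) (delta : R) (f : 'rV[R]_d -> R)
    (x : 'rV[R]_d) : R :=
  fine ('E_Q[fun w => f (x + delta *: rowof (v w))%R])%E.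

Definition admissible_objective (R : realType) (d : nat) (dX : measure_display)
    (Xi : measurableType dX) (D : probability Xi R)
    (F : 'rV[R]_d -> Xi -> R) (sigma L0 : R) : Prop :=
  [/\ forall x, D.-integrable [set: Xi] (EFin \o F x),
      exists m, forall x, m <= objective D F x,
      forall x,
        ('E_D[fun s => ((F x s - objective D F x) ^+ 2)%R] <= (sigma ^+ 2)%:E)%E &
      forall s, exists2 l, l <= L0 &
        forall x y, `|F x s - F y s| <= l * l2norm (x - y)].

Definition smooth_samples (R : realType) (d : nat) (Xi : Type)
    (F : 'rV[R]_d -> Xi -> R) (L1 : R) : Prop :=
  forall s, (forall x, differentiable (F ^~ s) x) /\
    exists2 l, l <= L1 &
      forall x y, l2norm (grad (F ^~ s) x - grad (F ^~ s) y)
                  <= l * l2norm (x - y).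

(* tau is the index of the randomly selected iterate; the index type of the
   independent family is Some (inl t) for u_t, Some (inr t) for xi_t and None
   for tau. *)
Definition sampling (R : realType) (d : nat) (dX dO : measure_display)
    (Xi : measurableType dX) (Omega : measurableType dO)
    (D : probability Xi R) (P : probability Omega R)
    (u : nat -> {RV P >-> d.-tuple R}) (xi : nat -> {RV P >-> Xi})
    (tau : {RV P >-> nat}) (T : nat) : Prop :=
  [/\ forall t, std_gaussian (u t),
      forall t (B : set Xi), measurable B -> distribution P (xi t) B = D B,
      forall t, (t < T)%N -> P [set w | tau w = t] = (T%:R^-1)%:E &
      mutual_independence P (fun k : option (nat + nat) =>
        match k with
        | Some (inl t) => g_sigma_algebra_preimage (u t)
        | Some (inr t) => g_sigma_algebra_preimage (xi t)
        | None => g_sigma_algebra_preimage tau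
        end)].

(* The three functions below are pathwise: u and s are realizations of the
   sequences of Gaussian directions and of data samples. At t = 0 the value
   prev = 0 gives the ordinary one-point estimate. *)
Definition query (R : realType) (d : nat) (Xi : Type)
    (F : 'rV[R]_d -> Xi -> R) (delta : R) (u : nat -> 'rV[R]_d)
    (s : nat -> Xi) (t : nat) (x : 'rV[R]_d) : R :=
  F (x + delta *: u t) (s t).

Fixpoint iterate (R : realType) (d : nat) (Xi : Type)
    (F : 'rV[R]_d -> Xi -> R) (delta eta : R) (x0 : 'rV[R]_d)
    (u : nat -> 'rV[R]_d) (s : nat -> Xi) (t : nat) : 'rV[R]_d :=
  let x := iterate F delta eta x0 u s in
  match t with
  | 0%N => x0
  | n.+1 =>
      let prev := if n is m.+1 then query F delta u s m (x m) else 0 in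
      x n - eta *: (((query F delta u s n (x n) - prev) / delta) *: u n)
  end.

Definition feedback (R : realType) (d : nat) (Xi : Type)
    (F : 'rV[R]_d -> Xi -> R) (delta eta : R) (x0 : 'rV[R]_d)
    (u : nat -> 'rV[R]_d) (s : nat -> Xi) (t : nat) : 'rV[R]_d :=
  let x := iterate F delta eta x0 u s in
  let prev := if t is m.+1 then query F delta u s m (x m) else 0 in
  ((query F delta u s t (x t) - prev) / delta) *: u t.

Lemma iterateS (R : realType) (d : nat) (Xi : Type)
    (F : 'rV[R]_d -> Xi -> R) (delta eta : R) (x0 : 'rV[R]_d)
    (u : nat -> 'rV[R]_d) (s : nat -> Xi) (t : nat) :
  iterate F delta eta x0 u s t.+1 =
  iterate F delta eta x0 u s t - eta *: feedback F delta eta x0 u s t.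
Proof. by []. Qed.

(* Main.v *)
Require Import Defs.
From HB Require Import structures.
From mathcomp Require Import all_boot all_order all_algebra finmap.
From mathcomp Require Import all_classical all_reals all_analysis.
From mathcomp Require Import measurable_realfun.
From mathcomp Require Import ring lra.

Set Implicit Arguments.
Unset Strict Implicit.
Unset Printing Implicit Defensive.

Import Order.TTheory GRing.Theory Num.Theory.
Import numFieldNormedType.Exports.

Local Open Scope classical_set_scope.
Local Open Scope ring_scope.

(** For a Lipschitz [f], Gaussian integration by parts gives
    [grad f_delta x = E[u * f (x + delta * u)] / delta]. It holds without any
    differentiability of [f]: shifting one coordinate of [u] by [a] multiplies its
    density by [exp (a * z - a^2 / 2)], whose first-order expansion in [a] is explicit.
    As [u_t] and [xi_t] are independent of [x_t] and of the previous query, the residual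
    feedback is an unbiased estimate of [grad f_delta x_t]. Its second moment satisfies
    [E |g_(t+1)|^2 <= alpha * E |g_t|^2 + M] with [alpha * T] bounded for the prescribed
    [eta] and [delta], hence is bounded by a multiple of [E |g_0|^2 + M]. Telescoping the
    descent inequality of [f_delta], whose quadratic term is of order
    [sqrt d * L0 / delta] in (i) and [L1] in (ii), bounds the average of
    [E |grad f_delta x_t|^2]; in (ii) the bias [|grad f - grad f_delta|^2] is of order
    [L1^2 * delta^2 * d]. *)

(** * Tilting the normal law *)

(** No conditional expectation is used. The sample space carrying only the sigma-algebra of the
    history is paired with one fresh variable, and Tonelli or Fubini on this product integrates that
    variable out. For this [F] at a random point must be jointly measurable, which follows from its
    Lipschitz bound and its measurability in the sample. Consecutive queries use different samples,
    so the Lipschitz bound does not apply to their difference directly. Inserting the value of [F]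
    at the old query point under the new sample leaves a Lipschitz difference, controlled by
    [eta * g_t] and [delta * u], and two noise terms of variance at most [sigma ^+ 2]; division by
    [delta] turns the latter into the [sigma ^+ 2 / delta ^+ 2] of [M]. Only the second moment of
    [g_0] is assumed bounded, hence the recursion runs in the extended reals and integrability is
    read off its conclusion. In (i), [alpha * T] equals [9 / 8 * c * epsf / d] with [c] a Gaussian
    constant, so the final constant depends on an upper bound for the tolerance. *)

Section density.
Local Open Scope ereal_scope.
Context d (T : measurableType d) (R : realType).
Variables (mu nu : {measure set T -> \bar R}) (p : T -> R).
Hypotheses (mp : measurable_fun setT p) (p0 : forall x, (0 <= p x)%R).
Hypothesis nuE : forall A, measurable A -> nu A = \int[mu]_(x in A) (p x)%:E.

Import HBNNSimple.

(** By monotone convergence both sides are limits along the same increasing simple functions; for a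
    simple function the identity is [nuE] summed over its level sets. *)
Lemma ge0_integral_density (f : T -> \bar R) :
  measurable_fun setT f -> (forall x, 0 <= f x) ->
  \int[nu]_x f x = \int[mu]_x (f x * (p x)%:E).
Proof.
move=> mf f0; pose h := nnsfun_approx measurableT mf.
have mpE : measurable_fun setT (EFin \o p) by exact/measurable_EFinP.
have fE x : f x = limn (fun n => (h n x)%:E).
  by apply/esym/cvg_lim => //; exact: cvg_nnsfun_approx.
have -> : \int[nu]_x f x = limn (fun n => \int[nu]_x (h n x)%:E).
  under eq_integral => x _ do rewrite fE.
  apply: monotone_convergence => //.
  - by move=> n; exact/measurable_EFinP/measurable_funP.
  - by move=> n x _; rewrite lee_fin.
  - by move=> x _ a b ab; rewrite lee_fin; exact/lefP/nd_nnsfun_approx.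
have -> : \int[mu]_x (f x * (p x)%:E) =
    limn (fun n => \int[mu]_x ((h n x)%:E * (p x)%:E)).
  rewrite -monotone_convergence//.
  - apply: eq_integral => x _; apply/esym/cvg_lim => //.
    by apply: cvgeZr => //; exact: cvg_nnsfun_approx.
  - by move=> n; apply: emeasurable_funM => //; exact/measurable_EFinP/measurable_funP.
  - by move=> n x _; rewrite mule_ge0 ?lee_fin.
  - by move=> x _ a b ab; rewrite lee_wpmul2r ?lee_fin//; exact/lefP/nd_nnsfun_approx.
congr (limn _); apply/funext => n.
have nuI A : measurable A -> nu A = \int[mu]_x ((\1_A x)%:E * (p x)%:E).
  move=> mA; rewrite nuE// integral_mkcond; apply: eq_integral => x _.
  by rewrite patchE indicE; case: ifPn => _; rewrite ?mul1e ?mul0e.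
rewrite integralT_nnsfun sintegralE.
under [RHS]eq_integral => x _.
  rewrite fimfunE -fsumEFin// ge0_mule_fsuml; last first.
    by move=> r; rewrite EFinM; apply: nnfun_muleindic_ge0.
  over.
rewrite ge0_integral_fsum//; last 2 first.
  move=> r; apply: emeasurable_funM => //.
  by apply/measurable_EFinP/measurable_funM.
  move=> r x _; rewrite mule_ge0 ?lee_fin//; exact: nnfun_muleindic_ge0.
apply: eq_fsbigr => r rh; rewrite nuI//.
under [RHS]eq_integral do rewrite EFinM -muleA.
rewrite ge0_integralZl ?lee_fin//.
- by apply: emeasurable_funM => //; exact/measurable_EFinP.
- by move=> x _; rewrite mule_ge0 ?lee_fin.
- by move: rh; rewrite inE => -[x _ <-].
Qed.

End density.

Section normal.
Context (R : realType).
Notation N := (normal_prob (0:R) 1).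

Lemma ge0_integral_shift (f : R -> \bar R) (a : R) :
  measurable_fun setT f -> (forall x, 0 <= f x)%E ->
  (\int[lebesgue_measure]_x f (x + a)%R = \int[lebesgue_measure]_x f x)%E.
Proof.
move=> mf f0.
have ms : measurable_fun setT (fun x : measurableTypeR R => (x + a : measurableTypeR R)).
  by apply: measurable_funD.
rewrite [RHS](eq_measure_integral (pushforward lebesgue_measure
   (fun x : measurableTypeR R => (x + a : measurableTypeR R)))).
  by rewrite ge0_integral_pushforward.
move=> A mA _.
(* The pushforward under translation is identified by its values on half-open intervals. *)
apply: lebesgue_measure_unique => //= _ [[b c]] _ <-.
rewrite /pushforward (_ : _ @^-1` _ = `]b - a, c - a]%classic); last first.
  by apply/seteqP; split => x /=; rewrite !in_itv/= ltrBlDr lerBrDr.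
rewrite !lebesgue_measure_itv/= !lte_fin ltrD2r.
by case: ifP => // _; rewrite -!EFinB; congr (_%:E); ring.
Qed.

Lemma normal_pdf_shift (a x : R) :
  normal_pdf 0 1 (x - a) = normal_pdf 0 1 x * expR (a * x - a ^+ 2 / 2).
Proof.
rewrite !normal_pdfE ?oner_eq0// -mulrA; congr (_ * _).
rewrite /normal_fun -expRD; congr expR.
by field.
Qed.

Lemma ge0_integral_normal (f : R -> \bar R) :
  measurable_fun setT f -> (forall x, 0 <= f x)%E ->
  (\int[N]_x f x = \int[lebesgue_measure]_x (f x * (normal_pdf 0 1 x)%:E))%E.
Proof.
move=> mf f0; apply: ge0_integral_density => //.
- exact: measurable_normal_pdf.
- by move=> x; exact: normal_pdf_ge0.
Qed.

(** The Cameron-Martin formula in dimension one. *)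
Lemma ge0_integral_normal_shift (f : R -> \bar R) (a : R) :
  measurable_fun setT f -> (forall x, 0 <= f x)%E ->
  (\int[N]_x f (x + a)%R =
   \int[N]_x (f x * (expR (a * x - a ^+ 2 / 2))%:E))%E.
Proof.
move=> mf f0.
have me : measurable_fun setT (fun x : R => (expR (a * x - a ^+ 2 / 2))%:E).
  apply/measurable_EFinP; apply: measurableT_comp => //.
  by apply: measurable_funB => //; apply: measurable_funM.
rewrite !ge0_integral_normal//; last 3 first.
- by apply: emeasurable_funM.
- by move=> x; rewrite mule_ge0// lee_fin expR_ge0.
- by apply: (measurableT_comp mf); apply: measurable_funD.
transitivity (\int[lebesgue_measure]_x (f (x + a)%R *
    (normal_pdf 0 1 (x + a - a)%R)%:E))%E.
  by apply: eq_integral => x _; rewrite addrK.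
rewrite (@ge0_integral_shift (fun y => (f y * (normal_pdf 0 1 (y - a))%:E)%E)).
- by apply: eq_integral => x _; rewrite normal_pdf_shift -muleA -EFinM [in RHS]mulrC.
- apply: emeasurable_funM => //; apply/measurable_EFinP.
  by apply: (measurableT_comp (measurable_normal_pdf 0 1)); apply: measurable_funB.
- by move=> x; rewrite mule_ge0// lee_fin normal_pdf_ge0.
Qed.

End normal.

(** * First-order expansion in the shift, and moments of the normal law *)

Section normal_moments.
Context (R : realType).
Notation N := (normal_prob (0:R) 1).
Implicit Types (g : R -> R) (a c A z : R).

(** The inequality [1 + y <= expR y], used also at [- y], gives [expR y - 1 <= y * expR y]. Hence
    [expR y - 1 - y] lies between [0] and [y * (expR y - 1)], and the last factor is estimated once
    more according to the sign of [y]. *)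
Lemma expR_sub_affine (y : R) : `|expR y - 1 - y| <= y ^+ 2 * expR `|y|.
Proof.
have h1 := expR_ge1Dx y.
have h2 : expR y - 1 <= y * expR y.
  have := expR_ge1Dx (- y); rewrite expRN => h.
  have := expR_gt0 y => e0.
  have : (1 - y) * expR y <= 1 by rewrite -ler_pdivlMr// mul1r.
  by nra.
rewrite ger0_norm; last by lra.
have [y0|y0] := leP 0 y.
  rewrite ger0_norm//; nra.
have e1 : 1 <= expR `|y| by rewrite -expR0 ler_expR.
have : expR y - 1 - y <= y ^+ 2 by nra.
have := sqr_ge0 y; nra.
Qed.

(** With [m = |z| + 1] the exponent is at most [|a| * m] in absolute value, so its second-order
    remainder is at most [a ^+ 2 * m ^+ 2 * expR m], and [m <= expR m] absorbs the polynomial.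
    Replacing the exponent by [a * z] costs another [a ^+ 2 / 2]. *)
Lemma expR_tilt_expansion a z : `|a| <= 1 ->
  `|expR (a * z - a ^+ 2 / 2) - 1 - a * z| <= a ^+ 2 * (2 * expR (3 * (`|z| + 1))).
Proof.
move=> a1; set y := a * z - _; set m := `|z| + 1.
have m0 : 0 <= m by rewrite addr_ge0.
have a0 : 0 <= `|a| by [].
have aa : a ^+ 2 = `|a| ^+ 2 by rewrite real_normK ?num_real.
have ym : `|y| <= `|a| * m.
  rewrite /y (le_trans (ler_normB _ _))// normrM [X in _ + X]ger0_norm; last first.
    by rewrite divr_ge0// sqr_ge0.
  by rewrite aa /m; nra.
have ym1 : `|y| <= m by rewrite (le_trans ym)// ler_piMl.
have me : m <= expR m by rewrite (le_trans _ (expR_ge1Dx m))// lerDr.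
have e3 : expR (3 * m) = expR m ^+ 3 by rewrite -expRM_natl.
have e1 : 1 <= expR m by rewrite -expR0 ler_expR.
have ey : expR `|y| <= expR m by rewrite ler_expR.
have h1 : `|expR y - 1 - y| <= `|a| ^+ 2 * expR (3 * m).
  rewrite (le_trans (expR_sub_affine y))// -[X in X * _]real_normK ?num_real//.
  rewrite (le_trans (ler_pM _ _ (lexx _) ey)) ?sqr_ge0 ?expR_ge0//.
  rewrite (@le_trans _ _ ((`|a| * m) ^+ 2 * expR m))//.
    by rewrite ler_wpM2r ?expR_ge0// lerXn2r// nnegrE ?mulr_ge0.
  rewrite exprMn -mulrA ler_wpM2l ?sqr_ge0// e3.
  rewrite [leRHS]exprSr ler_wpM2r ?expR_ge0// lerXn2r// nnegrE.
  exact: le_trans me.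
have e31 : 1 <= expR (3 * m) by rewrite e3 exprn_ege1.
rewrite (_ : _ - 1 - a * z = (expR y - 1 - y) - a ^+ 2 / 2); last by rewrite /y; ring.
rewrite (le_trans (ler_normB _ _))// [X in _ + X]ger0_norm; last first.
  by rewrite divr_ge0// sqr_ge0.
rewrite aa; have := sqr_ge0 `|a|; nra.
Qed.

(** No Gaussian integral is computed: the shift formula for the constant function 1 says that
    [expR (c * z - c ^+ 2 / 2)] has integral 1. *)
Lemma integral_normal_expR c : (\int[N]_z (expR (c * z))%:E = (expR (c ^+ 2 / 2))%:E)%E.
Proof.
have mc : measurable_fun setT (fun z : R => (expR (c * z))%:E).
  apply/measurable_EFinP; apply: measurableT_comp => //.
have := @ge0_integral_normal_shift R (cst 1%E) c (measurable_cst _) (fun=> lee01).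
rewrite integral_cst// mul1e => h.
transitivity (\int[N]_z ((expR (c ^+ 2 / 2))%:E * (1 * (expR (c * z - c ^+ 2 / 2))%:E)))%E.
  apply: eq_integral => z _; rewrite mul1e -EFinM -expRD; congr (expR _)%:E; ring.
rewrite ge0_integralZl//.
- by rewrite -h -[RHS]mule1; congr (_ * _)%E; exact: (probability_setT N).
- apply/measurable_EFinP; apply: measurable_funM => //; apply: measurableT_comp => //.
  by apply: measurable_funB => //; exact: measurable_funM.
Qed.

Lemma measurable_expR_normM c : measurable_fun setT (fun z : R => expR (c * `|z|)).
Proof.
apply: measurableT_comp => //; apply: measurable_funM => //; exact: measurableT_comp.
Qed.

Lemma integrable_normal_expR_norm c : N.-integrable setT (EFin \o (fun z => expR (c * `|z|))).
Proof.
have ic b : N.-integrable setT (EFin \o (fun z => expR (b * z))).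
  apply/integrableP; split.
    by apply/measurable_EFinP; exact: measurableT_comp.
  under eq_integral => z _ do rewrite /= ger0_norm ?expR_ge0//.
  by rewrite integral_normal_expR ltry.
apply: le_integrable (integrableD _ (ic c) (ic (- c))) => //.
- by apply/measurable_EFinP; exact: measurable_expR_normM.
- move=> z _; rewrite /= lee_fin [leLHS]ger0_norm ?expR_ge0// [leRHS]ger0_norm ?addr_ge0 ?expR_ge0//.
  have [z0|z0] := leP 0 z; first by rewrite (ger0_norm z0) lerDl expR_ge0.
  by rewrite (ltr0_norm z0) mulrN -mulNr lerDr expR_ge0.
Qed.

Lemma integrable_normal g A c : measurable_fun setT g ->
  (forall z, `|g z| <= A * expR (c * `|z|)) -> N.-integrable setT (EFin \o g).
Proof.
move=> mg gA.
have h := integrableZl measurableT A (integrable_normal_expR_norm c).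
apply: le_integrable h => //; first exact/measurable_EFinP.
move=> z _; rewrite /= lee_fin.
exact/(le_trans (gA z))/ler_norm.
Qed.

Lemma integral_normal_shift (f : R -> \bar R) (a : R) : measurable_fun setT f ->
  (\int[N]_x f (x + a)%R = \int[N]_x (f x * (expR (a * x - a ^+ 2 / 2))%:E))%E.
Proof.
move=> mf; rewrite integralE [RHS]integralE.
have mp := measurable_funepos mf; have mn := measurable_funeneg mf.
have -> : (\int[N]_x (fun x : R => f (x + a)%R)^\+ x = \int[N]_x f^\+ (x + a)%R)%E.
  by apply: eq_integral => x _; rewrite !funeposE.
have -> : (\int[N]_x (fun x : R => f (x + a)%R)^\- x = \int[N]_x f^\- (x + a)%R)%E.
  by apply: eq_integral => x _; rewrite !funenegE.
rewrite !ge0_integral_normal_shift//.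
congr (_ - _)%E; apply: eq_integral => x _.
  rewrite !funeposE muleC [in RHS]muleC maxe_pMr ?mule0// lee_fin expR_ge0//.
rewrite !funenegE muleC [in RHS]muleC -muleN maxe_pMr ?mule0// lee_fin expR_ge0//.
Qed.

(** The shift is moved from [g] to the density, so measurability and exponential growth of [g]
    suffice. Since [K] does not depend on [g], the estimate can be integrated over a family of
    functions with varying [A]; this is how the other coordinates of a Gaussian vector are
    treated. *)
Lemma normal_expansion : exists2 K, 0 <= K & forall g A, measurable_fun setT g ->
  (forall z, `|g z| <= A * expR `|z|) -> forall a, `|a| <= 1 ->
  `|\int[N]_z g (z + a) - \int[N]_z g z - a * \int[N]_z (z * g z)| <= A * K * a ^+ 2.
Proof.
(* The growth [expR |z|] of [g] times the factor [2 * expR (3 * (|z| + 1))] of the tilt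
   expansion. *)
exists (\int[N]_z (2 * expR 3 * expR (4 * `|z|))).
  by apply: Rintegral_ge0 => z _; rewrite !mulr_ge0 ?expR_ge0.
move=> g A mg gA a a1.
have A0 : 0 <= A.
  have := le_trans (normr_ge0 _) (gA 0); by rewrite pmulr_lge0// expR_gt0.
have ze z : `|z| <= expR `|z| by rewrite (le_trans _ (expR_ge1Dx _))// lerDr.
have ig : N.-integrable setT (EFin \o g).
  by apply: (@integrable_normal _ A 1) => // z; rewrite mul1r.
have izg : N.-integrable setT (EFin \o (fun z => z * g z)).
  apply: (@integrable_normal _ A 2) => [|z]; first exact: measurable_funM.
  rewrite normrM mulrC (le_trans (ler_pM _ _ (gA z) (ze z)))//.
  by rewrite -mulrA -expRD -mulr2n mulr_natl.
have K0 : N.-integrable setT (EFin \o (fun z => 2 * expR 3 * expR (4 * `|z|))).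
  exact: (integrableZl measurableT (2 * expR 3) (integrable_normal_expR_norm 4)).
pose r z := expR (a * z - a ^+ 2 / 2) - 1 - a * z.
have mr : measurable_fun setT r.
  apply: measurable_funB; last exact: measurable_funM.
  apply: measurable_funB => //; apply: measurableT_comp => //.
  by apply: measurable_funB => //; exact: measurable_funM.
have grK z : `|g z * r z| <= A * a ^+ 2 * (2 * expR 3 * expR (4 * `|z|)).
  rewrite normrM (le_trans (ler_pM _ _ (gA z) (expR_tilt_expansion z a1)))//.
  rewrite (_ : 3 * (`|z| + 1) = 3 + 3 * `|z|); last by ring.
  rewrite (_ : 4 * `|z| = `|z| + 3 * `|z|); last by ring.
  rewrite !expRD le_eqVlt; apply/orP; left; apply/eqP; ring.
have iK : N.-integrable setT (EFin \o (fun z => A * a ^+ 2 * (2 * expR 3 * expR (4 * `|z|)))).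
  exact: (integrableZl measurableT (A * a ^+ 2) K0).
have igr : N.-integrable setT (EFin \o (fun z => g z * r z)).
  apply: le_integrable iK => //; first by apply/measurable_EFinP; exact: measurable_funM.
  by move=> z _; rewrite /= lee_fin (le_trans (grK z))// ler_norm.
have iazg : N.-integrable setT (EFin \o (fun z => a * (z * g z))).
  exact: (integrableZl measurableT a izg).
have -> : \int[N]_z g (z + a) = \int[N]_z (g z * r z + (g z + a * (z * g z))).
  rewrite /Rintegral (integral_normal_shift a (f := EFin \o g)); last exact/measurable_EFinP.
  congr fine; apply: eq_integral => z _; rewrite /= -EFinM; congr (_%:E); rewrite /r; ring.
rewrite RintegralD//; last exact: (integrableD measurableT ig iazg).
rewrite RintegralD// RintegralZl//.
rewrite (_ : _ + _ - _ - _ = \int[N]_z (g z * r z)); last by ring.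
rewrite (le_trans (le_normr_Rintegral _ _))//.
rewrite (_ : A * _ * _ = A * a ^+ 2 * \int[N]_z (2 * expR 3 * expR (4 * `|z|))); last by ring.
rewrite -RintegralZl//; apply: le_Rintegral => //.
exact: (integrable_norm igr).
Qed.

(** A shift does not change the integral of the constant 1, so [normal_expansion] leaves
    [|a * m| <= K * a ^+ 2] for the mean [m] and all small [a], which forces [m = 0]. *)
Lemma normal_mean0 : \int[N]_z z = 0.
Proof.
have [K K0 h] := normal_expansion.
have {}h a : `|a| <= 1 -> `|a * \int[N]_z z| <= K * a ^+ 2.
  move=> a1; have := h (cst 1) 1 (measurable_cst _) _ a a1.
  under [X in _ - a * X]eq_Rintegral do rewrite /= mulr1.
  rewrite subrr sub0r normrN mul1r; apply => z.
  by rewrite /= normr1 mul1r -expR0 ler_expR.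
set m := \int[N]_z z in h *; apply/eqP/contraT => m0.
have mp : 0 < `|m| by rewrite normr_gt0.
(* This [b] is at most 1 and satisfies [K * b < |m|], contradicting the bound at [a = b]. *)
pose b := `|m| / (1 + K + `|m|).
have d0 : 0 < 1 + K + `|m| by lra.
have b0 : 0 < b by rewrite divr_gt0.
have bE : b * (1 + K + `|m|) = `|m| by rewrite divfK// gt_eqF.
have b1 : `|b| <= 1 by rewrite gtr0_norm// ler_pdivrMr// mul1r; lra.
have := h b b1; rewrite normrM (gtr0_norm b0); nra.
Qed.

(** The single function [expR (4 * |z|)] dominates [1], [|z|], [z ^+ 2] and [z ^+ 4] pointwise, so
    one constant replaces all the moments that occur. *)
Definition gauss_const : R := \int[N]_z expR (4 * `|z|).

Lemma normal_moment_bound : 1 <= gauss_const /\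
  [/\ \int[N]_z `|z| <= gauss_const, \int[N]_z (z ^+ 2) <= gauss_const &
      \int[N]_z (z ^+ 4) <= gauss_const].
Proof.
have ze z : `|z| <= expR `|z| by rewrite (le_trans _ (expR_ge1Dx _))// lerDr.
have e1 z : 1 <= expR `|z| by rewrite -expR0 ler_expR.
have e4 z : expR (4 * `|z|) = expR `|z| ^+ 4 by rewrite -expRM_natl.
have i4 := integrable_normal_expR_norm 4.
have b1 z : `|z| <= expR (4 * `|z|).
  by rewrite (le_trans (ze z))// e4 ler_eXnr.
have b2 z : `|z ^+ 2| <= expR (4 * `|z|).
  rewrite normrX e4 (@le_trans _ _ (expR `|z| ^+ 2))//.
    by rewrite lerXn2r// nnegrE expR_ge0.
  by rewrite ler_weXn2l.
have b4 z : `|z ^+ 4| <= expR (4 * `|z|).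
  by rewrite normrX e4 lerXn2r// nnegrE expR_ge0.
have le g : measurable_fun setT g -> (forall z, `|g z| <= expR (4 * `|z|)) ->
    \int[N]_z g z <= \int[N]_z expR (4 * `|z|).
  move=> mg gb; apply: le_Rintegral => //; last by move=> z _; exact: le_trans (ler_norm _) (gb z).
  by apply: (@integrable_normal _ 1 4) => // z; rewrite mul1r.
split.
  have N1 : \int[N]_z (cst 1 z) = 1 :> R.
    rewrite Rintegral_cst// mul1r.
    by transitivity (fine (1%E : \bar R)) => //; congr fine; exact: (probability_setT N).
  apply: (@le_trans _ _ (\int[N]_z (cst 1 z))); first by rewrite N1.
  apply: le_Rintegral => //.
    exact: (finite_measure_integrable_cst N).
  by move=> z _; rewrite -expR0 ler_expR mulr_ge0.
split; apply: le => //; first by move=> z; rewrite normr_id.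
Qed.

End normal_moments.

(** * Independence and Fubini *)

Section integral_indep.
Local Open Scope ereal_scope.
Context (R : realType) (dO d1 d2 : measure_display) (Omega : measurableType dO)
  (T1 : measurableType d1) (T2 : measurableType d2) (P : probability Omega R).
Variables (X : {RV P >-> T1}) (Y : {RV P >-> T2}).
Hypothesis XY : forall A B, measurable A -> measurable B ->
  P (X @^-1` A `&` Y @^-1` B) = P (X @^-1` A) * P (Y @^-1` B).

Let Z w := (X w, Y w).
Let mZ : measurable_fun setT Z. Proof. exact: measurable_fun_pair. Qed.
HB.instance Definition _ := isMeasurableFun.Build _ _ _ _ Z mZ.
Let ZRV : {RV P >-> (T1 * T2)%type} := Z.

Lemma distribution_pair_indep (A : set (T1 * T2)) : measurable A ->
  (distribution P X \x distribution P Y) A = distribution P ZRV A.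
Proof.
by move=> mA; apply: product_measure_unique => // B C mB mC; rewrite -XY.
Qed.

(** Substitute for conditioning on [X]: under independence the joint law is the product of the laws,
    so [Y] may be integrated out with [X] frozen. *)
Lemma ge0_integral_indep (h : T1 * T2 -> \bar R) :
  measurable_fun setT h -> (forall z, 0 <= h z) ->
  \int[P]_w h (X w, Y w) = \int[P]_w \int[distribution P Y]_y h (X w, y).
Proof.
move=> mh h0.
transitivity (\int[distribution P ZRV]_z h z).
  by rewrite ge0_integral_distribution.
rewrite -(@eq_measure_integral _ _ _ _ _ (distribution P X \x distribution P Y)); last first.
  by move=> A mA _; exact: distribution_pair_indep.
rewrite fubini_tonelli1// ge0_integral_distribution//.
  exact: measurable_fun_fubini_tonelli_F.
by move=> x; exact: integral_ge0.
Qed.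

(** Every section, not just almost every one, is taken integrable, so the real-valued inner integral
    agrees everywhere with the extended one of Fubini's theorem. *)
Lemma Rintegral_indep (h : T1 * T2 -> R) : measurable_fun setT h ->
  P.-integrable setT (fun w => (h (X w, Y w))%:E) ->
  (forall x, (distribution P Y).-integrable setT (fun y => (h (x, y))%:E)) ->
  P.-integrable setT (fun w => (\int[distribution P Y]_y h (X w, y))%:E) /\
  (\int[P]_w h (X w, Y w) = \int[P]_w \int[distribution P Y]_y h (X w, y))%R.
Proof.
move=> mh ih ihY.
have mhE : measurable_fun setT (EFin \o h) by exact/measurable_EFinP.
have iZ : (distribution P ZRV).-integrable setT (EFin \o h).
  exact: integrable_pushforward.
have i12 : (distribution P X \x distribution P Y).-integrable setT (EFin \o h).
  apply/integrableP; split => //; move/integrableP : iZ => [_ iZ].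
  apply: le_lt_trans iZ; rewrite le_eqVlt; apply/orP; left; apply/eqP.
  by apply: eq_measure_integral => A mA _; exact: distribution_pair_indep.
have FE x : fubini_F (distribution P Y) (EFin \o h) x =
    (\int[distribution P Y]_y h (x, y))%:E.
  by rewrite /fubini_F /Rintegral fineK//; apply: integrable_fin_num.
have iF := integrable_fubini_F i12.
have mF := measurable_fubini_F i12.
have iFX : P.-integrable setT (fubini_F (distribution P Y) (EFin \o h) \o X).
  apply/integrableP; split; first exact: measurableT_comp mF _.
  move/integrableP : iF => [_]; rewrite ge0_integral_distribution//.
  exact: measurableT_comp.
split.
  by apply: eq_integrable iFX => // w _; rewrite /= FE.
rewrite /Rintegral; congr fine.
transitivity (\int[distribution P ZRV]_z (EFin \o h) z).
  by rewrite integral_distribution.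
rewrite -(@eq_measure_integral _ _ _ _ _ (distribution P X \x distribution P Y)); last first.
  by move=> A mA _; exact: distribution_pair_indep.
rewrite -integral12_prod_meas1// integral_distribution//.
by apply: eq_integral => w _; rewrite /= FE.
Qed.

End integral_indep.

(** * Independence of generated sigma-algebras *)

Section independent_sigma_algebra.
Local Open Scope ereal_scope.
Context (R : realType) (dO : measure_display) (Omega : measurableType dO)
  (P : probability Omega R) (I : choiceType) (S : I -> set (set Omega)).
Hypothesis indS : mutual_independence P S.
Hypothesis S_T : forall i, S i setT.
Hypothesis S_I : forall i, setI_closed (S i).
Hypothesis S_m : forall i, S i `<=` measurable.

(** A pi-lambda argument: finite intersections of events from the [S j] form a pi-system [G]
    generating the sigma-algebra, and the finite measures [P (A & B)] and [P A * P B] of [A] agree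
    on [G] by mutual independence. *)
Lemma mutual_independence_sigma_algebra (J : set I) (i : I) (A B : set Omega) :
  ~ J i -> <<s \bigcup_(j in J) S j >> A -> S i B -> P (A `&` B) = P A * P B.
Proof.
move=> Ji JA SB; have mB : measurable B := S_m SB.
pose G := [set C | exists2 K : {fset I}, [set` K] `<=` J &
  exists2 E : I -> set Omega, (forall k, k \in K -> S k (E k)) &
    C = \bigcap_(k in [set` K]) E k].
have GI : setI_closed G.
  move=> _ _ [K1 K1J [E1 SE1 ->]] [K2 K2J [E2 SE2 ->]].
  exists (K1 `|` K2)%fset; first by move=> k /=; rewrite in_fsetU => /orP[/K1J|/K2J].
  exists (fun k => (if k \in K1 then E1 k else setT) `&`
                   (if k \in K2 then E2 k else setT)).
    move=> k _; apply: S_I; first by case: ifPn => [/SE1//|_]; exact: S_T.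
    by case: ifPn => [/SE2//|_]; exact: S_T.
  apply/seteqP; split => [w [w1 w2] k _|w wE].
    by split; case: ifPn => // kK; [exact: w1|exact: w2].
  split=> k /= kK; have /= := wE k; rewrite in_fsetU kK ?orbT => /(_ isT)[].
    by [].
  by [].
have GT : G setT.
  exists fset0 => [k|]; first by rewrite /= in_fset0.
  exists (fun=> setT) => //; apply/seteqP; split => // w _ k //.
have Gm : G `<=` measurable.
  move=> _ [K _ [E SE ->]]; apply: fin_bigcap_measurable => //.
  by move=> k /= kK; exact: S_m (SE k kK).
have SG : \bigcup_(j in J) S j `<=` G.
  move=> C [j Jj SC]; exists [fset j]%fset; first by move=> k /=; rewrite in_fset1 => /eqP ->.
  exists (fun=> C); first by move=> k; rewrite in_fset1 => /eqP ->.
  by rewrite set_fset1 bigcap_set1.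
pose b : {nonneg R} := NngNum (fine_ge0 (measure_ge0 P B)).
have bE : (b%:num)%:E = P B by rewrite /= fineK// fin_num_measure.
have GA : <<s G >> A.
  apply: smallest_sub JA; first exact: smallest_sigma_algebra.
  by move=> C /SG GC; exact: sub_sigma_algebra.
rewrite -bE muleC -[LHS]/(mrestr P mB A) -[RHS]/(mscale b P A).
apply: (@g_sigma_algebra_measure_unique _ _ _ G _ (fun=> setT) _ _
  (mrestr P mB) (mscale b P)) => //.
- by apply/seteqP; split => // w _; exists 0%N.
- move=> _ [K KJ [E SE ->]]; rewrite -[LHS]/(P (_ `&` B)) -[RHS]/((b%:num)%:E * P _) bE muleC.
  have iK : i \notin K by apply/negP => /KJ.
  (* As [i] lies outside [J], the event [B] can be inserted as one more member of the finite
     family. *)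
  pose E' k := if k == i then B else E k.
  have -> : \bigcap_(k in [set` K]) E k `&` B = \bigcap_(k in [set` (i |` K)%fset]) E' k.
    apply/seteqP; split => [w [wE wB] k /=|w wE].
      by rewrite in_fset1U /E'; case: eqP => // _ /=; exact: wE.
    split=> [k /= kK|]; last first.
      by have /= := wE i; rewrite fset1U1 /E' eqxx => /(_ isT).
    have /= := wE k; rewrite in_fset1U kK orbT /E' => /(_ isT).
    by case: eqP kK iK => // -> ->.
  rewrite !indS//.
    rewrite big_fsetU1//= {1}/E' eqxx muleC; congr (_ * _).
    rewrite !big_seq; apply: eq_bigr => k kK; rewrite /E'.
    by case: eqP kK iK => // -> ->.
  move=> k; rewrite in_fset1U /E'; case: eqP => [-> //|_ /=]; exact: SE.
- by move=> _; change (P (setT `&` B) < +oo); rewrite setTI ltey_eq fin_num_measure.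
Qed.

End independent_sigma_algebra.

(** * The law of a standard Gaussian vector and of its coordinates *)

Section standard_gaussian_law.
Local Open Scope ereal_scope.
Context (R : realType) (d : nat).

(** The vector [v] defining the smoothed function and the directions [u t] live on different
    probability spaces; this lemma transfers integrals from one to the other. Independence of the
    coordinates fixes the law on boxes, a pi-system generating the product sigma-algebra. *)
Lemma std_gaussian_law (d1 d2 : measure_display) (O1 : measurableType d1)
    (O2 : measurableType d2) (P1 : probability O1 R) (P2 : probability O2 R)
    (v1 : {RV P1 >-> d.-tuple R}) (v2 : {RV P2 >-> d.-tuple R}) (A : set (d.-tuple R)) :
  std_gaussian v1 -> std_gaussian v2 -> measurable A ->
  distribution P1 v1 A = distribution P2 v2 A.
Proof.
move=> [m1 i1] [m2 i2] mA.
pose box (B : 'I_d -> set R) := [set t : d.-tuple R | forall i, B i (tnth t i)].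
pose G := [set C | exists2 B, (forall i, measurable (B i)) & C = box B].
have boxE B : box B = \bigcap_(i in [set: 'I_d]) ((@tnth d R)^~ i @^-1` B i).
  by apply/seteqP; split => [t tB i _|t tB i]; [exact: tB|exact: tB].
have Gm : G `<=` measurable.
  move=> _ [B mB ->]; rewrite boxE; apply: fin_bigcap_measurable => // i _.
  by rewrite -[X in measurable X]setTI; exact: measurable_tnth.
have GI : setI_closed G.
  move=> _ _ [B mB ->] [C mC ->]; exists (fun i => B i `&` C i).
    by move=> i; exact: measurableI.
  by apply/seteqP; split => [t [tB tC] i|t tBC]; split => //; move=> i; case: (tBC i).
have GT : G setT by exists (fun=> setT) => //; apply/seteqP; split.
have GA : <<s G >> A.
  apply: smallest_sub mA; first exact: smallest_sigma_algebra.
  move=> C; rewrite -bigcup_seq/= => -[i _ [B mB <-]]; apply: sub_sigma_algebra.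
  exists (fun j => if j == i then B else setT); first by move=> j; case: ifP.
  rewrite setTI; apply/seteqP; split => [t tB j|t /(_ i)]; last by rewrite eqxx.
  by case: eqP => // ->.
have law (dO : measure_display) (O : measurableType dO) (P : probability O R)
    (v : {RV P >-> d.-tuple R}) B : std_gaussian v -> (forall i, measurable (B i)) ->
  P (v @^-1` box B) = \prod_(i <- [fset i | i : 'I_d]%fset) normal_prob 0 1 (B i).
  move=> [mv iv] mB; rewrite -[LHS]/(P _) boxE preimage_bigcap.
  pose E i := [set w | B i (tnth (v w) i)].
  rewrite (_ : \bigcap_(i in _) _ = \bigcap_(i in [set` [fset i | i : 'I_d]%fset]) E i).
    rewrite iv; first by apply: eq_bigr => i _; exact: mv.
    by move=> i _; exists (B i) => //; rewrite setTI.
  by apply/seteqP; split => [w wB i _|w wB i _]; apply: wB => //=; rewrite inE.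
apply: (@g_sigma_algebra_measure_unique _ _ _ G _ (fun=> setT) _ _
  (distribution P1 v1) (distribution P2 v2)) => //.
- by apply/seteqP; split => // w _; exists 0%N.
- by move=> _ [B mB ->]; rewrite -[LHS]/(P1 (v1 @^-1` box B)) -[RHS]/(P2 (v2 @^-1` box B)) !law.
- by move=> _; rewrite ltey_eq fin_num_measure.
Qed.

Variables (dO : measure_display) (O : measurableType dO) (P : probability O R)
  (v : {RV P >-> d.-tuple R}).
Hypothesis gv : std_gaussian v.

Definition coordinate (i : 'I_d) (w : O) : R := tnth (v w) i.

Lemma measurable_coordinate i : measurable_fun setT (coordinate i).
Proof. exact: (measurableT_comp (measurable_tnth i)). Qed.

HB.instance Definition _ i :=
  isMeasurableFun.Build _ _ _ _ (coordinate i) (measurable_coordinate i).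

(** A random variable whose law is the normal law itself, so that a coordinate and a scalar normal
    are compared through their distributions. *)
Let idR (x : measurableTypeR R) : R := x.
Let mid : measurable_fun setT idR. Proof. by move=> _ B mB; rewrite setTI. Qed.
HB.instance Definition _ := isMeasurableFun.Build _ _ _ _ idR mid.

Let coordinate_measure i (A : set R) : measurable A ->
  distribution P (coordinate i : {RV P >-> R}) A =
  distribution (normal_prob 0 1) (idR : {RV normal_prob 0 1 >-> R}) A.
Proof. by move=> mA; have [+ _] := gv; apply. Qed.

Let N1 := normal_prob (0%R : R) 1%R.

Lemma ge0_integral_coordinate i (f : R -> \bar R) :
  measurable_fun setT f -> (forall x, 0 <= f x) ->
  \int[P]_w f (coordinate i w) = \int[N1]_z f z.
Proof.
move=> mf f0.
transitivity (\int[distribution P (coordinate i : {RV P >-> R})]_z f z).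
  by rewrite ge0_integral_distribution.
rewrite (@eq_measure_integral _ _ _ _
  (distribution (normal_prob 0 1) (idR : {RV normal_prob 0 1 >-> R}))).
  by rewrite ge0_integral_distribution.
by move=> A mA _; exact: coordinate_measure.
Qed.

Lemma integrable_coordinate i (g : R -> R) : N1.-integrable setT (EFin \o g) ->
  measurable_fun setT g ->
  (distribution P (coordinate i : {RV P >-> R})).-integrable setT (EFin \o g).
Proof.
move=> /integrableP[_ ig] mg.
have mgE : measurable_fun setT (EFin \o g) by exact/measurable_EFinP.
apply/integrableP; split => //; rewrite ge0_integral_distribution//; last exact: measurableT_comp.
rewrite (ge0_integral_coordinate i (f := abse \o (EFin \o g)))//.
  exact: measurableT_comp.
by move=> x; exact: abse_ge0.
Qed.

Lemma Rintegral_coordinate i (g : R -> R) : N1.-integrable setT (EFin \o g) ->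
  measurable_fun setT g ->
  (\int[distribution P (coordinate i : {RV P >-> R})]_z g z = \int[N1]_z g z)%R.
Proof.
move=> ig mg; have mgE : measurable_fun setT (EFin \o g) by exact/measurable_EFinP.
rewrite /Rintegral; congr fine.
rewrite (@eq_measure_integral _ _ _ _
  (distribution (normal_prob 0 1) (idR : {RV normal_prob 0 1 >-> R}))).
  by rewrite integral_distribution.
by move=> A mA _; exact: coordinate_measure.
Qed.

End standard_gaussian_law.

(** * Euclidean vectors *)

Section euclid.
Context (R : realType) (d : nat).
Implicit Types x y z : 'rV[R]_d.

Definition dotv x y : R := \sum_(i < d) x ord0 i * y ord0 i.
Definition sqn x : R := \sum_(i < d) x ord0 i ^+ 2.

Lemma sqn_ge0 x : 0 <= sqn x.
Proof. by apply: sumr_ge0 => i _; exact: sqr_ge0. Qed.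

Lemma l2norm_ge0 x : 0 <= l2norm x.
Proof. exact: sqrtr_ge0. Qed.

Lemma l2norm_sqr x : l2norm x ^+ 2 = sqn x.
Proof. by rewrite sqr_sqrtr// sqn_ge0. Qed.

Lemma le_l2norm (c : R) x : 0 <= c -> sqn x <= c ^+ 2 -> l2norm x <= c.
Proof.
by move=> c0 xc; rewrite -(ler_pXn2r (ltn0Sn 1)) ?nnegrE ?l2norm_ge0// l2norm_sqr.
Qed.

Lemma dotvv x : dotv x x = sqn x.
Proof. by apply: eq_bigr => i _; rewrite expr2. Qed.

Lemma dotvC x y : dotv x y = dotv y x.
Proof. by apply: eq_bigr => i _; rewrite mulrC. Qed.

Lemma dotvDl x y z : dotv (x + y) z = dotv x z + dotv y z.
Proof. by rewrite -big_split; apply: eq_bigr => i _; rewrite mxE mulrDl. Qed.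

Lemma dotvZl (c : R) x z : dotv (c *: x) z = c * dotv x z.
Proof. by rewrite /dotv mulr_sumr; apply: eq_bigr => i _; rewrite mxE mulrA. Qed.

Lemma dotvNl x z : dotv (- x) z = - dotv x z.
Proof. by rewrite -scaleN1r dotvZl mulN1r. Qed.

Lemma dotvBl x y z : dotv (x - y) z = dotv x z - dotv y z.
Proof. by rewrite dotvDl dotvNl. Qed.

Lemma dotvDr x y z : dotv z (x + y) = dotv z x + dotv z y.
Proof. by rewrite !(dotvC z) dotvDl. Qed.

Lemma dotvZr (c : R) x z : dotv z (c *: x) = c * dotv z x.
Proof. by rewrite !(dotvC z) dotvZl. Qed.

Lemma sqnZ (c : R) x : sqn (c *: x) = c ^+ 2 * sqn x.
Proof. by rewrite -!dotvv dotvZl dotvZr mulrA. Qed.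

Lemma sqnN x : sqn (- x) = sqn x.
Proof. by rewrite -scaleN1r sqnZ sqrrN expr1n mul1r. Qed.

Lemma sqnD x y : sqn (x + y) = sqn x + 2 * dotv x y + sqn y.
Proof. rewrite -!dotvv dotvDl !dotvDr (dotvC y x); ring. Qed.

Lemma dotv_le_sqn x y : 2 * dotv x y <= sqn x + sqn y.
Proof. have := sqn_ge0 (x - y); rewrite sqnD sqnN -scaleN1r dotvZr; lra. Qed.

Lemma sqnD_le x y : sqn (x + y) <= 2 * (sqn x + sqn y).
Proof. rewrite sqnD; have := dotv_le_sqn x y; lra. Qed.

Lemma sqnD3_le x y z : sqn (x + y + z) <= 3 * (sqn x + sqn y + sqn z).
Proof.
rewrite !sqnD dotvDl; have := dotv_le_sqn x y; have := dotv_le_sqn x z.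
have := dotv_le_sqn y z; lra.
Qed.

Lemma l2normN x : l2norm (- x) = l2norm x.
Proof. by rewrite /l2norm -/(sqn _) sqnN. Qed.

Lemma l2normZ (c : R) x : l2norm (c *: x) = `|c| * l2norm x.
Proof.
by rewrite /l2norm -/(sqn _) sqnZ sqrtrM ?sqr_ge0// sqrtr_sqr.
Qed.

Lemma cauchy_schwarz x y : dotv x y <= l2norm x * l2norm y.
Proof.
have [x0|x0] := eqVneq (l2norm x) 0.
  have sx : sqn x = 0 by rewrite -l2norm_sqr x0 expr0n.
  rewrite x0 mul0r /dotv big1// => i _.
  move/eqP: sx; rewrite psumr_eq0; last by move=> j _; exact: sqr_ge0.
  by move/allP => /(_ i (mem_index_enum _)); rewrite sqrf_eq0 => /eqP ->; rewrite mul0r.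
have [y0|y0] := eqVneq (l2norm y) 0.
  have sy : sqn y = 0 by rewrite -l2norm_sqr y0 expr0n.
  rewrite y0 mulr0 /dotv big1// => i _.
  move/eqP: sy; rewrite psumr_eq0; last by move=> j _; exact: sqr_ge0.
  by move/allP => /(_ i (mem_index_enum _)); rewrite sqrf_eq0 => /eqP ->; rewrite mulr0.
have px : 0 < l2norm x by rewrite lt_def x0 l2norm_ge0.
have py : 0 < l2norm y by rewrite lt_def y0 l2norm_ge0.
have := dotv_le_sqn ((l2norm x)^-1 *: x) ((l2norm y)^-1 *: y).
rewrite dotvZl dotvZr !sqnZ -!l2norm_sqr -!exprMn !mulVf// expr1n.
move=> h; have : (l2norm x)^-1 * ((l2norm y)^-1 * dotv x y) <= 1 by lra.
by rewrite mulrA -invfM mulrC ler_pdivrMr ?mulr_gt0// mul1r.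
Qed.

Lemma cauchy_schwarz_norm x y : `|dotv x y| <= l2norm x * l2norm y.
Proof.
rewrite ler_norml cauchy_schwarz andbT lerNl -dotvNl.
by rewrite (le_trans (cauchy_schwarz _ _))// l2normN.
Qed.

Lemma coord_le_l2norm x i : `|x ord0 i| <= l2norm x.
Proof.
rewrite -sqrtr_sqr ler_wsqrtr// (bigD1 i)//= lerDl.
by apply: sumr_ge0 => j _; exact: sqr_ge0.
Qed.

Lemma sqn_delta (c : R) (i : 'I_d) : sqn (c *: delta_mx ord0 i) = c ^+ 2.
Proof.
rewrite sqnZ /sqn (bigD1 i)//= big1 ?addr0 => [|j ji]; first by rewrite mxE !eqxx expr1n mulr1.
by rewrite mxE (negbTE ji) andbF expr0n.
Qed.

Lemma l2norm_delta (c : R) (i : 'I_d) : l2norm (c *: delta_mx ord0 i) = `|c|.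
Proof. by rewrite /l2norm -/(sqn _) sqn_delta sqrtr_sqr. Qed.

Lemma dotv_delta x (c : R) (i : 'I_d) : dotv x (c *: delta_mx ord0 i) = c * x ord0 i.
Proof.
rewrite dotvZr /dotv (bigD1 i)//= big1 ?addr0 => [|j ji]; first by rewrite mxE !eqxx mulr1.
by rewrite mxE (negbTE ji) andbF mulr0.
Qed.

Lemma sum_norm_le_l2norm x : \sum_(i < d) `|x ord0 i| <= Num.sqrt d%:R * l2norm x.
Proof.
pose y : 'rV[R]_d := \row_i `|x ord0 i|; pose e : 'rV[R]_d := \row_i 1.
have -> : \sum_(i < d) `|x ord0 i| = dotv e y.
  by apply: eq_bigr => i _; rewrite !mxE mul1r.
have -> : l2norm x = l2norm y.
  by congr Num.sqrt; apply: eq_bigr => i _; rewrite mxE real_normK ?num_real.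
rewrite (le_trans (cauchy_schwarz _ _))// ler_wpM2r ?l2norm_ge0//.
rewrite ler_wsqrtr// le_eqVlt; apply/orP; left; apply/eqP.
under eq_bigr do rewrite mxE expr1n.
by rewrite sumr_const card_ord.
Qed.

(** Lets dominating functions be affine in the squared norm, so that second moments give
    integrability. *)
Lemma l2norm_le_sqn x : l2norm x <= 1 + sqn x.
Proof. rewrite -l2norm_sqr; have := sqr_ge0 (l2norm x - 1); have := l2norm_ge0 x; nra. Qed.

(** Cauchy-Schwarz against the all-ones vector reduces the fourth moment of the norm to fourth
    moments of the coordinates. *)
Lemma sqr_sqn_le x : sqn x ^+ 2 <= d%:R * \sum_(i < d) x ord0 i ^+ 4.
Proof.
pose y : 'rV[R]_d := \row_i x ord0 i ^+ 2; pose e : 'rV[R]_d := \row_i 1.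
have -> : sqn x = dotv e y by apply: eq_bigr => i _; rewrite !mxE mul1r.
have -> : \sum_(i < d) x ord0 i ^+ 4 = sqn y.
  by apply: eq_bigr => i _; rewrite mxE -exprM.
have -> : d%:R = sqn e.
  under [RHS]eq_bigr do rewrite mxE expr1n.
  by rewrite sumr_const card_ord.
rewrite -!l2norm_sqr -exprMn -[leLHS]real_normK ?num_real// lerXn2r ?nnegrE ?mulr_ge0 ?l2norm_ge0//.
exact: cauchy_schwarz_norm.
Qed.

Lemma rat_dense (x : 'rV[R]_d) (e : R) : 0 < e ->
  exists q : 'rV[rat]_d, l2norm (x - map_mx ratr q) < e.
Proof.
(* Coordinate errors of at most [c] give a norm of at most [d * c], strictly below [e] also when
   [d = 0]. *)
move=> e0; pose c := e / (d%:R + 1).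
have d1 : 0 < d%:R + 1 :> R by rewrite ltr_wpDl.
have c0 : 0 < c by rewrite divr_gt0.
have /choice[q qP] (i : 'I_d) : exists r : rat, `|x ord0 i - ratr r| <= c.
  have xc : x ord0 i < x ord0 i + c by rewrite ltrDl.
  have [r] := rat_in_itvoo xc.
  rewrite in_itv/= => /andP[r1 r2]; exists r; rewrite ler_norml; apply/andP; split; lra.
exists (\row_i q i); apply: (@le_lt_trans _ _ (d%:R * c)).
  apply: le_l2norm; first by rewrite mulr_ge0// ltW.
  rewrite (@le_trans _ _ (\sum_(i < d) c ^+ 2))//.
    apply: ler_sum => i _; rewrite !mxE -[leLHS]real_normK ?num_real//.
    by rewrite lerXn2r ?nnegrE// ltW.
  have -> : \sum_(i < d) c ^+ 2 = d%:R * c ^+ 2 by rewrite sumr_const card_ord mulr_natl.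
  rewrite (exprMn _ d%:R) ler_wpM2r ?sqr_ge0//.
  case: (d) => [|n]; first by rewrite expr0n.
  by rewrite ler_eXnr// ler1n.
have : c * (d%:R + 1) = e by rewrite divfK// gt_eqF.
by rewrite mulrDr mulr1 mulrC => <-; rewrite ltrDl.
Qed.

End euclid.

(** * Joint measurability of Lipschitz integrands *)

Section measurable_lipschitz.
Context (R : realType) (d : nat) (d1 d2 : measure_display)
  (T : measurableType d1) (Xi : measurableType d2).

Lemma measurable_l2norm (X : T -> 'rV[R]_d) :
  (forall i, measurable_fun setT (fun w => X w ord0 i)) ->
  measurable_fun setT (fun w => l2norm (X w)).
Proof.
move=> mX; apply: (measurableT_comp (f := @Num.sqrt R)).
  apply: continuous_measurable_fun; exact: sqrt_continuous.
by apply: measurable_sum => i; exact: measurable_funX.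
Qed.

Lemma measurable_sqn (X : T -> 'rV[R]_d) :
  (forall i, measurable_fun setT (fun w => X w ord0 i)) ->
  measurable_fun setT (fun w => sqn (X w)).
Proof. by move=> mX; apply: measurable_sum => i; exact: measurable_funX. Qed.

(* A function measurable in [s] and Lipschitz in [x] is jointly measurable, since
   [F x s < c] iff [F q s + L * l2norm (x - q) < c] for some rational [q]. *)
Lemma measurable_lipschitz_comp (F : 'rV[R]_d -> Xi -> R) (L : R)
    (X : T -> 'rV[R]_d) (Y : T -> Xi) : 0 <= L ->
  (forall s x y, `|F x s - F y s| <= L * l2norm (x - y)) ->
  (forall x, measurable_fun setT (F x)) ->
  (forall i, measurable_fun setT (fun w => X w ord0 i)) ->
  measurable_fun setT Y ->
  measurable_fun setT (fun w => F (X w) (Y w)).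
Proof.
move=> L0 lip mF mX mY.
(* Numbers that encode no rational vector are sent to 0; this is harmless because [h n] lies above
   [F (X w) (Y w)] whatever the point [q n]. *)
pose q n : 'rV[R]_d := if (choice.unpickle n : option 'rV[rat]_d) is Some r then map_mx ratr r else 0.
pose h n w := F (q n) (Y w) + L * l2norm (X w - q n).
have mh n : measurable_fun setT (h n).
  apply: measurable_funD; first exact: measurableT_comp.
  apply: measurable_funM => //; apply: measurable_l2norm => i.
  under eq_fun do rewrite !mxE.
  exact: measurable_funD.
move=> mT; apply: (measurability _ (RGenInftyO.measurableE R)) => //= _ [_ [c ->] <-].
rewrite setTI (_ : _ @^-1` _ = \bigcup_n (h n @^-1` `]-oo, c[)).
  by apply: bigcupT_measurable => n; rewrite -[X in measurable X]setTI; exact: mh.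
apply/seteqP; split => w /=.
  rewrite in_itv/= => Fc.
  (* At distance less than [e] from [X w] the majorant exceeds [F (X w) (Y w)] by at most
     [2 * L * e], which is below the gap to [c]. *)
  pose e := (c - F (X w) (Y w)) / (2 * L + 1).
  have L1 : 0 < 2 * L + 1 by lra.
  have e0 : 0 < e by rewrite divr_gt0// subr_gt0.
  have eE : e * (2 * L + 1) = c - F (X w) (Y w) by rewrite divfK// gt_eqF.
  have [r re] := rat_dense (X w) e0.
  exists (choice.pickle r) => //=; rewrite in_itv/= /h /q choice.pickleK.
  have := lip (Y w) (X w) (map_mx ratr r); rewrite ler_norml => /andP[+ _].
  have := l2norm_ge0 (X w - map_mx ratr r); nra.
move=> [n _]; rewrite /= !in_itv/=; apply: le_lt_trans; rewrite /h.
have := lip (Y w) (X w) (q n); rewrite ler_norml => /andP[_]; lra.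
Qed.

End measurable_lipschitz.

Section Rintegral_sum.
Context (d : measure_display) (T : measurableType d) (R : realType)
  (mu : {measure set T -> \bar R}) (I : Type) (f : I -> T -> R).
Hypothesis fi : forall i, mu.-integrable setT (EFin \o f i).

Lemma integrable_Rsum (s : seq I) : mu.-integrable setT (EFin \o (fun x => \sum_(i <- s) f i x)).
Proof.
have -> : EFin \o (fun x => \sum_(i <- s) f i x) = (fun x => \sum_(i <- s) (f i x)%:E)%E.
  by apply/funext => x /=; rewrite sumEFin.
by apply: integrable_sum => // i _; exact: fi.
Qed.

Lemma Rintegral_sum (s : seq I) : \int[mu]_x (\sum_(i <- s) f i x) = \sum_(i <- s) \int[mu]_x f i x.
Proof.
elim: s => [|i s ih].
  by rewrite big_nil; under eq_Rintegral do rewrite big_nil; rewrite /Rintegral integral0.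
rewrite big_cons -ih -RintegralD//; last exact: integrable_Rsum.
by apply: eq_Rintegral => x _; rewrite big_cons.
Qed.

End Rintegral_sum.

(** * Moments of Gaussian vectors *)

Section gaussian_moments.
Context (R : realType) (d : nat) (dO : measure_display) (O : measurableType dO)
  (P : probability O R) (v : {RV P >-> d.-tuple R}).
Hypothesis gv : std_gaussian v.
Notation N := (normal_prob (0:R) 1).
Notation c := (gauss_const R).

Lemma gauss_const_ge1 : 1 <= c.
Proof. by have [] := normal_moment_bound R. Qed.

Lemma integrable_normalX n : N.-integrable setT (EFin \o (fun z : R => z ^+ n)).
Proof.
apply: (@integrable_normal _ _ 1 n%:R); first exact: exprn_measurable.
move=> z; rewrite mul1r expRM_natl normrX lerXn2r ?nnegrE ?expR_ge0//.
by rewrite (le_trans _ (expR_ge1Dx _))// lerDr.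
Qed.

Lemma integrable_gaussian (i : 'I_d) (g : R -> R) :
  measurable_fun setT g -> N.-integrable setT (EFin \o g) ->
  P.-integrable setT (fun w => (g (rowof (v w) ord0 i))%:E) /\
  \int[P]_w g (rowof (v w) ord0 i) = \int[N]_z g z.
Proof.
move=> mg ig; under eq_fun do rewrite mxE.
have mgE : measurable_fun setT (EFin \o g) by exact/measurable_EFinP.
have iP : P.-integrable setT (fun w => (g (coordinate v i w))%:E).
  apply/integrableP; split.
    by apply/measurable_EFinP; apply: measurableT_comp => //; exact: measurable_coordinate.
  rewrite (ge0_integral_coordinate gv i (f := abse \o (EFin \o g)))//.
  - by move/integrableP : ig => [].
  - exact: measurableT_comp.
  - by move=> x; exact: abse_ge0.
split => //; rewrite -(Rintegral_coordinate gv i ig mg).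
rewrite /Rintegral integral_distribution//; congr fine.
by apply: eq_integral => w _; rewrite /= mxE.
Qed.

Lemma measurable_rowof i : measurable_fun setT (fun w => rowof (v w) ord0 i).
Proof. by under eq_fun do rewrite mxE; exact: measurable_coordinate. Qed.

Lemma gaussian_mean0 i : P.-integrable setT (fun w => (rowof (v w) ord0 i)%:E) /\
  \int[P]_w rowof (v w) ord0 i = 0.
Proof.
rewrite -(normal_mean0 R); apply: (@integrable_gaussian i id) => //.
exact: (integrable_normalX 1).
Qed.

Lemma gaussian_abs_moment i :
  P.-integrable setT (fun w => (`|rowof (v w) ord0 i|)%:E) /\
  \int[P]_w `|rowof (v w) ord0 i| <= c.
Proof.
have [|h1 ->] := @integrable_gaussian i (@Num.norm R R) (@normr_measurable R setT).
  exact: (integrable_norm (integrable_normalX 1)).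
by have [_ []] := normal_moment_bound R.
Qed.

Lemma gaussian_sqn : P.-integrable setT (fun w => (sqn (rowof (v w)))%:E) /\
  \int[P]_w sqn (rowof (v w)) <= c * d%:R.
Proof.
have h i := @integrable_gaussian i _ (@exprn_measurable R setT 2) (integrable_normalX 2).
split.
  under eq_fun do rewrite -sumEFin.
  by apply: integrable_sum => // i _; have [] := h i.
rewrite /sqn (Rintegral_sum (f := fun i w => rowof (v w) ord0 i ^+ 2)); last by move=> i; have [] := h i.
rewrite mulr_natr -[X in _ *+ X]card_ord -sumr_const; apply: ler_sum => i _.
have [_ ->] := h i; by have [_ []] := normal_moment_bound R.
Qed.

Lemma gaussian_sqn2 : P.-integrable setT (fun w => (sqn (rowof (v w)) ^+ 2)%:E) /\
  \int[P]_w (sqn (rowof (v w)) ^+ 2) <= c * d%:R ^+ 2.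
Proof.
have h i := @integrable_gaussian i _ (@exprn_measurable R setT 4) (integrable_normalX 4).
pose q w := \sum_(i < d) rowof (v w) ord0 i ^+ 4.
have iq : P.-integrable setT (fun w => (q w)%:E).
  rewrite /q; under eq_fun do rewrite -sumEFin.
  by apply: integrable_sum => // i _; have [] := h i.
have idq : P.-integrable setT (fun w => (d%:R * q w)%:E).
  exact: (integrableZl measurableT d%:R iq).
have qE : \int[P]_w q w <= c * d%:R.
  rewrite /q (Rintegral_sum (f := fun i w => rowof (v w) ord0 i ^+ 4)); last by move=> i; have [] := h i.
  rewrite mulr_natr -[X in _ *+ X]card_ord -sumr_const; apply: ler_sum => i _.
  have [_ ->] := h i; by have [_ []] := normal_moment_bound R.
have is2 : P.-integrable setT (fun w => (sqn (rowof (v w)) ^+ 2)%:E).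
  apply: le_integrable idq => //.
    by apply/measurable_EFinP/measurable_funX/measurable_sqn => i; exact: measurable_rowof.
  move=> w _; rewrite /= lee_fin ger0_norm ?sqr_ge0//.
  by rewrite (le_trans (sqr_sqn_le _))// ler_norm.
split => //.
rewrite (@le_trans _ _ (\int[P]_w (d%:R * q w)))//.
  by apply: le_Rintegral => // w _; exact: sqr_sqn_le.
by rewrite RintegralZl// expr2 mulrCA ler_wpM2l.
Qed.

End gaussian_moments.

(** * Derivatives from quadratic error bounds, and mean value estimates *)

Section one_dim.
Context (R : realType).

(** Derivatives of expectations are obtained through this criterion: an explicit quadratic error
    survives integration, so no differentiation under the integral sign is performed. *)
Lemma is_derive_quadratic (V : normedModType R) (f : V -> R) (x v : V) (D C e : R) :
  0 < e -> (forall h, `|h| <= e -> `|f (x + h *: v) - f x - h * D| <= C * h ^+ 2) ->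
  is_derive x v f D.
Proof.
move=> e0 fC.
have cv : h^-1 *: (f (h *: v + x) - f x) @[h --> 0^'] --> D.
  apply/cvgrPdist_le => eps eps0.
  have C1 : 0 < `|C| + 1 by rewrite ltr_wpDl.
  near=> h.
  have h0 : h != 0 by near: h; exact: nbhs_dnbhs_neq.
  have he : `|h| <= e.
    near: h; apply: dnbhs0_le => //.
  have hep : `|h| <= eps / (`|C| + 1).
    near: h; apply: dnbhs0_le; by rewrite divr_gt0.
  have := fC h he; rewrite (addrC x) => fh.
  rewrite distrC -(ler_pM2l (_ : 0 < `|h|)) ?normr_gt0// -normrM mulrBr.
  rewrite /GRing.scale/= mulrA divff// mul1r (le_trans fh)//.
  rewrite -[X in _ * X]real_normK ?num_real// expr2 mulrCA.
  rewrite ler_wpM2l//.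
  move: hep; rewrite ler_pdivlMr// => hep.
  have := normr_ge0 h; have := ler_norm C; have := normr_ge0 C; nra.
apply: DeriveDef; first by apply/cvg_ex; exists D.
by apply/cvg_lim.
Unshelve. all: by end_near. Qed.

Lemma mvt_line (f df : R -> R) (t : R) :
  (forall s : R, is_derive s (1 : R) f (df s)) ->
  exists2 s, `|s| <= `|t| & f t - f 0 = df s * t.
Proof.
move=> fd.
have cf (a b : R) : {within `[a, b], continuous f}.
  apply: derivable_within_continuous => s _; by have [] := fd s.
have [t0|t0] := leP 0 t.
  have [s] := MVT_segment t0 (fun s _ => fd s) (cf 0 t).
  rewrite in_itv/= => /andP[s0 st] E; exists s; last by rewrite E subr0.
  by rewrite !ger0_norm.
have [s] := MVT_segment (ltW t0) (fun s _ => fd s) (cf t 0).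
rewrite in_itv/= => /andP[s0 st] E; exists s.
  by rewrite !ler0_norm ?(ltW t0)// lerN2.
by rewrite -opprB E sub0r mulrN opprK.
Qed.

(** The mean value theorem yields the constant [L]; integrating the derivative would yield
    [L / 2]. *)
Lemma mvt_lipschitz_derivative (f df : R -> R) (L t : R) :
  (forall s : R, is_derive s (1 : R) f (df s)) ->
  (forall s, `|df s - df 0| <= L * `|s|) -> 0 <= L ->
  `|f t - f 0 - df 0 * t| <= L * t ^+ 2.
Proof.
move=> fd dL L0; have [s st E] := mvt_line t fd.
rewrite E -mulrBl normrM -[t ^+ 2]real_normK ?num_real// expr2 mulrA.
rewrite ler_wpM2r// (le_trans (dL s))// ler_wpM2l//.
Qed.

(** Applied to increments of a Lipschitz function: dividing [|h * D| <= |A h| + C * h ^+ 2] by a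
    small [h] bounds the derivative by the Lipschitz constant. *)
Lemma slope_bound (A : R -> R) (D L C e : R) : 0 < e ->
  (forall h, `|h| <= e -> `|A h - h * D| <= C * h ^+ 2) ->
  (forall h, `|A h| <= L * `|h|) -> `|D| <= L.
Proof.
move=> e0 hC hL; apply/ler_addgt0Pl => eps eps0.
have C1 : 0 < `|C| + 1 by rewrite ltr_wpDl.
pose h := Num.min e (eps / (`|C| + 1)).
have h0 : 0 < h by rewrite lt_min e0 divr_gt0.
have hd : `|h| <= e by rewrite gtr0_norm// ge_min lexx.
have he : h * (`|C| + 1) <= eps by rewrite -ler_pdivlMr// ge_min lexx orbT.
have h1 := hC h hd; have h2 := hL h; rewrite (gtr0_norm h0) in h2.
rewrite -(ler_pM2l h0) -[X in X * `|_|](gtr0_norm h0) -normrM.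
have := ler_distD (A h) (h * D) 0; rewrite !subr0 distrC => h3.
have := ler_norm C; have := normr_ge0 C; nra.
Qed.

End one_dim.

(** * Integrating out a variable independent of a sub-sigma-algebra *)

Section sub_sigma_algebra.
Context (R : realType) (dO d2 : measure_display) (O : measurableType dO)
  (T2 : measurableType d2) (P : probability O R) (G : set (set O)).
Hypothesis Gm : <<s G >> `<=` measurable.
Variable Y : {RV P >-> T2}.
Hypothesis GY : forall A B, <<s G >> A -> measurable B ->
  P (A `&` Y @^-1` B) = (P A * P (Y @^-1` B))%E.
(** The sample space with the coarser sigma-algebra. The identity map into [T1] is a random variable
    independent of [Y], so freezing the point of [T1] amounts to conditioning on [G]. *)
Let T1 := g_sigma_algebraType G.

Let X (w : O) : T1 := w.
Let mX : measurable_fun setT X.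
Proof. by move=> _ B mB; rewrite setTI; exact: Gm. Qed.
HB.instance Definition _ := isMeasurableFun.Build _ _ _ _ X mX.

Lemma measurable_sub d3 (T3 : measurableType d3) (f : T1 -> T3) :
  measurable_fun setT f -> measurable_fun setT (f : O -> T3).
Proof. by move=> mf _ B mB; rewrite setTI; apply: Gm; rewrite -[_ @^-1` _]setTI; exact: mf. Qed.

Lemma ge0_integral_sub (h : T1 * T2 -> \bar R) :
  measurable_fun setT h -> (forall z, (0 <= h z)%E) ->
  (\int[P]_w h (w, Y w) = \int[P]_w \int[distribution P Y]_y h (w, y))%E.
Proof.
move=> mh h0; apply: (@ge0_integral_indep _ _ _ _ _ _ _ P (X : {RV P >-> T1}) Y) => //.
Qed.

Lemma Rintegral_sub (h : T1 * T2 -> R) : measurable_fun setT h ->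
  P.-integrable setT (fun w => (h (w, Y w))%:E) ->
  (forall x, (distribution P Y).-integrable setT (fun y => (h (x, y))%:E)) ->
  P.-integrable setT (fun w => (\int[distribution P Y]_y h (w, y))%:E) /\
  \int[P]_w h (w, Y w) = \int[P]_w \int[distribution P Y]_y h (w, y).
Proof.
move=> mh ih ihY; apply: (@Rintegral_indep _ _ _ _ _ _ _ P (X : {RV P >-> T1}) Y) => //.
Qed.

End sub_sigma_algebra.

Section Rintegral_bounds.
Context (R : realType) (dO : measure_display) (O : measurableType dO)
  (P : probability O R).

Lemma Rintegral_cst_probability (k : R) : \int[P]_w k = k.
Proof.
rewrite (Rintegral_cst P measurableT k) -[RHS]mulr1; congr (_ * _).
by transitivity (fine (1%E : \bar R)) => //; congr fine; exact: (probability_setT P).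
Qed.

Lemma norm_Rintegral_le (g h : O -> R) :
  P.-integrable setT (EFin \o g) -> P.-integrable setT (EFin \o h) ->
  (forall w, `|g w| <= h w) -> `|\int[P]_w g w| <= \int[P]_w h w.
Proof.
move=> ig ih gh; rewrite (le_trans (le_normr_Rintegral _ _))//.
by apply: le_Rintegral => //; exact: (integrable_norm ig).
Qed.

Lemma integrable_dominated (g h : O -> R) : measurable_fun setT g ->
  P.-integrable setT (EFin \o h) -> (forall w, `|g w| <= h w) ->
  P.-integrable setT (EFin \o g).
Proof.
move=> mg ih gh; apply: le_integrable ih => //; first exact/measurable_EFinP.
by move=> w _; rewrite /= lee_fin (le_trans (gh w))// ler_norm.
Qed.

Lemma integrable_cst (k : R) : P.-integrable setT (EFin \o (fun=> k)).
Proof. exact: (finite_measure_integrable_cst P). Qed.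

Lemma integrable_scale (k : R) (g : O -> R) : P.-integrable setT (EFin \o g) ->
  P.-integrable setT (EFin \o (fun w => k * g w)).
Proof. by move=> ig; exact: (integrableZl measurableT k ig). Qed.

Lemma integrable_add (g h : O -> R) : P.-integrable setT (EFin \o g) ->
  P.-integrable setT (EFin \o h) -> P.-integrable setT (EFin \o (fun w => g w + h w)).
Proof. by move=> ig ih; exact: (integrableD measurableT ig ih). Qed.

Lemma integrable_diff (g h : O -> R) : P.-integrable setT (EFin \o g) ->
  P.-integrable setT (EFin \o h) -> P.-integrable setT (EFin \o (fun w => g w - h w)).
Proof. by move=> ig ih; exact: (integrableB measurableT ig ih). Qed.

End Rintegral_bounds.

(** * Gaussian smoothing *)

Section smoothing.
Context (R : realType) (d : nat) (dO : measure_display) (O : measurableType dO)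
  (P : probability O R) (v : {RV P >-> d.-tuple R}).
Hypothesis gv : std_gaussian v.
Variables (f : 'rV[R]_d -> R) (L delta : R).
Hypotheses (L0 : 0 <= L) (delta0 : 0 < delta).
Hypothesis lip : forall x y, `|f x - f y| <= L * l2norm (x - y).
Notation N := (normal_prob (0:R) 1).
Notation c := (gauss_const R).
Notation V w := (rowof (v w)).
Notation e i := (delta_mx ord0 i : 'rV[R]_d).

Definition smooth x : R := \int[P]_w f (x + delta *: V w).
Definition sgrad x : 'rV[R]_d :=
  \row_i (delta^-1 * \int[P]_w (V w ord0 i * f (x + delta *: V w))).

Lemma measurable_lipschitz d1 (T : measurableType d1) (X : T -> 'rV[R]_d) :
  (forall i, measurable_fun setT (fun w => X w ord0 i)) ->
  measurable_fun setT (fun w => f (X w)).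
Proof.
move=> mX; apply: (@measurable_lipschitz_comp _ _ _ _ T T (fun x _ => f x) L X id) => //.
Qed.

Lemma measurable_shift x : measurable_fun setT (fun w => f (x + delta *: V w)).
Proof.
apply: measurable_lipschitz => i; under eq_fun do rewrite !mxE.
apply: measurable_funD => //; apply: measurable_funM => //; exact: measurable_coordinate.
Qed.

Lemma lip_shift x y : `|f (x + y)| <= `|f x| + L * l2norm y.
Proof.
have := lip (x + y) x; rewrite addrAC subrr add0r => h.
have := ler_normD (f (x + y) - f x) (f x); rewrite subrK; lra.
Qed.

Lemma integrable_affine_sqn (a b : R) :
  P.-integrable setT (EFin \o (fun w => a + b * sqn (V w))).
Proof.
apply: integrable_add; first exact: integrable_cst.
by apply: integrable_scale; have [] := gaussian_sqn gv.
Qed.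

Lemma shift_bound x w : `|f (x + delta *: V w)| <= `|f x| + L * delta + L * delta * sqn (V w).
Proof.
rewrite (le_trans (lip_shift _ _))// -addrA lerD2l l2normZ gtr0_norm//.
have := l2norm_le_sqn (V w); have := mulr_ge0 L0 (ltW delta0).
rewrite mulrA; nra.
Qed.

Lemma integrable_shift x : P.-integrable setT (EFin \o (fun w => f (x + delta *: V w))).
Proof.
apply: integrable_dominated (shift_bound x); first exact: measurable_shift.
exact: integrable_affine_sqn.
Qed.

Lemma integrable_coord_shift i x :
  P.-integrable setT (EFin \o (fun w => V w ord0 i * f (x + delta *: V w))).
Proof.
apply: (integrable_dominated _ (integrable_affine_sqn (`|f x|) (`|f x| + L * delta))).
  apply: measurable_funM; last exact: measurable_shift.
  exact: measurable_rowof.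
move=> w; rewrite normrM.
have h1 := lip_shift x (delta *: V w); rewrite l2normZ (gtr0_norm delta0) in h1.
have h2 := coord_le_l2norm (V w) i.
have h3 := l2norm_le_sqn (V w); have h4 := l2norm_sqr (V w).
have h5 := mulr_ge0 L0 (ltW delta0).
rewrite (le_trans (ler_pM _ _ h2 h1))//.
have := normr_ge0 (f x); have := l2norm_ge0 (V w).
rewrite mulrA -h4; rewrite -h4 in h3; nra.
Qed.

Lemma smooth_lip x y : `|smooth x - smooth y| <= L * l2norm (x - y).
Proof.
have ix := integrable_shift x; have iy := integrable_shift y.
rewrite /smooth -RintegralB//.
rewrite -[leRHS](Rintegral_cst_probability P).
apply: norm_Rintegral_le => [| |w]; first exact: integrable_diff.
  exact: integrable_cst.
by rewrite (le_trans (lip _ _))// opprD addrACA subrr addr0.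
Qed.

(** Only [f] depends on the point in the integral defining [sgrad], so its Lipschitz bound passes
    through, weighted by the mean of [|u_i|]. The factor [delta^-1] is the price of smoothness, and
    per coordinate the constant is free of the dimension. *)
Lemma sgrad_lip i x y : `|sgrad x ord0 i - sgrad y ord0 i| <=
  L / delta * c * l2norm (x - y).
Proof.
have ix := integrable_coord_shift i x; have iy := integrable_coord_shift i y.
have [ia ca] := gaussian_abs_moment gv i.
rewrite !mxE -mulrBr -RintegralB// normrM gtr0_norm ?invr_gt0//.
have -> : L / delta * c * l2norm (x - y) = delta^-1 * (L * l2norm (x - y) * c) by ring.
rewrite ler_wpM2l ?invr_ge0 ?(ltW delta0)//.
rewrite (@le_trans _ _ (\int[P]_w (L * l2norm (x - y) * `|V w ord0 i|)))//.
  apply: norm_Rintegral_le => [| |w]; first exact: integrable_diff.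
    exact: integrable_scale.
  rewrite -mulrBr normrM mulrC ler_wpM2r// (le_trans (lip _ _))//.
  by rewrite opprD addrACA subrr addr0.
by rewrite RintegralZl// ler_wpM2l// mulr_ge0// l2norm_ge0.
Qed.

Section coordinate_split.
Variables (i : 'I_d) (x : 'rV[R]_d).

Let S j := g_sigma_algebra_preimage (fun w => tnth (v w) j).
Let G := \bigcup_(j in [set j | j != i]) S j.
Let T1 := g_sigma_algebraType G.

Let S_m j : S j `<=` measurable.
Proof.
move=> _ [B mB <-]; rewrite setTI -[_ @^-1` _]setTI.
exact: (measurable_coordinate v j).
Qed.

Let Gm : <<s G >> `<=` measurable.
Proof.
apply: smallest_sub; first exact: sigma_algebra_measurable.
by move=> A [j _ /S_m].
Qed.

Let indep A B : <<s G >> A -> measurable B ->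
  P (A `&` coordinate v i @^-1` B) = (P A * P (coordinate v i @^-1` B))%E.
Proof.
move=> GA mB; have [_ iv] := gv.
apply: (mutual_independence_sigma_algebra (i := i) iv _ _ _ _ GA).
- by move=> j; exists setT => //; rewrite setTI preimage_setT.
- move=> j _ _ [B1 mB1 <-] [B2 mB2 <-]; exists (B1 `&` B2); first exact: measurableI.
  by rewrite !setTI preimage_setI.
- exact: S_m.
- by rewrite /= eqxx.
- by exists B => //; rewrite setTI.
Qed.

(** [base] is [x + delta * u] without the Gaussian part of its [i]-th coordinate; it depends only on
    the other coordinates and is therefore independent of the [i]-th. In [gg] the [i]-th Gaussian
    becomes a free variable, and moving [x] by [delta * a] along axis [i] becomes a shift of that
    variable by [a]. *)
Let base (w : O) : 'rV[R]_d :=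
  \row_j (x ord0 j + (if j == i then 0 else delta * tnth (v w) j)).
Let gg (a : R) (p : T1 * R) : R := f (base p.1 + (delta * (p.2 + a)) *: e i).

Let measurable_base j : measurable_fun setT (fun w : T1 => base w ord0 j).
Proof.
under eq_fun do rewrite mxE; apply: measurable_funD => //.
have [ji|ji] := eqVneq j i; first exact: measurable_cst.
apply: measurable_funM => // _ B mB; rewrite setTI; apply: sub_sigma_algebra.
by exists j => //; exists B => //; rewrite setTI.
Qed.

Let measurable_gg a : measurable_fun setT (gg a).
Proof.
apply: measurable_lipschitz => j; under eq_fun do rewrite mxE.
apply: measurable_funD.
  exact: (measurableT_comp (measurable_base j)).
under eq_fun do rewrite mxE.
apply: measurable_funM => //; apply: measurable_funM => //; exact: measurable_funD.
Qed.

Let ggE a w : f (x + (delta * a) *: e i + delta *: V w) = gg a (w, coordinate v i w).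
Proof.
congr f; apply/rowP => j; rewrite !mxE /coordinate/=.
by case: eqVneq => [->|ji] /=; ring.
Qed.

(** Serves as the growth constant [A] of [normal_expansion] for the section at [w]. It does not
    depend on [a], and it is integrable because it is affine in the squared norm. *)
Let B w := `|f x| + L * delta + L * delta + L * delta * sqn (V w).

Let B_ge0 w : 0 <= B w.
Proof.
by rewrite /B !addr_ge0 ?mulr_ge0 ?(ltW delta0) ?sqn_ge0.
Qed.

Let gg_bound a w z : `|gg a (w, z)| <= B w * expR `|z + a|.
Proof.
have h0 : l2norm (base w - x) <= delta * l2norm (V w).
  apply: le_l2norm; first by rewrite mulr_ge0 ?l2norm_ge0 ?ltW.
  rewrite exprMn l2norm_sqr /sqn mulr_sumr; apply: ler_sum => j _.
  rewrite !mxE addrAC subrr add0r; case: ifP => _; last by rewrite exprMn.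
  by rewrite expr0n /= mulr_ge0 ?sqr_ge0.
have h1 := lip_shift x (base w - x); rewrite [x + _]addrC subrK in h1.
have h2 := lip_shift (base w) ((delta * (z + a)) *: e i).
rewrite l2norm_delta normrM (gtr0_norm delta0) in h2.
have h3 := l2norm_le_sqn (V w).
have h5 := mulr_ge0 L0 (ltW delta0).
have h6 : `|f (base w)| <= `|f x| + L * delta + L * delta * sqn (V w).
  rewrite (le_trans h1)// -addrA lerD2l (le_trans (ler_wpM2l L0 h0))// mulrA; nra.
have e1 : 1 <= expR `|z + a| by rewrite -expR0 ler_expR.
have ez : `|z + a| <= expR `|z + a| by rewrite (le_trans _ (expR_ge1Dx _))// lerDr.
rewrite /gg/= (le_trans h2)//.
have b0 : 0 <= `|f x| + L * delta + L * delta * sqn (V w) by rewrite (le_trans _ h6).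
rewrite /B mulrA; have := normr_ge0 (z + a).
rewrite (_ : `|f x| + L * delta + L * delta + L * delta * sqn (V w) =
  (`|f x| + L * delta + L * delta * sqn (V w)) + L * delta); last by ring.
nra.
Qed.

Let normal_gg a w : N.-integrable setT (EFin \o (fun z => gg a (w, z))) /\
  N.-integrable setT (EFin \o (fun z => z * gg a (w, z))).
Proof.
have mg : measurable_fun setT (fun z : R => gg a (w, z)).
  exact: (measurableT_comp (measurable_gg a) (pair1_measurable (w : T1))).
have hb z : `|gg a (w, z)| <= B w * expR `|a| * expR `|z|.
  rewrite (le_trans (gg_bound a w z))// -mulrA ler_wpM2l//.
  by rewrite -expRD ler_expR addrC ler_normD.
split.
  by apply: (@integrable_normal _ _ (B w * expR `|a|) 1) => // z; rewrite mul1r.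
apply: (@integrable_normal _ _ (B w * expR `|a|) 2); first exact: measurable_funM.
move=> z; rewrite normrM mulrC.
have ez : `|z| <= expR `|z| by rewrite (le_trans _ (expR_ge1Dx _))// lerDr.
have -> : expR (2 * `|z|) = expR `|z| * expR `|z| by rewrite -expRD; congr expR; ring.
by rewrite [leRHS]mulrA; exact: ler_pM.
Qed.

Let split_gg a :
  P.-integrable setT (EFin \o (fun w => \int[N]_z gg a (w, z))) /\
  smooth (x + (delta * a) *: e i) = \int[P]_w \int[N]_z gg a (w, z).
Proof.
have mg w : measurable_fun setT (fun z : R => gg a (w, z)).
  exact: (measurableT_comp (measurable_gg a) (pair1_measurable (w : T1))).
have := @Rintegral_sub _ _ _ _ _ P G Gm (coordinate v i) indep (gg a) (measurable_gg a).
case.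
- apply: eq_integrable (integrable_shift (x + (delta * a) *: e i)) => // w _.
  by rewrite /= ggE.
- by move=> w; apply: (integrable_coordinate gv) => //; have [] := normal_gg a w.
move=> h1 h2.
have E w : \int[distribution P (coordinate v i)]_y gg a (w, y) = \int[N]_z gg a (w, z).
  by apply: (Rintegral_coordinate gv) => //; have [] := normal_gg a w.
split; first by apply: eq_integrable h1 => // w _; rewrite /= E.
rewrite /smooth; under eq_Rintegral do rewrite ggE.
by rewrite h2; apply: eq_Rintegral => w _; rewrite E.
Qed.

Let split_zgg :
  P.-integrable setT (EFin \o (fun w => \int[N]_z (z * gg 0 (w, z)))) /\
  delta * sgrad x ord0 i = \int[P]_w \int[N]_z (z * gg 0 (w, z)).
Proof.
pose h (p : T1 * R) := p.2 * gg 0 p.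
have mh : measurable_fun setT h by apply: measurable_funM.
have mg w : measurable_fun setT (fun z : R => z * gg 0 (w, z)).
  exact: (measurableT_comp mh (pair1_measurable (w : T1))).
have hE w : V w ord0 i * f (x + delta *: V w) = h (w, coordinate v i w).
  by rewrite /h/= -ggE mulr0 scale0r addr0 mxE.
have := @Rintegral_sub _ _ _ _ _ P G Gm (coordinate v i) indep h mh.
case.
- apply: eq_integrable (integrable_coord_shift i x) => // w _.
  by rewrite /= hE.
- move=> w; apply: (integrable_coordinate gv i (g := fun z => z * gg 0 (w, z))) => //.
  by have [] := normal_gg 0 w.
move=> h1 h2.
have E w : \int[distribution P (coordinate v i)]_y h (w, y) = \int[N]_z (z * gg 0 (w, z)).
  apply: (Rintegral_coordinate gv i (g := fun z => z * gg 0 (w, z))) => //.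
  by have [] := normal_gg 0 w.
split; first by apply: eq_integrable h1 => // w _; rewrite /= E.
rewrite mxE mulrA divff ?gt_eqF// mul1r; under eq_Rintegral do rewrite hE.
by rewrite h2; apply: eq_Rintegral => w _; rewrite E.
Qed.

(** With the other coordinates frozen, [normal_expansion] expands the integral over the [i]-th
    coordinate with error [B w * K * a ^+ 2]; integrating over [w] gives the expansion of
    [smooth]. *)
Lemma smooth_expansion : exists C : R, forall h, `|h| <= delta ->
  `|smooth (x + h *: e i) - smooth x - h * sgrad x ord0 i| <= C * h ^+ 2.
Proof.
have [K K0 hK] := normal_expansion R.
have iB : P.-integrable setT (EFin \o B) by exact: integrable_affine_sqn.
(* A displacement [h] is a shift [a = h / delta] of the Gaussian variable, whence the factor
   [delta ^- 2] and the range [|h| <= delta]. *)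
exists (K * \int[P]_w B w / delta ^+ 2) => h hd; pose a := h / delta.
have hE : h = delta * a by rewrite mulrC divfK// gt_eqF.
have a1 : `|a| <= 1 by rewrite normrM normfV (gtr0_norm delta0) ler_pdivrMr// mul1r.
have [ia Ea] := split_gg a; have [i0 E0] := split_gg 0.
have [iz Ez] := split_zgg.
rewrite mulr0 scale0r addr0 in E0.
have -> : h * sgrad x ord0 i = a * \int[P]_w \int[N]_z (z * gg 0 (w, z)).
  by rewrite -Ez hE; ring.
rewrite [X in smooth (x + X *: _)]hE Ea E0.
rewrite -RintegralZl// -RintegralB// -RintegralB//; last 2 first.
  exact: integrable_diff.
  exact: integrable_scale.
have -> : K * (\int[P]_w B w) / delta ^+ 2 * h ^+ 2 = (K * a ^+ 2) * \int[P]_w B w.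
  by rewrite hE; field; rewrite gt_eqF.
rewrite -RintegralZl//; apply: norm_Rintegral_le => [| |w].
- apply: integrable_diff; [exact: integrable_diff|exact: integrable_scale].
- exact: integrable_scale.
rewrite (_ : K * a ^+ 2 * B w = B w * K * a ^+ 2); last by ring.
have mg : measurable_fun setT (fun z : R => gg 0 (w, z)).
  exact: (measurableT_comp (measurable_gg 0) (pair1_measurable (w : T1))).
have gE z : gg 0 (w, z + a) = gg a (w, z) by rewrite /gg/= addr0.
have := hK _ (B w) mg _ a a1.
rewrite (_ : \int[N]_z gg 0 (w, z + a) = \int[N]_z gg a (w, z)).
  by apply => z; rewrite -[z in leRHS]addr0; exact: gg_bound.
by apply: eq_Rintegral => z _; exact: gE.
Qed.

End coordinate_split.

Lemma smooth_derive i x (s : R) :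
  is_derive s (1 : R) (fun t : R => smooth (x + t *: e i)) (sgrad (x + s *: e i) ord0 i).
Proof.
have [C hC] := smooth_expansion i (x + s *: e i).
apply: (is_derive_quadratic delta0 (C := C)) => h hd /=.
have -> : h *: (1 : R) = h by rewrite /GRing.scale/= mulr1.
by rewrite scalerDl addrA; exact: hC.
Qed.

Lemma grad_smooth x : grad smooth x = sgrad x.
Proof.
apply/rowP => i; rewrite mxE.
have [C hC] := smooth_expansion i x.
have h : is_derive x (e i) smooth (sgrad x ord0 i).
  by apply: (is_derive_quadratic delta0 (C := C)).
by rewrite derive_val.
Qed.

Lemma smooth_coordinate i x (t : R) :
  `|smooth (x + t *: e i) - smooth x - sgrad x ord0 i * t| <= L / delta * c * t ^+ 2.
Proof.
have c0 : 0 <= c := le_trans ler01 (gauss_const_ge1 R).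
have L'0 : 0 <= L / delta * c by rewrite !mulr_ge0// invr_ge0 ltW.
have := mvt_lipschitz_derivative t (smooth_derive i x) _ L'0.
rewrite scale0r addr0; apply => s; rewrite (le_trans (sgrad_lip _ _ _))//.
by rewrite addrAC subrr add0r l2norm_delta.
Qed.

(* Lipschitz bounds are available only for the coordinates of [sgrad], so [y] is reached
   from [x] one coordinate at a time; this costs the factor [sqrt d]. *)
Lemma smooth_descent x y : (0 < d)%N ->
  smooth y - smooth x - dotv (sgrad x) (y - x) <=
  2 * Num.sqrt d%:R * (L / delta * c) * sqn (y - x).
Proof.
move=> d0; set M := L / delta * c.
have c0 : 0 <= c := le_trans ler01 (gauss_const_ge1 R).
have M0 : 0 <= M by rewrite !mulr_ge0// invr_ge0 ltW.
pose z (k : nat) : 'rV[R]_d := \row_j (if (j < k)%N then y ord0 j else x ord0 j).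
have z0 : z 0%N = x by apply/rowP => j; rewrite mxE.
have zd : z d = y by apply/rowP => j; rewrite mxE ltn_ord.
have zS (k : 'I_d) : z k.+1 = z k + (y - x) ord0 k *: e k.
  apply/rowP => j; rewrite !mxE ltnS leq_eqVlt.
  have [->|jk] := eqVneq j k; first by rewrite eqxx ltnn /= mulr1 addrC subrK.
  by rewrite (negbTE (_ : val j != val k))//= ?mulr0 ?addr0//.
have zx k : l2norm (z k - x) <= l2norm (y - x).
  apply: ler_wsqrtr; apply: ler_sum => j _; rewrite !mxE.
  by case: ifP => // _; rewrite subrr expr0n sqr_ge0.
(* The last term is the expansion error along axis [k]; the other is the cost of replacing the
   gradient at [z k] by the gradient at [x]. Summed over [k], the latter produces an l1 norm and
   hence [sqrt d]. *)
have step (k : 'I_d) : smooth (z k.+1) - smooth (z k) - sgrad x ord0 k * (y - x) ord0 k <=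
    M * l2norm (y - x) * `|(y - x) ord0 k| + M * (y - x) ord0 k ^+ 2.
  have := smooth_coordinate k (z k) ((y - x) ord0 k); rewrite -zS -/M.
  move/(le_trans (ler_norm _)) => h1.
  have h2 := sgrad_lip k (z k) x; rewrite -/M in h2.
  have h3 : (sgrad (z k) ord0 k - sgrad x ord0 k) * (y - x) ord0 k <=
      M * l2norm (y - x) * `|(y - x) ord0 k|.
    rewrite (le_trans (ler_norm _))// normrM ler_wpM2r// (le_trans h2)//.
    by rewrite ler_wpM2l.
  move: h1 h3; rewrite mulrBl; lra.
have -> : smooth y - smooth x - dotv (sgrad x) (y - x) =
    \sum_(k < d) (smooth (z k.+1) - smooth (z k) - sgrad x ord0 k * (y - x) ord0 k).
  rewrite sumrB -(big_mkord xpredT (fun k => smooth (z k.+1) - smooth (z k))).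
  by rewrite telescope_sumr// zd z0.
rewrite (le_trans (ler_sum _ (fun k _ => step k)))// big_split/=.
rewrite -!mulr_sumr -/(sqn (y - x)).
have h := sum_norm_le_l2norm (y - x).
have d1 : 1 <= Num.sqrt d%:R :> R by rewrite -[leLHS]sqrtr1 ler_wsqrtr// ler1n.
have s0 := sqn_ge0 (y - x).
have n0 := l2norm_ge0 (y - x).
have h1 : M * l2norm (y - x) * (\sum_(k < d) `|(y - x) ord0 k|) <=
    Num.sqrt d%:R * M * sqn (y - x).
  apply: (@le_trans _ _ (M * l2norm (y - x) * (Num.sqrt d%:R * l2norm (y - x)))).
    by apply: ler_wpM2l => //; exact: mulr_ge0.
  by rewrite -l2norm_sqr le_eqVlt; apply/orP; left; apply/eqP; ring.
(* Here [sqrt d >= 1] is inserted only to merge both contributions into the factor [2 * sqrt d]. *)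
have h2 : M * sqn (y - x) <= Num.sqrt d%:R * M * sqn (y - x).
  by rewrite -mulrA ler_peMl// mulr_ge0.
lra.
Qed.

Lemma sgrad_bound x i : `|sgrad x ord0 i| <= L.
Proof.
have [C hC] := smooth_expansion i x.
apply: (slope_bound delta0 hC) => h; rewrite (le_trans (smooth_lip _ _))//.
by rewrite addrAC subrr add0r l2norm_delta.
Qed.

End smoothing.

(** * First-order expansions with quadratic error *)

Section quad_smooth.
Context (R : realType) (d : nat).
Implicit Types (f : 'rV[R]_d -> R) (g : 'rV[R]_d -> 'rV[R]_d) (L : R).
Notation e i := (delta_mx ord0 i : 'rV[R]_d).

(* First-order expansion with quadratic error: unlike Lipschitz continuity of the
   gradient, this form passes to expectations without measurability of norms. *)
Definition quad_smooth f g L := forall x y,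
  `|f y - f x - dotv (g x) (y - x)| <= L * sqn (y - x).

Lemma derive_dotv_grad f (x u : 'rV[R]_d) : differentiable f x ->
  'D_u f x = dotv (grad f x) u.
Proof.
move=> df; rewrite deriveE// {1}(row_sum_delta u) linear_sum.
by apply: eq_bigr => i _; rewrite linearZ/= mxE deriveE// mulrC.
Qed.

Lemma is_derive_line f (x u : 'rV[R]_d) (t : R) : differentiable f (x + t *: u) ->
  is_derive t (1 : R) (fun s : R => f (x + s *: u)) (dotv (grad f (x + t *: u)) u).
Proof.
move=> df; rewrite -derive_dotv_grad//.
have E : (fun h : R => h^-1 *: (f (x + (h *: (1 : R) + t) *: u) - f (x + t *: u))) =
    (fun h : R => h^-1 *: (f (h *: u + (x + t *: u)) - f (x + t *: u))).
  apply/funext => h; congr (_ *: (f _ - _)).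
  have -> : h *: (1 : R) = h by rewrite /GRing.scale/= mulr1.
  by rewrite scalerDl addrCA.
have dd : derivable f (x + t *: u) u by exact: diff_derivable.
by apply: DeriveDef; rewrite /derivable /derive/= E.
Qed.

Lemma lipschitz_grad_quad_smooth f L : (forall x, differentiable f x) -> 0 <= L ->
  (forall x y, l2norm (grad f x - grad f y) <= L * l2norm (x - y)) ->
  quad_smooth f (grad f) L.
Proof.
move=> df L0 lg x y; pose u := y - x.
have dl (s : R) := is_derive_line (x := x) (u := u) (df (x + s *: u)).
have := mvt_lipschitz_derivative (L := L * sqn u) 1 dl.
rewrite scale0r addr0 scale1r mulr1 expr1n mulr1 /u [x + _]addrC subrK; apply.
  move=> s; rewrite -dotvBl (le_trans (cauchy_schwarz_norm _ _))//.
  rewrite (le_trans (ler_wpM2r (l2norm_ge0 _) (lg _ _)))//.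
  rewrite [_ + s *: _ - _]addrAC subrr add0r l2normZ -l2norm_sqr.
  by rewrite le_eqVlt; apply/orP; left; apply/eqP; ring.
by rewrite mulr_ge0// sqn_ge0.
Qed.

Lemma quad_smooth_coordinate f g L : quad_smooth f g L -> forall x i h,
  `|f (x + h *: e i) - f x - h * g x ord0 i| <= L * h ^+ 2.
Proof.
move=> fg x i h; have := fg x (x + h *: e i).
by rewrite [x + _ - x]addrAC subrr add0r dotv_delta sqn_delta.
Qed.

(** The field in such an expansion is unique, so gradient and expectation are interchanged by
    averaging the expansion and identifying its linear part. *)
Lemma quad_smooth_grad f g L : quad_smooth f g L -> grad f = g.
Proof.
move=> fg; apply/funext => x; apply/rowP => i; rewrite mxE.
have h : is_derive x (e i) f (g x ord0 i).
  apply: (is_derive_quadratic ltr01 (C := L)) => h _; exact: quad_smooth_coordinate.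
by rewrite derive_val.
Qed.

Lemma quad_smooth_bound f g L L' : quad_smooth f g L ->
  (forall x y, `|f x - f y| <= L' * l2norm (x - y)) ->
  forall x i, `|g x ord0 i| <= L'.
Proof.
move=> fg lip x i.
apply: (slope_bound ltr01 (fun h _ => quad_smooth_coordinate fg x i h)) => h.
by rewrite (le_trans (lip _ _))// addrAC subrr add0r l2norm_delta.
Qed.

(* Compare the expansions at [x] and at [y] in the point [x + w], where [w] is parallel to
   [g x - g y] and as long as [x - y]. *)
Lemma quad_smooth_lipschitz f g L : 0 <= L -> quad_smooth f g L -> forall x y,
  l2norm (g x - g y) <= 6 * L * l2norm (x - y).
Proof.
move=> L0 fg x y; set a := g x - g y; set r := l2norm (x - y).
have [->|a0] := eqVneq (l2norm a) 0; first by rewrite !mulr_ge0// l2norm_ge0.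
have [r0|r0] := eqVneq r 0.
  have sxy : sqn (x - y) = 0 by rewrite -l2norm_sqr -/r r0 expr0n.
  have xy : x = y.
    apply/rowP => i; apply/eqP; rewrite -subr_eq0 -normr_le0 -(_ : r = 0)//.
    by have := coord_le_l2norm (x - y) i; rewrite !mxE.
  by move: a0; rewrite /a xy subrr /l2norm big1 ?sqrtr0 ?eqxx// => i _; rewrite mxE expr0n.
have rp : 0 < r by rewrite lt_def r0 l2norm_ge0.
have ap : 0 < l2norm a by rewrite lt_def a0 l2norm_ge0.
pose w := (r / l2norm a) *: a.
have wr : sqn w = r ^+ 2 by rewrite sqnZ -l2norm_sqr; field; rewrite gt_eqF.
have aw : dotv a w = r * l2norm a by rewrite dotvZr dotvv -l2norm_sqr; field; rewrite gt_eqF.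
have h1 := fg x (x + w); have h2 := fg y (x + w); have h3 := fg y x.
rewrite [x + w - x]addrAC subrr add0r wr in h1.
rewrite -/r -l2norm_sqr -/r in h3.
have s2 : sqn (x + w - y) <= 4 * r ^+ 2.
  rewrite addrAC (le_trans (sqnD_le _ _))// wr -l2norm_sqr -/r; lra.
have h2' : `|f (x + w) - f y - dotv (g y) (x + w - y)| <= L * (4 * r ^+ 2).
  by rewrite (le_trans h2)// ler_wpM2l.
(* [6 = 1 + 4 + 1]: the displacements from [x] to [x + w] and from [y] to [x] have length [r], the
   one from [y] to [x + w] at most [2 * r]. *)
have : dotv a w <= 6 * L * r ^+ 2.
  have yw : x + w - y = w + (x - y) by rewrite addrAC addrC.
  move: h1 h2' h3; rewrite yw !ler_norml dotvBl (dotvDr w (x - y)).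
  by move=> /andP[? ?] /andP[? ?] /andP[? ?]; lra.
by rewrite aw mulrC expr2 mulrA ler_pM2r.
Qed.

Section average.
Context (dO : measure_display) (O : measurableType dO) (P : probability O R).
Variables (f : O -> 'rV[R]_d -> R) (g : O -> 'rV[R]_d -> 'rV[R]_d) (L L' : R).
Hypotheses (L0 : 0 <= L) (fg : forall w, quad_smooth (f w) (g w) L).
Hypothesis lip : forall w x y, `|f w x - f w y| <= L' * l2norm (x - y).
Hypothesis fi : forall x, P.-integrable setT (EFin \o (fun w => f w x)).

(** Measurability of the gradient in [w] is not assumed: it is a pointwise limit of difference
    quotients with step [1 / (n + 1)], bounded by the Lipschitz constant [L']. *)
Lemma integrable_quad_smooth x i : P.-integrable setT (EFin \o (fun w => g w x ord0 i)).
Proof.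
have mf y : measurable_fun setT (fun w => f w y).
  exact/measurable_EFinP/(measurable_int P (fi y)).
apply: (integrable_dominated _ (integrable_cst P L')).
  apply: (@measurable_fun_cvg _ _ _ _
    (fun n w => n.+1%:R * (f w (x + n.+1%:R^-1 *: e i) - f w x))).
    by move=> n; apply: measurable_funM => //; exact: measurable_funB.
  move=> w _; apply/cvgrPdist_le => eps eps0; near=> n.
  have n0 : 0 < n.+1%:R :> R by [].
  have := quad_smooth_coordinate (fg w) x i n.+1%:R^-1.
  set D := f w _ - _; set G := g w x ord0 i => h.
  have -> : G - n.+1%:R * D = n.+1%:R * (n.+1%:R^-1 * G - D).
    by rewrite [RHS]mulrBr mulrA divff ?mul1r ?gt_eqF.
  rewrite normrM (gtr0_norm n0) distrC (le_trans (ler_wpM2l (ltW n0) h))//.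
  rewrite expr2 mulrCA (mulrA n.+1%:R) divff ?mul1r ?gt_eqF//.
  have hn : n.+1%:R^-1 <= eps / (L + 1) by apply: ltW; near: n;
    apply: near_infty_natSinv_lt (PosNum (divr_gt0 eps0 (ltr_wpDl L0 ltr01))).
  have L1 : 0 < L + 1 by rewrite ltr_wpDl.
  move: hn; rewrite ler_pdivlMr//; have : 0 <= n.+1%:R^-1 :> R by rewrite invr_ge0 ler0n.
  move: (n.+1%:R^-1) => m; lra.
by move=> w; exact: (quad_smooth_bound (fg w) (lip w)).
Unshelve. all: by end_near. Qed.

Lemma quad_smooth_average : quad_smooth (fun x => \int[P]_w f w x)
  (fun x => \row_i \int[P]_w g w x ord0 i) L.
Proof.
move=> x y.
have ig i : P.-integrable setT (EFin \o (fun w => g w x ord0 i * (y - x) ord0 i)).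
  have := integrable_scale ((y - x) ord0 i) (integrable_quad_smooth x i).
  by apply: eq_integrable => // w _; rewrite /= mulrC.
have iD : P.-integrable setT (EFin \o (fun w => dotv (g w x) (y - x))).
  exact: integrable_Rsum.
have -> : dotv (\row_i \int[P]_w g w x ord0 i) (y - x) = \int[P]_w dotv (g w x) (y - x).
  rewrite /dotv Rintegral_sum//; apply: eq_bigr => i _.
  rewrite mxE mulrC -RintegralZl//; last exact: integrable_quad_smooth.
  by apply: eq_Rintegral => w _; rewrite mulrC.
rewrite -RintegralB// -RintegralB//; last exact: integrable_diff.
rewrite -[leRHS](Rintegral_cst_probability P).
apply: norm_Rintegral_le => [| |w]; last exact: fg.
- by apply: integrable_diff => //; exact: integrable_diff.
- exact: integrable_cst.
Qed.

End average.

Section smoothing_quad.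
Context (dO : measure_display) (O : measurableType dO)
  (P : probability O R) (v : {RV P >-> d.-tuple R}).
Hypothesis gv : std_gaussian v.
Variables (f : 'rV[R]_d -> R) (g : 'rV[R]_d -> 'rV[R]_d) (L L' delta : R).
Hypotheses (L0 : 0 <= L) (L'0 : 0 <= L') (delta0 : 0 < delta).
Hypothesis lip : forall x y, `|f x - f y| <= L' * l2norm (x - y).
Hypothesis fg : quad_smooth f g L.
Notation V w := (rowof (v w)).

Let fs w x := f (x + delta *: V w).
Let gs w x := g (x + delta *: V w).

Let fgs w : quad_smooth (fs w) (gs w) L.
Proof.
move=> x y; have := fg (x + delta *: V w) (y + delta *: V w).
by rewrite opprD addrACA subrr addr0.
Qed.

Let lips w x y : `|fs w x - fs w y| <= L' * l2norm (x - y).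
Proof. by rewrite (le_trans (lip _ _))// opprD addrACA subrr addr0. Qed.

Let fis x : P.-integrable setT (EFin \o (fun w => fs w x)).
Proof. exact: (integrable_shift gv L'0 delta0 lip). Qed.

(** [smooth] averages translates of [f], which all share the constant [L]. In contrast to the merely
    Lipschitz case, the result involves neither [delta] nor the dimension. *)
Lemma quad_smooth_smooth : quad_smooth (smooth v f delta) (sgrad v f delta) L.
Proof.
have h := quad_smooth_average L0 fgs lips fis.
suff -> : sgrad v f delta = (fun x => \row_i \int[P]_w gs w x ord0 i) by [].
rewrite -(quad_smooth_grad h); apply/funext => x.
by rewrite -(grad_smooth gv L'0 delta0 lip).
Qed.

(** Jensen's inequality done by hand: the squared norm of [a] is the mean of
    [dotv a (g x - gs w x)], hence at most half of itself plus half the mean of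
    [sqn (g x - gs w x)]. The factor 6 is that of [quad_smooth_lipschitz]. *)
Lemma sgrad_bias x : sqn (g x - sgrad v f delta x) <=
  (6 * L * delta) ^+ 2 * (gauss_const R * d%:R).
Proof.
have h := quad_smooth_average L0 fgs lips fis.
have -> : sgrad v f delta x = \row_i \int[P]_w gs w x ord0 i.
  have : grad (smooth v f delta) x = \row_i \int[P]_w gs w x ord0 i.
    exact: (congr1 (fun G => G x) (quad_smooth_grad h)).
  by rewrite (grad_smooth gv L'0 delta0 lip).
have igs i : P.-integrable setT (EFin \o (fun w => gs w x ord0 i)).
  exact: (integrable_quad_smooth L0 fgs lips fis).
set a := g x - _.
have ia i : P.-integrable setT (EFin \o (fun w => a ord0 i * (g x - gs w x) ord0 i)).
  apply: integrable_scale; under eq_fun do rewrite !mxE.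
  by apply: integrable_diff => //; exact: integrable_cst.
have aE : sqn a = \int[P]_w dotv a (g x - gs w x).
  rewrite /dotv Rintegral_sum//; apply: eq_bigr => i _.
  rewrite RintegralZl//; last first.
    under eq_fun do rewrite !mxE.
    by apply: integrable_diff => //; exact: integrable_cst.
  rewrite expr2; congr (_ * _); rewrite !mxE.
  under [RHS]eq_Rintegral do rewrite !mxE.
  by rewrite RintegralB ?Rintegral_cst_probability//; exact: integrable_cst.
have [i1 s1] := gaussian_sqn gv.
pose k := (6 * L * delta) ^+ 2.
have gb w : sqn (g x - gs w x) <= k * sqn (V w).
  have := quad_smooth_lipschitz L0 fg x (x + delta *: V w).
  rewrite opprD addrA subrr add0r l2normN l2normZ gtr0_norm// => hh.
  rewrite -!l2norm_sqr /k -exprMn -/(gs w x) lerXn2r ?nnegrE ?l2norm_ge0//.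
    by rewrite !mulr_ge0 ?l2norm_ge0// ltW.
  by rewrite (le_trans hh)// mulrA.
have : sqn a <= 2^-1 * sqn a + 2^-1 * k * \int[P]_w sqn (V w).
  have ik : P.-integrable setT (EFin \o (fun w => 2^-1 * k * sqn (V w))).
    exact: integrable_scale.
  have ic := integrable_cst P (2^-1 * sqn a).
  rewrite {1}aE -[X in _ <= X + _](Rintegral_cst_probability P) -RintegralZl//.
  rewrite -RintegralD//; apply: le_Rintegral => //.
  - exact: integrable_Rsum.
  - exact: integrable_add.
  - by move=> w _; have := dotv_le_sqn a (g x - gs w x); have := gb w; lra.
have k0 : 0 <= k by exact: sqr_ge0.
have := ler_wpM2l k0 s1; rewrite -/k; lra.
Qed.

End smoothing_quad.

End quad_smooth.

(** * Expectations of nonnegative functions, finite or not *)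

Section ge0_expectation.
Local Open Scope ereal_scope.
Context (R : realType) (dO : measure_display) (O : measurableType dO)
  (P : {measure set O -> \bar R}).

Lemma ge0_Ele (f g : O -> R) : measurable_fun setT f -> measurable_fun setT g ->
  (forall w, (0 <= f w)%R) -> (forall w, (f w <= g w)%R) ->
  \int[P]_w (f w)%:E <= \int[P]_w (g w)%:E.
Proof.
move=> mf mg f0 fg; apply: ge0_le_integral => //.
- by move=> w _; rewrite lee_fin.
- exact/measurable_EFinP.
- exact/measurable_EFinP.
- by move=> w _; rewrite lee_fin.
Qed.

Lemma ge0_ED (f g : O -> R) : measurable_fun setT f -> measurable_fun setT g ->
  (forall w, (0 <= f w)%R) -> (forall w, (0 <= g w)%R) ->
  \int[P]_w (f w + g w)%:E = \int[P]_w (f w)%:E + \int[P]_w (g w)%:E.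
Proof.
move=> mf mg f0 g0; under eq_integral do rewrite EFinD.
rewrite ge0_integralD//.
- by move=> w _; rewrite lee_fin.
- exact/measurable_EFinP.
- by move=> w _; rewrite lee_fin.
- exact/measurable_EFinP.
Qed.

Lemma ge0_EZ (k : R) (f : O -> R) : measurable_fun setT f -> (0 <= k)%R ->
  (forall w, (0 <= f w)%R) -> \int[P]_w (k * f w)%:E = k%:E * \int[P]_w (f w)%:E.
Proof.
move=> mf k0 f0; under eq_integral do rewrite EFinM.
rewrite ge0_integralZl//; first exact/measurable_EFinP.
by move=> w _; rewrite lee_fin.
Qed.

Lemma ge0_E_integrable (f : O -> R) (k : R) : measurable_fun setT f ->
  (forall w, (0 <= f w)%R) -> \int[P]_w (f w)%:E <= k%:E ->
  P.-integrable setT (EFin \o f) /\ (\int[P]_w f w <= k)%R.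
Proof.
move=> mf f0 fk.
have i : P.-integrable setT (EFin \o f).
  apply/integrableP; split; first exact/measurable_EFinP.
  apply: (le_lt_trans _ (ltry k)); apply: le_trans fk.
  by rewrite le_eqVlt; apply/orP; left; apply/eqP; apply: eq_integral => w _;
    rewrite /= ger0_norm.
by split => //; rewrite -lee_fin /Rintegral fineK//; exact: integrable_fin_num.
Qed.

Lemma integrable_EFin_Rintegral (f : O -> R) : P.-integrable setT (EFin \o f) ->
  \int[P]_w (f w)%:E = (\int[P]_w f w)%:E.
Proof. by move=> fi; rewrite /Rintegral fineK//; exact: integrable_fin_num. Qed.

End ge0_expectation.

(** * The residual-feedback iteration *)

Section sgd.
Context (R : realType) (d : nat) (dX dO dG : measure_display)
  (Xi : measurableType dX) (Omega : measurableType dO) (Gamma : measurableType dG)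
  (D : probability Xi R) (P : probability Omega R) (Q : probability Gamma R)
  (F : 'rV[R]_d -> Xi -> R) (v : {RV Q >-> d.-tuple R})
  (u : nat -> {RV P >-> d.-tuple R}) (xi : nat -> {RV P >-> Xi})
  (tau : {RV P >-> nat}) (T : nat) (x0 : 'rV[R]_d) (eta delta L0 sigma : R).
Hypotheses (adm : admissible_objective D F sigma L0) (gv : std_gaussian v)
  (smp : sampling D u xi tau T) (eta0 : 0 < eta) (delta0 : 0 < delta) (L0_gt0 : 0 < L0).

Notation c := (gauss_const R).
Notation f := (objective D F).
Notation U t w := (rowof (u t w)).
Notation V z := (rowof (v z)).
Notation x t w := (iterate F delta eta x0 (fun n => U n w) (fun n => xi n w) t).
Notation g t w := (feedback F delta eta x0 (fun n => U n w) (fun n => xi n w) t).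
Notation q t w := (F (x t w + delta *: U t w) (xi t w)).
Notation sg := (sgrad v f delta).
Notation sm := (smooth v f delta).
Let prev t w := if t is m.+1 then q m w else 0.

Let L0_ge0 : 0 <= L0. Proof. exact: ltW. Qed.

Let gE t w : g t w = ((q t w - prev t w) / delta) *: U t w.
Proof. by case: t. Qed.

Let xS t w : x t.+1 w = x t w - eta *: g t w.
Proof. exact: iterateS. Qed.

Let lipF s y z : `|F y s - F z s| <= L0 * l2norm (y - z).
Proof.
have [_ _ _ /(_ s)[l lL h]] := adm.
by rewrite (le_trans (h y z))// ler_wpM2r// l2norm_ge0.
Qed.

Let iF y : D.-integrable setT (EFin \o F y).
Proof. by have [+ _ _ _] := adm; apply. Qed.

Let mF y : measurable_fun setT (F y).
Proof. exact/measurable_EFinP/(measurable_int D (iF y)). Qed.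

Lemma objectiveE y : f y = \int[D]_s F y s.
Proof. by rewrite /objective unlock. Qed.

Lemma objective_lip y z : `|f y - f z| <= L0 * l2norm (y - z).
Proof.
rewrite !objectiveE -RintegralB// -[leRHS](Rintegral_cst_probability D).
apply: norm_Rintegral_le => //; first exact: integrable_diff.
exact: integrable_cst.
Qed.

Let S (k : option (nat + nat)) : set (set Omega) :=
  match k with
  | Some (inl t) => g_sigma_algebra_preimage (u t)
  | Some (inr t) => g_sigma_algebra_preimage (xi t)
  | None => g_sigma_algebra_preimage tau
  end.
(** [H J] generates the sigma-algebra of the random inputs indexed by [J], and [T1 J] is the sample
    space seen through it; measurability on [T1 J] expresses dependence on these inputs only. *)
Let H (J : set (option (nat + nat))) := \bigcup_(j in J) S j.
Let T1 J := g_sigma_algebraType (H J).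

Let S_m k : S k `<=` measurable.
Proof.
by case: k => [[n|n]|] _ [B mB <-]; exact: measurable_funP.
Qed.

Let Hm J : <<s H J >> `<=` measurable.
Proof.
apply: smallest_sub; first exact: sigma_algebra_measurable.
by move=> A [j _ /S_m].
Qed.

Let S_T k : S k setT.
Proof. by case: k => [[]|] /= *; exists setT => //; rewrite setTI preimage_setT. Qed.

Let S_I k : setI_closed (S k).
Proof.
by case: k => [[]|] /= *; move=> _ _ [B1 mB1 <-] [B2 mB2 <-]; (exists (B1 `&` B2);
  [exact: measurableI|rewrite !setTI preimage_setI]).
Qed.

Let indep J k A B : ~ J k -> <<s H J >> A -> S k B -> P (A `&` B) = (P A * P B)%E.
Proof.
have [_ _ _ ind] := smp; move=> Jk HA SB.
exact: (mutual_independence_sigma_algebra (S := S) ind S_T S_I S_m Jk HA SB).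
Qed.

Let hist_mono J J' d3 (T3 : measurableType d3) (h : Omega -> T3) : J `<=` J' ->
  measurable_fun setT (h : T1 J -> T3) -> measurable_fun setT (h : T1 J' -> T3).
Proof.
move=> JJ' mh _ B mB; have := mh measurableT B mB; rewrite !setTI.
apply: smallest_sub; first exact: smallest_sigma_algebra.
by move=> A [j Jj Sj]; apply: sub_sigma_algebra; exists j => //; exact: JJ'.
Qed.

Let measurable_hist J d3 (T3 : measurableType d3) (h : Omega -> T3) :
  measurable_fun setT (h : T1 J -> T3) -> measurable_fun setT h.
Proof. by move=> mh; apply: (measurable_sub (Hm (J := J)) mh). Qed.

(* [Jx t] indexes the randomness preceding round [t]; [Ju t] adds [u t]. *)
Let Jx t : set (option (nat + nat)) := [set k | match k with
  | Some (inl s) => (s < t)%N | Some (inr s) => (s < t)%N | None => False end].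
Let Ju t : set (option (nat + nat)) := [set k | match k with
  | Some (inl s) => (s <= t)%N | Some (inr s) => (s < t)%N | None => False end].
Let Jall : set (option (nat + nat)) := [set k | k <> None].

Let JxS t : Jx t `<=` Jx t.+1.
Proof. by move=> [[s|s]|] //= st; rewrite ltnS ltnW. Qed.
Let Jxu t : Jx t `<=` Ju t.
Proof. by move=> [[s|s]|] //= st; rewrite ltnW. Qed.
Let JuS t : Ju t `<=` Jx t.+1.
Proof. by move=> [[s|s]|] //= st; rewrite ltnS ltnW. Qed.
Let Jxall t : Jx t `<=` Jall.
Proof. by move=> [[s|s]|]. Qed.

Let measurable_u J t : J (Some (inl t)) -> measurable_fun setT (u t : T1 J -> d.-tuple R).
Proof.
move=> Jt _ B mB; rewrite setTI; apply: sub_sigma_algebra; exists (Some (inl t)) => //.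
by exists B => //; rewrite setTI.
Qed.

Let measurable_U J t i : J (Some (inl t)) ->
  measurable_fun setT ((fun w => U t w ord0 i) : T1 J -> R).
Proof.
move=> Jt; under eq_fun do rewrite mxE.
exact: (measurableT_comp (measurable_tnth i) (measurable_u Jt)).
Qed.

Let measurable_xi J t : J (Some (inr t)) -> measurable_fun setT (xi t : T1 J -> Xi).
Proof.
move=> Jt _ B mB; rewrite setTI; apply: sub_sigma_algebra; exists (Some (inr t)) => //.
by exists B => //; rewrite setTI.
Qed.

Let measurable_query J t (Y : Omega -> 'rV[R]_d) : J (Some (inr t)) ->
  (forall i, measurable_fun setT ((fun w => Y w ord0 i) : T1 J -> R)) ->
  measurable_fun setT ((fun w => F (Y w) (xi t w)) : T1 J -> R).
Proof.
move=> Jt mY.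
exact: (measurable_lipschitz_comp L0_ge0 lipF mF mY (measurable_xi Jt)).
Qed.

Let measurable_shiftU J t i : J (Some (inl t)) ->
  (forall i, measurable_fun setT ((fun w => x t w ord0 i) : T1 J -> R)) ->
  measurable_fun setT ((fun w => (x t w + delta *: U t w) ord0 i) : T1 J -> R).
Proof.
move=> Jt mx; under eq_fun do rewrite 2!mxE.
apply: measurable_funD => //; apply: measurable_funM => //; exact: measurable_U.
Qed.

(** The update uses both the iterate and the previous query, so the induction carries the pair. *)
Let measurable_state t :
  (forall i, measurable_fun setT ((fun w => x t w ord0 i) : T1 (Jx t) -> R)) /\
  measurable_fun setT (prev t : T1 (Jx t) -> R).
Proof.
elim: t => [|t [mx mp]]; first by split => [i|]; exact: measurable_cst.
have mx' i : measurable_fun setT ((fun w => x t w ord0 i) : T1 (Jx t.+1) -> R).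
  exact: hist_mono (@JxS t) (mx i).
have mp' : measurable_fun setT (prev t : T1 (Jx t.+1) -> R).
  exact: hist_mono (@JxS t) mp.
have mq : measurable_fun setT ((fun w => q t w) : T1 (Jx t.+1) -> R).
  apply: measurable_query => [|i]; first by rewrite /Jx/=.
  by apply: measurable_shiftU => //; rewrite /Jx/=.
split => // i.
under eq_fun do rewrite xS gE !mxE.
apply: measurable_funB => //; apply: measurable_funM => //.
apply: measurable_funM.
  by apply: measurable_funM => //; exact: measurable_funB.
apply: (measurableT_comp (measurable_tnth i)).
by apply: measurable_u; rewrite /Jx/=.
Qed.

Let measurable_x J t i : Jx t `<=` J ->
  measurable_fun setT ((fun w => x t w ord0 i) : T1 J -> R).
Proof. by move=> tJ; apply: hist_mono tJ _; have [+ _] := measurable_state t; apply. Qed.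

Let measurable_prev J t : Jx t `<=` J -> measurable_fun setT (prev t : T1 J -> R).
Proof. by move=> tJ; apply: hist_mono tJ _; have [] := measurable_state t. Qed.

Let measurable_g t i : measurable_fun setT ((fun w => g t w ord0 i) : T1 (Jx t.+1) -> R).
Proof.
under eq_fun do rewrite gE mxE.
apply: measurable_funM; last by apply: measurable_U; rewrite /Jx/=.
apply: measurable_funM => //; apply: measurable_funB.
  apply: measurable_query => [|j]; first by rewrite /Jx/=.
  by apply: measurable_shiftU => [|k]; [rewrite /Jx/=|apply: measurable_x; exact: JxS].
by apply: measurable_prev; exact: JxS.
Qed.

(** * Integrating out a fresh direction or a fresh sample *)

Let gu t : std_gaussian (u t). Proof. by have [+ _ _ _] := smp; apply. Qed.

Let law_u t (A : set (d.-tuple R)) : measurable A ->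
  distribution P (u t) A = distribution Q v A.
Proof. by move=> mA; exact: std_gaussian_law. Qed.

Let ge0_law_u t (h : d.-tuple R -> \bar R) : measurable_fun setT h ->
  (forall y, (0 <= h y)%E) ->
  (\int[distribution P (u t)]_y h y = \int[Q]_z h (v z))%E.
Proof.
move=> mh h0; rewrite (@eq_measure_integral _ _ _ _ (distribution Q v)).
  by rewrite ge0_integral_distribution.
by move=> A mA _; exact: law_u.
Qed.

Let Rlaw_u t (h : d.-tuple R -> R) : measurable_fun setT h ->
  Q.-integrable setT (fun z => (h (v z))%:E) ->
  (distribution P (u t)).-integrable setT (EFin \o h) /\
  \int[distribution P (u t)]_y h y = \int[Q]_z h (v z).
Proof.
move=> mh ih; have mhE : measurable_fun setT (EFin \o h) by exact/measurable_EFinP.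
split.
  apply/integrableP; split => //; rewrite (ge0_law_u t (h := abse \o (EFin \o h))).
  - by move/integrableP : ih => [].
  - exact: measurableT_comp.
  - by move=> y; exact: abse_ge0.
rewrite /Rintegral (@eq_measure_integral _ _ _ _ (distribution Q v)).
  by rewrite integral_distribution.
by move=> A mA _; exact: law_u.
Qed.

Let law_xi t (h : Xi -> \bar R) :
  (\int[distribution P (xi t)]_s h s = \int[D]_s h s)%E.
Proof.
by apply: eq_measure_integral => A mA _; have [_ + _ _] := smp; apply.
Qed.

Let integrable_law_xi t (h : Xi -> R) : D.-integrable setT (EFin \o h) ->
  (distribution P (xi t)).-integrable setT (EFin \o h).
Proof.
by move=> /integrableP[mh ih]; apply/integrableP; split => //; rewrite law_xi.
Qed.

Let indep_u t A B : <<s H (Jx t) >> A -> measurable B ->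
  P (A `&` u t @^-1` B) = (P A * P (u t @^-1` B))%E.
Proof.
move=> HA mB; apply: (@indep _ (Some (inl t))) HA _; first by rewrite /Jx/= ltnn.
by exists B => //; rewrite setTI.
Qed.

Let indep_xi t A B : <<s H (Ju t) >> A -> measurable B ->
  P (A `&` xi t @^-1` B) = (P A * P (xi t @^-1` B))%E.
Proof.
move=> HA mB; apply: (@indep _ (Some (inr t))) HA _; first by rewrite /Ju/= ltnn.
by exists B => //; rewrite setTI.
Qed.

Let indep_tau A B : <<s H Jall >> A -> measurable B ->
  P (A `&` tau @^-1` B) = (P A * P (tau @^-1` B))%E.
Proof.
move=> HA mB; apply: (@indep _ None) HA _; first exact.
by exists B => //; rewrite setTI.
Qed.

Let E_mul_u t (Z : Omega -> R) (k : d.-tuple R -> R) :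
  measurable_fun setT (Z : T1 (Jx t) -> R) -> measurable_fun setT k ->
  (forall w, 0 <= Z w) -> (forall y, 0 <= k y) ->
  (\int[P]_w (Z w * k (u t w))%:E = (\int[P]_w (Z w)%:E) * \int[Q]_z (k (v z))%:E)%E.
Proof.
move=> mZ mk Z0 k0.
have mkE : measurable_fun setT (EFin \o k) by exact/measurable_EFinP.
rewrite (ge0_integral_sub (Hm (J := Jx t)) (@indep_u t)
  (h := fun p : T1 (Jx t) * d.-tuple R => (Z p.1 * k p.2)%:E)); last 2 first.
- apply/measurable_EFinP; apply: measurable_funM.
    exact: (measurableT_comp mZ).
  exact: (measurableT_comp mk).
- by move=> p; rewrite lee_fin mulr_ge0.
rewrite -ge0_integralZr//; last 3 first.
- exact/measurable_EFinP/(measurable_hist mZ).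
- by move=> w _; rewrite lee_fin.
- by apply: integral_ge0 => z _; rewrite lee_fin.
apply: eq_integral => w _ /=; rewrite ge0_EZ// (ge0_law_u t (h := EFin \o k))//.
Qed.

(** The weight [Z] and the point [Y] are determined before [xi t] is drawn, so averaging the sample
    first leaves the variance of [F] at a frozen point. *)
Let E_var_xi t (Z : Omega -> R) (Y : Omega -> 'rV[R]_d) :
  measurable_fun setT (Z : T1 (Ju t) -> R) ->
  (forall i, measurable_fun setT ((fun w => Y w ord0 i) : T1 (Ju t) -> R)) ->
  (forall w, 0 <= Z w) ->
  (\int[P]_w (Z w * (F (Y w) (xi t w) - f (Y w)) ^+ 2)%:E <=
   (sigma ^+ 2)%:E * \int[P]_w (Z w)%:E)%E.
Proof.
move=> mZ mY Z0.
pose h (p : T1 (Ju t) * Xi) := Z p.1 * (F (Y p.1) p.2 - f (Y p.1)) ^+ 2.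
have mY1 i : measurable_fun setT (fun p : T1 (Ju t) * Xi => Y p.1 ord0 i).
  exact: (measurableT_comp (mY i)).
have mh : measurable_fun setT h.
  apply: measurable_funM; first exact: (measurableT_comp mZ).
  apply: measurable_funX; apply: measurable_funB.
    exact: (measurable_lipschitz_comp L0_ge0 lipF mF mY1).
  exact: (measurable_lipschitz L0_ge0 objective_lip mY1).
rewrite (ge0_integral_sub (Hm (J := Ju t)) (@indep_xi t) (h := EFin \o h)); last 2 first.
- exact/measurable_EFinP.
- by move=> p; rewrite lee_fin mulr_ge0// sqr_ge0.
rewrite -ge0_EZ//; last 2 first.
- exact: measurable_hist mZ.
- exact: sqr_ge0.
have mhE : measurable_fun setT (EFin \o h) by exact/measurable_EFinP.
apply: ge0_le_integral => //.
- by move=> w _; apply: integral_ge0 => s _; rewrite lee_fin mulr_ge0// sqr_ge0.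
- apply: (measurable_sub (Hm (J := Ju t))).
  apply: (measurable_fun_fubini_tonelli_F (EFin \o h)) => // p.
  by rewrite lee_fin mulr_ge0// sqr_ge0.
- by apply/measurable_EFinP; apply: measurable_funM => //; exact: measurable_hist mZ.
move=> w _; rewrite law_xi /h/= ge0_EZ//; last 2 first.
- by apply: measurable_funX; exact: measurable_funB.
- by move=> s; exact: sqr_ge0.
rewrite mulrC EFinM lee_wpmul2l ?lee_fin//.
by have [_ _ + _] := adm; move=> /(_ (Y w)); rewrite unlock.
Qed.

(** Stated in the extended reals, since finiteness at round [t] is itself a consequence of this
    recursion. The constants come from two three-term square inequalities, giving [9 = 3 * 3] for
    the Lipschitz terms and 3 for each noise term. *)
Lemma feedback_moment t :
  (\int[P]_w (sqn (g t.+1 w))%:E <=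
   (9 * L0 ^+ 2 * eta ^+ 2 * c * d%:R / delta ^+ 2)%:E * \int[P]_w (sqn (g t w))%:E +
   (18 * L0 ^+ 2 * c ^+ 2 * d%:R ^+ 2 + 6 * sigma ^+ 2 * c * d%:R / delta ^+ 2)%:E)%E.
Proof.
have c1 : 1 <= c := gauss_const_ge1 R.
have c0 : 0 <= c := le_trans ler01 c1.
have d2 : 0 < delta ^+ 2 by rewrite exprn_gt0.
pose y w := x t w + delta *: U t w.
pose S1 w := sqn (U t.+1 w). pose S0 w := sqn (U t w).
pose G w := sqn (g t w).
(* [b] and [e] are the noises of the new and of the old sample, both at the old query point; what
   remains of the query difference compares two points under the same sample. *)
pose b w := F (y w) (xi t.+1 w) - f (y w).
pose e w := F (y w) (xi t w) - f (y w).
have S1_ge0 w : 0 <= S1 w by exact: sqn_ge0.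
have S0_ge0 w : 0 <= S0 w by exact: sqn_ge0.
have G_ge0 w : 0 <= G w by exact: sqn_ge0.
pose a1 := 9 * L0 ^+ 2 * eta ^+ 2 / delta ^+ 2.
pose a2 := 9 * L0 ^+ 2.
pose a4 := 3 / delta ^+ 2.
have a1_ge0 : 0 <= a1 by rewrite divr_ge0 ?mulr_ge0 ?sqr_ge0 ?ltW.
have a2_ge0 : 0 <= a2 by rewrite mulr_ge0 ?sqr_ge0.
have a4_ge0 : 0 <= a4 by rewrite divr_ge0 ?ltW.
have ptw w : sqn (g t.+1 w) <= a1 * (G w * S1 w) + (a2 * (1 * (S1 w ^+ 2)) +
    (a2 * (S0 w * S1 w) + (a4 * (S1 w * b w ^+ 2) + a4 * (e w ^+ 2 * S1 w)))).
  rewrite gE sqnZ -/(S1 w) expr_div_n.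
  have -> : prev t.+1 w = F (y w) (xi t w) by [].
  set r := q t.+1 w - F (y w) (xi t.+1 w).
  have -> : q t.+1 w - F (y w) (xi t w) = r + b w - e w by rewrite /r /b /e; ring.
  have h1 : r ^+ 2 <= L0 ^+ 2 * (3 * (eta ^+ 2 * G w + delta ^+ 2 * S1 w + delta ^+ 2 * S0 w)).
    rewrite -[r ^+ 2]real_normK ?num_real//.
    have h := lipF (xi t.+1 w) (x t.+1 w + delta *: U t.+1 w) (y w).
    rewrite (@le_trans _ _ ((L0 * l2norm (x t.+1 w + delta *: U t.+1 w - y w)) ^+ 2))//.
      by rewrite lerXn2r// nnegrE mulr_ge0// l2norm_ge0.
    rewrite exprMn l2norm_sqr ler_wpM2l ?sqr_ge0//.
    have -> : x t.+1 w + delta *: U t.+1 w - y w =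
        - (eta *: g t w) + delta *: U t.+1 w + - (delta *: U t w).
      by rewrite xS /y; apply/rowP => i; rewrite !mxE; ring.
    by apply: le_trans (sqnD3_le _ _ _) _; rewrite !sqnN (sqnZ eta) !(sqnZ delta).
  have h2 : (r + b w - e w) ^+ 2 <= 3 * (r ^+ 2 + b w ^+ 2 + e w ^+ 2).
    have := sqr_ge0 (r - b w); have := sqr_ge0 (r + e w); have := sqr_ge0 (b w + e w).
    rewrite !expr2; lra.
  have h3 : (r + b w - e w) ^+ 2 <= 9 * L0 ^+ 2 * eta ^+ 2 * G w +
      9 * L0 ^+ 2 * delta ^+ 2 * (S1 w + S0 w) + 3 * (b w ^+ 2 + e w ^+ 2) by lra.
  have k0 : 0 <= S1 w / delta ^+ 2 by rewrite divr_ge0// ltW.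
  have -> : (r + b w - e w) ^+ 2 / delta ^+ 2 * S1 w =
      S1 w / delta ^+ 2 * (r + b w - e w) ^+ 2 by ring.
  apply: le_trans (ler_wpM2l k0 h3) _; rewrite le_eqVlt; apply/orP; left; apply/eqP.
  by rewrite /a1 /a2 /a4; field; rewrite gt_eqF.
have mS J s : J (Some (inl s)) -> measurable_fun setT ((fun w => sqn (U s w)) : T1 J -> R).
  by move=> Js; apply: measurable_sqn => i; exact: measurable_U.
have mS1 : measurable_fun setT (S1 : T1 (Ju t.+1) -> R) by apply: mS; rewrite /Ju/=.
have mS0 : measurable_fun setT (S0 : T1 (Jx t.+1) -> R) by apply: mS; rewrite /Jx/=.
have mG : measurable_fun setT (G : T1 (Jx t.+1) -> R).
  by apply: measurable_sqn => i; exact: measurable_g.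
have my J i : Ju t `<=` J -> measurable_fun setT ((fun w => y w ord0 i) : T1 J -> R).
  move=> tJ; apply: measurable_shiftU => [|j]; first by apply: tJ; rewrite /Ju/=.
  by apply: measurable_x => k /Jxu/tJ.
have mfy J : Ju t `<=` J -> measurable_fun setT ((fun w => f (y w)) : T1 J -> R).
  by move=> tJ; apply: (measurable_lipschitz L0_ge0 objective_lip) => i; exact: my.
have me : measurable_fun setT (e : T1 (Jx t.+1) -> R).
  apply: measurable_funB; last by apply: mfy; exact: JuS.
  apply: measurable_query => [|i]; first by rewrite /Jx/=.
  by apply: my; exact: JuS.
have mb : measurable_fun setT b.
  apply: (@measurable_hist (Jx t.+2)); apply: measurable_funB.
    apply: measurable_query => [|i]; first by rewrite /Jx/=.
    by apply: my => k /JuS/JxS.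
  by apply: mfy => k /JuS/JxS.
have MS1 := measurable_hist mS1; have MS0 := measurable_hist mS0.
have MG := measurable_hist mG; have Me := measurable_hist me.
have mg1 : measurable_fun setT ((fun w => sqn (g t.+1 w)) : T1 (Jx t.+2) -> R).
  by apply: measurable_sqn => i; exact: measurable_g.
have Mg := measurable_hist mg1.
have mk1 : measurable_fun setT (fun p : d.-tuple R => sqn (rowof p)).
  apply: measurable_sqn => i; under eq_fun do rewrite mxE.
  exact: measurable_tnth.
have [iV EV] := gaussian_sqn gv. have [iV2 EV2] := gaussian_sqn2 gv.
have QV : (\int[Q]_z (sqn (V z))%:E <= (c * d%:R)%:E)%E.
  by rewrite integrable_EFin_Rintegral// lee_fin.
have QV2 : (\int[Q]_z (sqn (V z) ^+ 2)%:E <= (c * d%:R ^+ 2)%:E)%E.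
  by rewrite (integrable_EFin_Rintegral iV2) lee_fin.
have E1 : (\int[P]_w (cst 1 w)%:E = 1)%E.
  apply: (eq_trans (integrable_EFin_Rintegral (integrable_cst P 1))).
  by rewrite Rintegral_cst_probability.
have T1E : (\int[P]_w (G w * S1 w)%:E <= (\int[P]_w (G w)%:E) * (c * d%:R)%:E)%E.
  rewrite (E_mul_u mG mk1)//; last by move=> p; exact: sqn_ge0.
  by rewrite lee_wpmul2l//; apply: integral_ge0 => w _; rewrite lee_fin.
have T2E : (\int[P]_w (1 * S1 w ^+ 2)%:E <= (c * d%:R ^+ 2)%:E)%E.
  rewrite (@E_mul_u t.+1 (cst 1) (fun p => sqn (rowof p) ^+ 2))//.
  - by rewrite E1 mul1e.
  - exact: measurable_funX.
  - by move=> p; exact: sqr_ge0.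
have S0E : (\int[P]_w (S0 w)%:E <= (c * d%:R)%:E)%E.
  have := @E_mul_u t (cst 1) (fun p => sqn (rowof p)) (measurable_cst _) mk1
    (fun=> ler01) (fun p => sqn_ge0 _).
  rewrite E1 mul1e => h; apply: le_trans QV; rewrite -h le_eqVlt; apply/orP; left.
  by apply/eqP; apply: eq_integral => w _; rewrite /= mul1r.
have T3E : (\int[P]_w (S0 w * S1 w)%:E <= (c ^+ 2 * d%:R ^+ 2)%:E)%E.
  rewrite (E_mul_u mS0 mk1)//; last by move=> p; exact: sqn_ge0.
  rewrite (_ : c ^+ 2 * d%:R ^+ 2 = (c * d%:R) * (c * d%:R)) ?EFinM; last by ring.
  by apply: lee_pmul => //; apply: integral_ge0 => w _; rewrite lee_fin sqn_ge0.
have S1E : (\int[P]_w (S1 w)%:E <= (c * d%:R)%:E)%E.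
  have := @E_mul_u t.+1 (cst 1) (fun p => sqn (rowof p)) (measurable_cst _) mk1
    (fun=> ler01) (fun p => sqn_ge0 _).
  rewrite E1 mul1e => h; apply: le_trans QV; rewrite -h le_eqVlt; apply/orP; left.
  by apply/eqP; apply: eq_integral => w _; rewrite /= mul1r.
(* [b] involves [xi t.+1], which is independent of [u t.+1] and the past, so it is averaged first
   with weight [S1]; [e] depends on the past alone, so in [T5E] the independent [u t.+1] factors
   out. *)
have T4E : (\int[P]_w (S1 w * b w ^+ 2)%:E <= (sigma ^+ 2 * (c * d%:R))%:E)%E.
  apply: le_trans (E_var_xi mS1 _ S1_ge0) _.
    by move=> i; apply: my => k /JuS/Jxu.
  by rewrite [leRHS]EFinM lee_wpmul2l// lee_fin sqr_ge0.
have eE : (\int[P]_w (e w ^+ 2)%:E <= (sigma ^+ 2)%:E)%E.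
  have h := @E_var_xi t (cst 1) y (measurable_cst _) (fun i => my (Ju t) i (@subset_refl _ _)) (fun=> ler01).
  rewrite E1 mule1 in h; apply: le_trans h.
  by rewrite le_eqVlt; apply/orP; left; apply/eqP; apply: eq_integral => w _; rewrite mul1r.
have T5E : (\int[P]_w (e w ^+ 2 * S1 w)%:E <= (sigma ^+ 2 * (c * d%:R))%:E)%E.
  have me2 : measurable_fun setT ((fun w => e w ^+ 2) : T1 (Jx t.+1) -> R).
    exact: measurable_funX.
  rewrite (E_mul_u me2 mk1) ?EFinM//; last 2 first.
  - by move=> w; exact: sqr_ge0.
  - by move=> p; exact: sqn_ge0.
  by apply: lee_pmul => //; apply: integral_ge0 => w _; rewrite lee_fin ?sqr_ge0 ?sqn_ge0.
have n1 w : 0 <= G w * S1 w by rewrite mulr_ge0.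
have n2 w : 0 <= 1 * S1 w ^+ 2 by rewrite mul1r sqr_ge0.
have n3 w : 0 <= S0 w * S1 w by rewrite mulr_ge0.
have n4 w : 0 <= S1 w * b w ^+ 2 by rewrite mulr_ge0 ?sqr_ge0.
have n5 w : 0 <= e w ^+ 2 * S1 w by rewrite mulr_ge0 ?sqr_ge0.
have M1 : measurable_fun setT (fun w => G w * S1 w) by exact: measurable_funM.
have M2 : measurable_fun setT (fun w => 1 * S1 w ^+ 2).
  by apply: measurable_funM => //; exact: measurable_funX.
have M3 : measurable_fun setT (fun w => S0 w * S1 w) by exact: measurable_funM.
have M4 : measurable_fun setT (fun w => S1 w * b w ^+ 2).
  by apply: measurable_funM => //; exact: measurable_funX.
have M5 : measurable_fun setT (fun w => e w ^+ 2 * S1 w).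
  by apply: measurable_funM => //; exact: measurable_funX.
have mZ (a : R) (h : Omega -> R) : measurable_fun setT h -> measurable_fun setT (fun w => a * h w).
  by move=> mh; exact: measurable_funM.
have nZ (a : R) (h : Omega -> R) : 0 <= a -> (forall w, 0 <= h w) -> forall w, 0 <= a * h w.
  by move=> a0 h0 w; exact: mulr_ge0.
apply: le_trans (ge0_Ele P Mg _ (fun w => sqn_ge0 _) ptw) _.
  by do 4 (apply: measurable_funD; first exact: mZ); exact: mZ.
rewrite ge0_ED; [|exact: mZ| |exact: nZ|]; last 2 first.
- by do 3 (apply: measurable_funD; first exact: mZ); exact: mZ.
- by move=> w; do ?[apply: addr_ge0]; apply: mulr_ge0.
rewrite ge0_ED; [|exact: mZ| |exact: nZ|]; last 2 first.
- by do 2 (apply: measurable_funD; first exact: mZ); exact: mZ.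
- by move=> w; do ?[apply: addr_ge0]; apply: mulr_ge0.
rewrite ge0_ED; [|exact: mZ| |exact: nZ|]; last 2 first.
- by apply: measurable_funD; exact: mZ.
- by move=> w; do ?[apply: addr_ge0]; apply: mulr_ge0.
rewrite ge0_ED; [|exact: mZ|exact: mZ|exact: nZ|exact: nZ].
rewrite (ge0_EZ P M1 a1_ge0 n1) (ge0_EZ P M2 a2_ge0 n2) (ge0_EZ P M3 a2_ge0 n3).
rewrite (ge0_EZ P M4 a4_ge0 n4) (ge0_EZ P M5 a4_ge0 n5).
have lw (a : R) (p r : \bar R) : 0 <= a -> (p <= r)%E -> (a%:E * p <= a%:E * r)%E.
  by move=> a0 pr; rewrite lee_wpmul2l ?lee_fin.
apply: (@le_trans _ _ (a1%:E * (\int[P]_w (G w)%:E * (c * d%:R)%:E) +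
  (a2%:E * (c * d%:R ^+ 2)%:E + (a2%:E * (c ^+ 2 * d%:R ^+ 2)%:E +
  (a4%:E * (sigma ^+ 2 * (c * d%:R))%:E + a4%:E * (sigma ^+ 2 * (c * d%:R))%:E))))%E).
  by do 4 (apply: leeD; first exact: lw); exact: lw.
apply: leeD.
  rewrite muleCA muleC -EFinM (_ : a1 * (c * d%:R) =
    9 * L0 ^+ 2 * eta ^+ 2 * c * d%:R / delta ^+ 2)//.
  by rewrite /a1; field; rewrite gt_eqF.
rewrite -!EFinM -!EFinD lee_fin /a2 /a4.
(* Since [c >= 1], the fourth-moment term [c * d ^+ 2] is absorbed by the product term
   [c ^+ 2 * d ^+ 2]; together they give [18 = 9 + 9]. *)
have cc : c <= c ^+ 2 by rewrite ler_eXnr.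
have dd : 0 <= L0 ^+ 2 * d%:R ^+ 2 by rewrite mulr_ge0 ?sqr_ge0.
have := ler_wpM2l dd cc.
rewrite (_ : 3 / delta ^+ 2 * (sigma ^+ 2 * (c * d%:R)) =
   3 * (sigma ^+ 2 * c * d%:R / delta ^+ 2)); last by ring.
rewrite (_ : 6 * sigma ^+ 2 * c * d%:R / delta ^+ 2 =
   6 * (sigma ^+ 2 * c * d%:R / delta ^+ 2)); last by ring.
lra.
Qed.

Let measurable_sg J (Y : Omega -> 'rV[R]_d) i :
  (forall j, measurable_fun setT ((fun w => Y w ord0 j) : T1 J -> R)) ->
  measurable_fun setT ((fun w => sg (Y w) ord0 i) : T1 J -> R).
Proof.
move=> mY; apply: (measurable_lipschitz (f := fun y => sg y ord0 i) (L := L0 / delta * c)) => //.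
  by rewrite !mulr_ge0 ?invr_ge0 ?(ltW delta0)// (le_trans ler01 (gauss_const_ge1 R)).
exact: (sgrad_lip gv L0_ge0 delta0 objective_lip i).
Qed.

Let measurable_gx t i : measurable_fun setT (fun w => g t w ord0 i : R).
Proof.
move=> _ B mB; rewrite setTI; apply: (Hm (J := Jx t.+1)).
have := @measurable_g t i measurableT B mB; by rewrite setTI.
Qed.

Let measurable_sqn_g t : measurable_fun setT (fun w => sqn (g t w)).
Proof. by apply: measurable_sqn => i; exact: measurable_gx. Qed.

Lemma integrable_feedback t (mu : R) : (\int[P]_w (sqn (g t w))%:E <= mu%:E)%E ->
  [/\ P.-integrable setT (EFin \o (fun w => sqn (g t w))), \int[P]_w sqn (g t w) <= mu &
    forall i, P.-integrable setT (EFin \o (fun w => g t w ord0 i))].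
Proof.
move=> hmu; have [i1 le1] := ge0_E_integrable (measurable_sqn_g t) (fun w => sqn_ge0 _) hmu.
split => // i; apply: (integrable_dominated (measurable_gx t i)
  (integrable_add (integrable_cst P 1) i1)) => w.
by rewrite (le_trans (coord_le_l2norm _ _))// l2norm_le_sqn.
Qed.

Let sg_bound y i : `|sg y ord0 i| <= L0.
Proof. exact: (sgrad_bound gv L0_ge0 delta0 objective_lip). Qed.

Let measurable_sgx t i : measurable_fun setT (fun w => sg (x t w) ord0 i : R).
Proof.
apply: (measurable_sub (Hm (J := Jx t)) (f := fun w => sg (x t w) ord0 i)).
by apply: measurable_sg => j; exact: measurable_x.
Qed.

Let integrable_sg_sqr t i : P.-integrable setT (EFin \o (fun w => sg (x t w) ord0 i ^+ 2)).
Proof.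
apply: (integrable_dominated _ (integrable_cst P (L0 ^+ 2))).
  exact: measurable_funX.
by move=> w; rewrite normrX lerXn2r// nnegrE.
Qed.

(** Unbiasedness is tested only against [sg (x t)], the form that enters the descent inequality.
    This test factor is bounded and depends on the past alone, so it passes through both
    integrations. *)
Let unbiased_coordinate t i (mu : R) : (\int[P]_w (sqn (g t w))%:E <= mu%:E)%E ->
  P.-integrable setT (EFin \o (fun w => sg (x t w) ord0 i * g t w ord0 i)) /\
  \int[P]_w (sg (x t w) ord0 i * g t w ord0 i) = \int[P]_w (sg (x t w) ord0 i ^+ 2).
Proof.
move=> /integrable_feedback[_ _ /(_ i) ig].
have isg : P.-integrable setT (EFin \o (fun w => sg (x t w) ord0 i * g t w ord0 i)).
  apply: (integrable_dominated _ (integrable_scale L0 (integrable_norm ig))).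
    by apply: measurable_funM => //; exact: measurable_gx.
  by move=> w; rewrite normrM ler_wpM2r.
split => //.
(* [h] separates the sample from the past and [u t]; [k] is what remains after averaging the sample,
   with [F] replaced by [f], and separates [u t] from the past. *)
pose h (p : T1 (Ju t) * Xi) : R := sg (x t p.1) ord0 i *
  ((F (x t p.1 + delta *: U t p.1) p.2 - prev t p.1) / delta * U t p.1 ord0 i).
pose k (p : T1 (Jx t) * d.-tuple R) : R := sg (x t p.1) ord0 i *
  ((f (x t p.1 + delta *: rowof p.2) - prev t p.1) / delta * rowof p.2 ord0 i).
have hE w : sg (x t w) ord0 i * g t w ord0 i = h (w, xi t w).
  by rewrite gE [(_ *: U t w) _ _]mxE.
have Ut : Ju t (Some (inl t)) by rewrite /Ju/=.
have mUs j : measurable_fun setT ((fun w => (x t w + delta *: U t w) ord0 j) : T1 (Ju t) -> R).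
  by apply: measurable_shiftU => // l; apply: measurable_x; exact: Jxu.
have mh : measurable_fun setT h.
  apply: measurable_funM.
    apply: (measurableT_comp (f := (fun w => sg (x t w) ord0 i) : T1 (Ju t) -> R)) => //.
    by apply: measurable_sg => j; apply: measurable_x; exact: Jxu.
  apply: measurable_funM; last first.
    by apply: (measurableT_comp (f := (fun w => U t w ord0 i) : T1 (Ju t) -> R)) => //;
      exact: measurable_U.
  apply: measurable_funM => //; apply: measurable_funB.
    apply: (measurable_lipschitz_comp (T := (T1 (Ju t) * Xi)%type) L0_ge0 lipF mF
      (X := fun p => x t p.1 + delta *: U t p.1) (Y := snd)) => // j.
    exact: (measurableT_comp (mUs j)).
  apply: (measurableT_comp (f := prev t : T1 (Ju t) -> R)) => //.
  by apply: measurable_prev; exact: Jxu.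
have iD w a : D.-integrable setT (EFin \o (fun s => a * (F (x t w + delta *: U t w) s - prev t w))).
  by apply: integrable_scale; apply: integrable_diff => //; exact: integrable_cst.
have hD w s : h (w, s) = (sg (x t w) ord0 i / delta * U t w ord0 i) *
    (F (x t w + delta *: U t w) s - prev t w) by rewrite /h/=; ring.
have hI w : \int[distribution P (xi t)]_s h (w, s) = k (w, u t w).
  rewrite /Rintegral law_xi -/(Rintegral D setT (fun s => h (w, s))).
  under eq_Rintegral do rewrite hD.
  rewrite RintegralZl//; last by apply: integrable_diff => //; exact: integrable_cst.
  rewrite RintegralB//; last exact: integrable_cst.
  by rewrite Rintegral_cst_probability -objectiveE /k/=; ring.
have [] := Rintegral_sub (Hm (J := Ju t)) (@indep_xi t) mh.
- by apply: eq_integrable isg => // w _; rewrite /= hE.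
- move=> w; apply: integrable_law_xi; apply: eq_integrable (iD w _) => // s _.
  by rewrite /= hD.
move=> ik Ek; under eq_Rintegral do rewrite hE.
rewrite Ek; under eq_Rintegral do rewrite hI.
have mk : measurable_fun setT k.
  apply: measurable_funM.
    apply: (measurableT_comp (f := (fun w => sg (x t w) ord0 i) : T1 (Jx t) -> R)) => //.
    by apply: measurable_sg => j; exact: measurable_x.
  have mr j : measurable_fun setT (fun p : T1 (Jx t) * d.-tuple R => rowof p.2 ord0 j).
    under eq_fun do rewrite mxE.
    exact: (measurableT_comp (measurable_tnth j)).
  apply: measurable_funM => //; apply: measurable_funM => //; apply: measurable_funB.
    apply: (measurable_lipschitz (T := (T1 (Jx t) * d.-tuple R)%type) L0_ge0 objective_lip
      (X := fun p => x t p.1 + delta *: rowof p.2)) => j.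
    under eq_fun do rewrite 2!mxE.
    apply: measurable_funD; last by apply: measurable_funM => //; exact: mr.
    apply: (measurableT_comp (f := (fun w => x t w ord0 j) : T1 (Jx t) -> R)) => //.
    exact: measurable_x.
  apply: (measurableT_comp (f := prev t : T1 (Jx t) -> R)) => //.
  exact: measurable_prev.
have ik' : P.-integrable setT (fun w => (k (w, u t w))%:E).
  by apply: eq_integrable ik => // w _; rewrite /= hI.
have [im Em] := gaussian_mean0 gv i.
have ics y := integrable_coord_shift gv L0_ge0 delta0 objective_lip i y.
have kQ w z : k (w, v z) = sg (x t w) ord0 i / delta *
    (V z ord0 i * f (x t w + delta *: V z) - prev t w * V z ord0 i) by rewrite /k/=; ring.
have iQ w : Q.-integrable setT (EFin \o (fun z =>
    V z ord0 i * f (x t w + delta *: V z) - prev t w * V z ord0 i)).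
  by apply: integrable_diff => //; exact: integrable_scale.
have iQk w : Q.-integrable setT (fun z => (k (w, v z))%:E).
  have := integrable_scale (sg (x t w) ord0 i / delta) (iQ w).
  by apply: eq_integrable => // z _; rewrite /= kQ.
have mkw w : measurable_fun setT (fun y => k (w, y)).
  exact: (measurableT_comp mk (pair1_measurable (w : T1 (Jx t)))).
have [] := Rintegral_sub (Hm (J := Jx t)) (@indep_u t) mk ik'.
  by move=> w; have [] := Rlaw_u t (mkw w) (iQk w).
move=> _ ->; apply: eq_Rintegral => w _.
have [_ ->] := Rlaw_u t (mkw w) (iQk w).
under eq_Rintegral do rewrite kQ.
rewrite RintegralZl// RintegralB//; last exact: integrable_scale.
(* The previous query is known before [u t], so its contribution vanishes with the mean of [u t]. *)
rewrite RintegralZl// Em mulr0 subr0 expr2.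
rewrite -mulrA; congr (_ * _); by rewrite mxE.
Qed.

Lemma feedback_unbiased t (mu : R) : (\int[P]_w (sqn (g t w))%:E <= mu%:E)%E ->
  P.-integrable setT (EFin \o (fun w => dotv (sg (x t w)) (g t w))) /\
  \int[P]_w dotv (sg (x t w)) (g t w) = \int[P]_w sqn (sg (x t w)).
Proof.
move=> hmu; have h i := unbiased_coordinate i hmu.
split; first by apply: integrable_Rsum => i; have [] := h i.
rewrite /dotv /sqn Rintegral_sum; last by move=> i; have [] := h i.
rewrite Rintegral_sum; last by move=> i; exact: integrable_sg_sqr.
by apply: eq_bigr => i _; have [_ ->] := h i.
Qed.

(** The curvature [Lam] and the moment bound [mu] are parameters, so both regimes share the
    argument. *)
Lemma descent_sum (Lam fl mu : R) (n : nat) : 0 <= Lam ->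
  (forall y z, sm z - sm y - dotv (sg y) (z - y) <= Lam * sqn (z - y)) ->
  (forall y, fl <= sm y) ->
  (forall t, (t < n)%N -> (\int[P]_w (sqn (g t w))%:E <= mu%:E)%E) ->
  eta * \sum_(t < n) \int[P]_w sqn (sg (x t w)) <=
  sm x0 - fl + n%:R * (Lam * eta ^+ 2 * mu).
Proof.
move=> Lam0 desc lb hmu.
(* The induction bounds the mean of [sm (x n)] from above and also carries its integrability; the
   lower bound [fl] enters once, at the end. *)
suff [ism hsm] : P.-integrable setT (EFin \o (fun w => sm (x n w))) /\
    \int[P]_w sm (x n w) <= sm x0 -
      eta * \sum_(t < n) \int[P]_w sqn (sg (x t w)) + n%:R * (Lam * eta ^+ 2 * mu).
  have : fl <= \int[P]_w sm (x n w).
    rewrite -[leLHS](Rintegral_cst_probability P); apply: le_Rintegral => //.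
    exact: integrable_cst.
  lra.
elim: n hmu => [|n ih] hmu.
  split; first exact: (integrable_cst P (sm x0)).
  rewrite big_ord0 mulr0 subr0 mul0r addr0.
  by rewrite (Rintegral_cst_probability P (sm x0)).
have [|ism hsm] := ih; first by move=> t tn; apply: hmu; rewrite ltnW.
have hn := hmu n (ltnSn n).
have [isq sqmu ig] := integrable_feedback hn.
have [idot Edot] := feedback_unbiased hn.
have slip y z : `|sm y - sm z| <= L0 * l2norm (y - z).
  exact: (smooth_lip gv L0_ge0 delta0 objective_lip).
have msm : measurable_fun setT (fun w => sm (x n.+1 w)).
  apply: (measurable_sub (Hm (J := Jx n.+1)) (f := fun w => sm (x n.+1 w))).
  by apply: (measurable_lipschitz L0_ge0 slip) => i; exact: measurable_x.
have xd w : x n.+1 w - x n w = - (eta *: g n w).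
  by rewrite xS addrAC subrr add0r.
have isS : P.-integrable setT (EFin \o (fun w => sm (x n.+1 w))).
  have ib := integrable_add (integrable_norm ism)
    (integrable_scale (L0 * eta) (integrable_add (integrable_cst P 1) isq)).
  apply: (integrable_dominated msm ib) => w.
  have h1 := slip (x n.+1 w) (x n w).
  rewrite xd l2normN l2normZ (gtr0_norm eta0) in h1.
  have h2 := ler_normD (sm (x n.+1 w) - sm (x n w)) (sm (x n w)).
  rewrite subrK in h2.
  have h3 := ler_wpM2l (mulr_ge0 L0_ge0 (ltW eta0)) (l2norm_le_sqn (g n w)).
  rewrite /=; lra.
split => //.
have step w : sm (x n.+1 w) <= (sm (x n w) -
    eta * dotv (sg (x n w)) (g n w)) + Lam * eta ^+ 2 * sqn (g n w).
  have := desc (x n w) (x n.+1 w).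
  have dN (a b : 'rV[R]_d) : dotv a (- (eta *: b)) = - (eta * dotv a b).
    by rewrite -scaleN1r (dotvZr (-1)) (dotvZr eta) mulN1r.
  rewrite xd sqnN (sqnZ eta) dN; lra.
have i1 := integrable_diff ism (integrable_scale eta idot).
have i2 := integrable_scale (Lam * eta ^+ 2) isq.
have : \int[P]_w sm (x n.+1 w) <= \int[P]_w sm (x n w) -
    eta * \int[P]_w sqn (sg (x n w)) + Lam * eta ^+ 2 * \int[P]_w sqn (g n w).
  rewrite -Edot -!RintegralZl// -RintegralB//; last exact: integrable_scale.
  rewrite -RintegralD//; apply: le_Rintegral => //; exact: integrable_add.
have hmu' := ler_wpM2l (mulr_ge0 Lam0 (sqr_ge0 eta)) sqmu.
have comb (I1 I0 S' s q r m0 : R) : I1 <= I0 - eta * s + q -> I0 <= m0 - eta * S' + n%:R * r ->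
    q <= r -> I1 <= m0 - eta * (S' + s) + (n%:R + 1) * r by lra.
move=> hI; rewrite big_ord_recr/= -natr1; exact: comb hI hsm hmu'.
Qed.

Lemma selection_expectation (phi : 'rV[R]_d -> R) : (0 < T)%N ->
  (forall y, 0 <= phi y) ->
  (forall t, measurable_fun setT ((fun w => phi (x t w)) : T1 (Jx t) -> R)) ->
  (\int[P]_w (phi (x (tau w) w))%:E =
   \sum_(t < T) (T%:R^-1)%:E * \int[P]_w (phi (x t w))%:E)%E.
Proof.
move=> T0 phi0 mphi.
have Mphi t : measurable_fun setT (fun w => phi (x t w)) := measurable_hist (mphi t).
have mtau (B : set nat) : measurable (tau @^-1` B).
  by rewrite -[X in measurable X]setTI; exact: measurable_funP.
have mL : measurable_fun setT (fun w => phi (x (tau w) w)).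
  move=> _ B mB; rewrite setTI.
  rewrite (_ : _ @^-1` B = \bigcup_k (tau @^-1` [set k] `&` (fun w => phi (x k w)) @^-1` B)).
    apply: bigcupT_measurable => k; apply: measurableI => //.
    by rewrite -[X in measurable X]setTI; exact: Mphi.
  by apply/seteqP; split => [w wB|w [k _ [/= <-]]] //; exists (tau w).
pose ind t w : R := (tau w == t)%:R.
have mind t : measurable_fun setT (ind t).
  exact: (measurableT_comp (f := fun k : nat => (k == t)%:R : R)).
have Ptau t : (t < T)%N -> P (tau @^-1` [set t]) = (T%:R^-1)%:E.
  by have [_ _ + _] := smp; apply.
pose psi w := \sum_(t < T) (phi (x t w) * ind t w).
have mpsi : measurable_fun setT psi.
  by apply: measurable_sum => t; apply: measurable_funM => //; exact: mind.
pose A := \big[setU/set0]_(t < T) (tau @^-1` [set val t]).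
have mA : measurable A by exact: bigsetU_measurable.
(* [sampling] prescribes the law of [tau] only below [T]; the [T] masses [1 / T] already add up to
   1, so other values of [tau] form a null event. *)
have PA : P A = 1%E.
  rewrite /A (measure_bigsetU P (F := fun t => tau @^-1` [set t])) //; last first.
    exact: trivIset_preimage1.
  rewrite (eq_bigr (fun=> (T%:R^-1)%:E)); last by move=> t _; exact: Ptau.
  rewrite sumEFin sumr_const card_ord -(mulr_natr T%:R^-1) mulVf//.
  by rewrite pnatr_eq0 -lt0n.
have -> : (\int[P]_w (phi (x (tau w) w))%:E = \int[P]_w (psi w)%:E)%E.
  apply: ae_eq_integral => //; [exact/measurable_EFinP|exact/measurable_EFinP|].
  exists (~` A); split; first exact: measurableC.
    by apply: (eq_trans (probability_setC P mA)); rewrite PA subee.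
  move=> w /= h; apply: contra_not h => wA _; congr (_%:E).
  move: wA; rewrite /A -(bigcup_mkord T (fun k => tau @^-1` [set k])) => -[k /= kT tk].
  rewrite /psi (bigD1 (Ordinal kT))//= /ind tk eqxx mulr1 big1 ?addr0// => j jk.
  by rewrite (negbTE (_ : k != j)) ?mulr0// eq_sym.
have -> : (\int[P]_w (psi w)%:E = \int[P]_w \sum_(t < T) (phi (x t w) * ind t w)%:E)%E.
  by apply: eq_integral => w _; rewrite sumEFin.
rewrite ge0_integral_sum//; last 2 first.
- by move=> t; apply/measurable_EFinP; apply: measurable_funM => //; exact: mind.
- by move=> t w _; rewrite lee_fin mulr_ge0// ler0n.
apply: eq_bigr => t _.
have mphiA : measurable_fun setT ((fun w => phi (x t w)) : T1 Jall -> R).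
  exact: hist_mono (@Jxall t) (mphi t).
pose e1 (k : nat) : R := (k == t)%:R.
rewrite (ge0_integral_sub (Hm (J := Jall)) (@indep_tau)
  (h := fun p : T1 Jall * nat => (phi (x t p.1) * e1 p.2)%:E)); last 2 first.
- apply/measurable_EFinP; apply: measurable_funM.
    exact: (measurableT_comp mphiA).
  exact: (measurableT_comp (f := e1)).
- by move=> p; rewrite lee_fin mulr_ge0// ler0n.
rewrite muleC -ge0_integralZr//; last 2 first.
- exact/measurable_EFinP.
- by move=> w _; rewrite lee_fin.
apply: eq_integral => w _ /=; rewrite ge0_EZ//.
congr (_ * _)%E; rewrite -(Ptau t (ltn_ord t)).
transitivity (distribution P tau ([set val t] `&` setT)); last by rewrite setIT.
rewrite -integral_indic//; apply: eq_integral => k _.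
by rewrite indicE in_set1.
Qed.

Let Rintegral_sqn_sg t : P.-integrable setT (EFin \o (fun w => sqn (sg (x t w)))).
Proof. by apply: integrable_Rsum => i; exact: integrable_sg_sqr. Qed.

(** [h] is the gradient to be estimated: [sg] itself with zero bias in (i), the gradient of [f] in
    (ii). The factors 2 come from splitting [h] into [h - sg] and [sg]. *)
Lemma selected_gradient_bound (h : 'rV[R]_d -> 'rV[R]_d) (Lh bias Lam fl gap mu : R) :
  (0 < T)%N -> 0 <= Lh -> 0 <= Lam ->
  (forall i y z, `|h y ord0 i - h z ord0 i| <= Lh * l2norm (y - z)) ->
  (forall y, sqn (h y - sg y) <= bias) ->
  (forall y z, sm z - sm y - dotv (sg y) (z - y) <= Lam * sqn (z - y)) ->
  (forall y, fl <= sm y) -> sm x0 - fl <= gap ->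
  (forall t, (t < T)%N -> (\int[P]_w (sqn (g t w))%:E <= mu%:E)%E) ->
  (\int[P]_w (sqn (h (x (tau w) w)))%:E <=
   (2 * ((gap + T%:R * (Lam * eta ^+ 2 * mu)) / (eta * T%:R)) + 2 * bias)%:E)%E.
Proof.
move=> T0 Lh0 Lam0 hlip hbias desc lb hgap hmu.
have Tp : 0 < T%:R :> R by rewrite ltr0n.
have mh t : measurable_fun setT ((fun w => sqn (h (x t w))) : T1 (Jx t) -> R).
  apply: measurable_sqn => i.
  apply: (measurable_lipschitz (f := fun y => h y ord0 i) Lh0 (hlip i)) => j.
  exact: measurable_x.
rewrite (selection_expectation (phi := fun y => sqn (h y)) T0 (fun y => sqn_ge0 _) mh).
have step t : (\int[P]_w (sqn (h (x t w)))%:E <=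
    (2 * \int[P]_w sqn (sg (x t w)) + 2 * bias)%:E)%E.
  have i1 := integrable_add (integrable_scale 2 (Rintegral_sqn_sg t))
    (integrable_cst P (2 * bias)).
  have -> : 2 * \int[P]_w sqn (sg (x t w)) + 2 * bias =
      \int[P]_w (2 * sqn (sg (x t w)) + 2 * bias).
    rewrite RintegralD//; last 2 first.
    - exact: integrable_scale.
    - exact: (integrable_cst P (2 * bias)).
    by rewrite RintegralZl// (Rintegral_cst_probability P (2 * bias)).
  rewrite -(integrable_EFin_Rintegral i1); apply: ge0_Ele.
  - exact: measurable_hist (mh t).
  - exact/measurable_EFinP/(measurable_int P i1).
  - by move=> w; exact: sqn_ge0.
  - move=> w; have := sqnD_le (h (x t w) - sg (x t w)) (sg (x t w)).
    rewrite subrK; have := hbias (x t w).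
    by move: (sqn _) (sqn _) (sqn _) => a b e ? ?; lra.
have hs := descent_sum Lam0 desc lb hmu.
apply: (@le_trans _ _ (\sum_(t < T) (T%:R^-1 *
    (2 * \int[P]_w sqn (sg (x t w)) + 2 * bias))%:E)%E).
  apply: lee_sum => t _; rewrite [leRHS]EFinM; exact: lee_wpmul2l.
rewrite sumEFin lee_fin -mulr_sumr big_split/= -mulr_sumr sumr_const card_ord.
move: hs; set Sg := \sum_(t < T) _ => hs.
have comb (X Y : R) : eta * Sg <= X -> X <= Y -> T%:R^-1 * (2 * Sg + (2 * bias) *+ T) <=
    2 * (Y / (eta * T%:R)) + 2 * bias.
  move=> h1 h2; have eT : 0 < eta * T%:R by rewrite mulr_gt0.
  have -> : T%:R^-1 * (2 * Sg + (2 * bias) *+ T) = 2 * (eta * Sg / (eta * T%:R)) + 2 * bias.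
    by rewrite -(mulr_natr (2 * bias)); field; rewrite !gt_eqF.
  rewrite lerD2r ler_pM2l// ler_pM2r ?invr_gt0//; exact: le_trans h1 h2.
by apply: comb hs _; rewrite lerD2r.
Qed.

End sgd.

(** * Moment recursion and step sizes *)

Section rates.
Context (R : realType).
Implicit Types (p q r c B G sg gap K E : R).

(* Beyond the contractive range [alpha <= 1/2] the bound [alpha * T <= K] leaves fewer
   than [2 * K] steps, so the geometric growth is absorbed in a constant. *)
Lemma recursion_bound K : exists2 B : R, 0 <= B &
  forall (T : nat) (alpha M G : R) (m : nat -> \bar R),
    (0 < T)%N -> 0 <= alpha -> alpha * T%:R <= K -> 0 <= M -> 0 <= G ->
    (m 0%N <= G%:E)%E ->
    (forall t, (m t.+1 <= alpha%:E * m t + M%:E)%E) ->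
    forall t, (t < T)%N -> (m t <= (B * (G + M))%:E)%E.
Proof.
pose A := 1 + `|K|; pose N := Num.bound (2 * K).
have A1 : 1 <= A by rewrite lerDl.
have AN t : 1 <= A ^+ t by exact: exprn_ege1.
exists (2 + A ^+ N * (1 + N%:R)).
  by rewrite addr_ge0// mulr_ge0 ?addr_ge0// (le_trans ler01 (AN _)).
move=> T alpha M G m T0 alpha0 aT M0 G0 m0 mS t tT.
have T1 : 1 <= T%:R :> R by rewrite ler1n.
have real_bound (r : nat -> R) : G <= r 0%N -> (forall s, alpha * r s + M <= r s.+1) ->
    forall s, (m s <= (r s)%:E)%E.
  move=> r0 rS; elim=> [|s ih]; first by rewrite (le_trans m0)// lee_fin.
  apply: le_trans (mS s) _; apply: (@le_trans _ _ (alpha%:E * (r s)%:E + M%:E)%E).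
    by rewrite leeD2r// lee_wpmul2l ?lee_fin.
  by rewrite -EFinM -EFinD lee_fin.
have X0 : 0 <= A ^+ N * (1 + N%:R) * (G + M).
  by rewrite !mulr_ge0 ?addr_ge0// (le_trans ler01 (AN _)).
have [a2|a2] := leP alpha 2^-1.
  apply: (@le_trans _ _ (G + 2 * M)%:E).
    (* For [alpha <= 1/2] the constant [G + 2 * M] is a supersolution of the recursion. *)
    apply: (real_bound (fun=> G + 2 * M)) => [|s]; first by rewrite lerDl mulr_ge0.
    nra.
  rewrite lee_fin mulrDl; lra.
have TK : T%:R <= 2 * K by nra.
have TN : (T <= N)%N.
  have K2 : 0 <= 2 * K by rewrite (le_trans _ TK).
  by rewrite -(ler_nat R) (le_trans TK)// ltW// archi_boundP.
have aA : alpha <= A.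
  have : alpha <= K by nra.
  by rewrite /A => h; rewrite (le_trans h)// (le_trans (ler_norm _))// lerDr.
apply: (@le_trans _ _ (A ^+ t * (G + t%:R * M))%:E).
  (* As [A] dominates both 1 and [alpha], this sequence is a supersolution for every
     [alpha <= A]. *)
  apply: (real_bound (fun t => A ^+ t * (G + t%:R * M))) => [|s].
    by rewrite expr0 mul1r mul0r addr0.
  have As := AN s; have AsS := AN s.+1; rewrite -natr1 exprS in AsS *.
  have X1 : 0 <= A ^+ s * (G + s%:R * M).
    by rewrite mulr_ge0 ?addr_ge0 ?mulr_ge0// (le_trans ler01).
  have := ler_wpM2r X1 aA; have := ler_wpM2r M0 AsS; nra.
rewrite lee_fin (@le_trans _ _ (A ^+ N * (1 + N%:R) * (G + M)))//; last first.
  by rewrite mulrDl lerDr mulr_ge0// addr_ge0.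
have tN : t%:R <= N%:R :> R by rewrite ler_nat (leq_trans (ltnW tT)).
rewrite -mulrA ler_pM//.
- by rewrite (le_trans ler01).
- by rewrite addr_ge0// mulr_ge0.
- by rewrite ler_weXn2l// (leq_trans (ltnW tT)).
- have N0 : 0 <= N%:R :> R by [].
  have := ler_wpM2r M0 tN; have := mulr_ge0 N0 G0; lra.
Qed.

(** Expressing everything through roots of [d], [T] and the tolerance makes all exponents natural,
    so the rate computations become identities of rational functions. *)
Lemma powR_rootX (a : R) (k n : nat) : a `^ (k%:R / n%:R) = (a `^ n%:R^-1) ^+ k.
Proof. by rewrite mulrC powRrM powR_mulrn// powR_ge0. Qed.

Lemma powR_rootK (a : R) (n : nat) : (0 < n)%N -> 0 <= a -> (a `^ n%:R^-1) ^+ n = a.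
Proof. by move=> n0 a0; rewrite -powR_rootX divff ?powRr1// pnatr_eq0 -lt0n. Qed.

Lemma powR_root_ge1 (a : R) (n : nat) : 1 <= a -> 1 <= a `^ n%:R^-1.
Proof.
have E1 : 1 `^ n%:R^-1 = 1 :> R by rewrite powR1.
move=> a1; rewrite -[leLHS]E1 ge0_ler_powR ?nnegrE ?invr_ge0//.
exact: le_trans ler01 a1.
Qed.

(** Here [p], [q], [r], [s] stand for the square roots of [d], [T], [epsf] and 2. The left side
    equals [9 / 8 * c * r ^+ 2 / p ^+ 2]. *)
Lemma contraction_nonsmooth p q r s L0 c E eta delta : 1 <= p -> 0 < q -> 0 < r -> 0 < L0 -> 0 <= c ->
  s ^+ 2 = 2 -> 0 < s -> r ^+ 2 <= E ->
  eta = r ^+ 3 / (2 * s * L0 ^+ 2 * p ^+ 3 * q) -> delta = r ^+ 2 / (L0 * p) ->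
  9 * L0 ^+ 2 * eta ^+ 2 * c * p ^+ 2 / delta ^+ 2 * q ^+ 2 <= 9 / 8 * c * E.
Proof.
move=> p1 q0 r0 L00 c0 s2 s0 rE -> ->; have p0 : 0 < p := lt_le_trans ltr01 p1.
have -> : 9 * L0 ^+ 2 * (r ^+ 3 / (2 * s * L0 ^+ 2 * p ^+ 3 * q)) ^+ 2 * c * p ^+ 2 /
    (r ^+ 2 / (L0 * p)) ^+ 2 * q ^+ 2 = 9 / (4 * s ^+ 2) * c * (r ^+ 2 / p ^+ 2).
  by field; rewrite !gt_eqF.
rewrite s2; have -> : (9 : R) / (4 * 2) = 9 / 8 by field.
rewrite ler_wpM2l ?mulr_ge0//; apply: le_trans rE.
by rewrite ler_pdivrMr ?exprn_gt0// ler_peMr ?sqr_ge0// exprn_ege1.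
Qed.

(** Once [p ^+ 3 / (r ^+ 3 * q)] is factored out, only positive powers of [r], bounded through [E],
    and negative powers of [p], bounded by 1, remain. The summand [2 * 0] is the vanishing bias. *)
Lemma rate_nonsmooth p q r s L0 c B G sg gap E eta delta : 1 <= p -> 0 < q -> 0 < r -> 0 < L0 ->
  0 <= c -> 0 < s -> 0 <= B -> 0 <= G -> r ^+ 2 <= E ->
  eta = r ^+ 3 / (2 * s * L0 ^+ 2 * p ^+ 3 * q) -> delta = r ^+ 2 / (L0 * p) ->
  2 * ((gap + q ^+ 2 * (2 * p * (L0 / delta * c) * eta ^+ 2 *
    (B * (G + (18 * L0 ^+ 2 * c ^+ 2 * (p ^+ 2) ^+ 2 +
      6 * sg ^+ 2 * c * p ^+ 2 / delta ^+ 2))))) / (eta * q ^+ 2)) + 2 * 0 <=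
  (4 * s * L0 ^+ 2 * gap + 2 * c * B / s *
    (G * E ^+ 2 + 18 * L0 ^+ 2 * c ^+ 2 * E ^+ 2 + 6 * sg ^+ 2 * c * L0 ^+ 2)) *
    p ^+ 3 * (r ^+ 3)^-1 * q^-1.
Proof.
move=> p1 q0 r0 L00 c0 s0 B0 G0 rE etaE deltaE.
have p0 : 0 < p := lt_le_trans ltr01 p1.
have -> : 2 * ((gap + q ^+ 2 * (2 * p * (L0 / delta * c) * eta ^+ 2 *
    (B * (G + (18 * L0 ^+ 2 * c ^+ 2 * (p ^+ 2) ^+ 2 +
      6 * sg ^+ 2 * c * p ^+ 2 / delta ^+ 2))))) / (eta * q ^+ 2)) + 2 * 0 =
  (4 * s * L0 ^+ 2 * gap + 2 * c * B / s *
    (G * (r ^+ 2) ^+ 2 / p ^+ 4 + 18 * L0 ^+ 2 * c ^+ 2 * (r ^+ 2) ^+ 2 +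
      6 * sg ^+ 2 * c * L0 ^+ 2)) * p ^+ 3 * (r ^+ 3)^-1 * q^-1.
  by rewrite etaE deltaE; field; rewrite !gt_eqF.
have h1 : (r ^+ 2) ^+ 2 <= E ^+ 2.
  by rewrite lerXn2r ?nnegrE ?sqr_ge0// (le_trans _ rE) ?sqr_ge0.
have h2 : G * (r ^+ 2) ^+ 2 / p ^+ 4 <= G * E ^+ 2.
  rewrite ler_pdivrMr ?exprn_gt0// (le_trans (ler_wpM2l G0 h1))//.
  by apply: ler_peMr; [rewrite mulr_ge0 ?sqr_ge0|exact: exprn_ege1].
rewrite !ler_wpM2r ?invr_ge0 ?exprn_ge0 ?(ltW p0) ?(ltW q0) ?(ltW r0)//.
rewrite lerD2l ler_wpM2l ?divr_ge0 ?mulr_ge0 ?(ltW s0)//.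
by rewrite lerD2r lerD// ler_wpM2l// !mulr_ge0 ?(ltW L00).
Qed.

(** Here [p] and [q] are the sixth roots of [d] and [T]; the prescribed [eta] and [delta] cancel
    them entirely. *)
Lemma contraction_smooth p q L0 c eta delta : 0 < p -> 0 < q -> 0 < L0 ->
  eta = 1 / (2 * L0 * p ^+ 8 * q ^+ 4) -> delta = 1 / (p ^+ 5 * q) ->
  9 * L0 ^+ 2 * eta ^+ 2 * c * p ^+ 6 / delta ^+ 2 * q ^+ 6 = 9 / 4 * c.
Proof. by move=> p0 q0 L00 -> ->; field; rewrite !gt_eqF. Qed.

(** The initial gap and the sampling noise have exactly the order [p ^+ 8 / q ^+ 2]; the remaining
    terms, among them the bias, carry extra negative powers of [p] or [q]. *)
Lemma rate_smooth p q L0 L1 c B G sg gap eta delta : 1 <= p -> 1 <= q -> 0 < L0 -> 0 < L1 ->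
  0 <= c -> 0 <= B -> 0 <= G ->
  eta = 1 / (2 * L0 * p ^+ 8 * q ^+ 4) -> delta = 1 / (p ^+ 5 * q) ->
  2 * ((gap + q ^+ 6 * (L1 * eta ^+ 2 *
    (B * (G + (18 * L0 ^+ 2 * c ^+ 2 * (p ^+ 6) ^+ 2 +
      6 * sg ^+ 2 * c * p ^+ 6 / delta ^+ 2))))) / (eta * q ^+ 6)) +
    2 * ((6 * L1 * delta) ^+ 2 * (c * p ^+ 6)) <=
  (4 * L0 * gap + L1 * B / L0 * (G + 18 * L0 ^+ 2 * c ^+ 2 + 6 * sg ^+ 2 * c) +
    72 * L1 ^+ 2 * c) * p ^+ 8 * (q ^+ 2)^-1.
Proof.
move=> p1 q1 L00 L10 c0 B0 G0 etaE deltaE.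
have p0 : 0 < p := lt_le_trans ltr01 p1.
have q0 : 0 < q := lt_le_trans ltr01 q1.
have -> : 2 * ((gap + q ^+ 6 * (L1 * eta ^+ 2 *
    (B * (G + (18 * L0 ^+ 2 * c ^+ 2 * (p ^+ 6) ^+ 2 +
      6 * sg ^+ 2 * c * p ^+ 6 / delta ^+ 2))))) / (eta * q ^+ 6)) +
    2 * ((6 * L1 * delta) ^+ 2 * (c * p ^+ 6)) =
  (4 * L0 * gap + L1 * B / L0 * (G / (p ^+ 16 * q ^+ 2) +
    18 * L0 ^+ 2 * c ^+ 2 / (p ^+ 4 * q ^+ 2) + 6 * sg ^+ 2 * c) +
    72 * L1 ^+ 2 * c / p ^+ 12) * p ^+ 8 * (q ^+ 2)^-1.
  by rewrite etaE deltaE; field; rewrite !gt_eqF.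
have le1 (X Y : R) : 0 <= X -> 1 <= Y -> X / Y <= X.
  move=> X0 Y1; rewrite ler_pdivrMr ?(lt_le_trans ltr01 Y1)//.
  by rewrite ler_peMr.
have pq n k : 1 <= p ^+ n * q ^+ k.
  by rewrite -[leLHS]mulr1 ler_pM// exprn_ege1.
rewrite !ler_wpM2r ?invr_ge0 ?exprn_ge0 ?(ltW p0) ?(ltW q0)//.
apply: lerD; last first.
  by apply: le1; [rewrite !mulr_ge0 ?(ltW L10)|exact: exprn_ege1].
rewrite lerD2l ler_wpM2l ?divr_ge0 ?mulr_ge0 ?(ltW L00) ?(ltW L10)//.
by rewrite lerD2r lerD// le1// !mulr_ge0 ?(ltW L00).
Qed.

End rates.

(** * Assembling the rates *)

Section final.
Context (R : realType).

Lemma smoothedE (d : nat) (dG : measure_display) (Gamma : measurableType dG)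
    (Q : probability Gamma R) (v : {RV Q >-> d.-tuple R}) (delta : R)
    (f : 'rV[R]_d -> R) : smoothed v delta f = smooth v f delta.
Proof. by apply/funext => x; rewrite /smoothed unlock. Qed.

Lemma powR_sqrtX3 (a : R) : 0 <= a -> a `^ (3 / 2) = Num.sqrt a ^+ 3.
Proof. by move=> a0; rewrite (powR_rootX a 3 2) powR12_sqrt. Qed.

Lemma range_inf_le (T : Type) (h : T -> R) (m : R) : (forall y, m <= h y) ->
  forall y, inf (range h) <= h y.
Proof.
move=> hm y; apply: ge_inf; last by exists y.
by exists m => _ [z _ <-].
Qed.

Lemma smooth_ge (d : nat) (dG : measure_display) (Gamma : measurableType dG)
    (Q : probability Gamma R) (v : {RV Q >-> d.-tuple R}) (f : 'rV[R]_d -> R)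
    (L delta m : R) : std_gaussian v -> 0 <= L -> 0 < delta ->
  (forall x y, `|f x - f y| <= L * l2norm (x - y)) ->
  (forall x, m <= f x) -> forall x, m <= smooth v f delta x.
Proof.
move=> gv L0 delta0 lip fm x; rewrite -[leLHS](Rintegral_cst_probability Q).
apply: le_Rintegral => //; first exact: integrable_cst.
exact: (integrable_shift gv L0 delta0 lip).
Qed.

(** Averaging the sample expansions gives the expansion of [f] and at once identifies its gradient
    as the mean of the sample gradients. *)
Lemma objective_quad_smooth (d : nat) (dX : measure_display) (Xi : measurableType dX)
    (D : probability Xi R) (F : 'rV[R]_d -> Xi -> R) (sigma L0 L1 : R) :
  0 < L1 -> admissible_objective D F sigma L0 -> smooth_samples F L1 ->
  quad_smooth (objective D F) (grad (objective D F)) L1.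
Proof.
move=> L10 [iF _ _ lipF] smF.
have qF s : quad_smooth (F ^~ s) (grad (F ^~ s)) L1.
  have [df [l lL hl]] := smF s.
  apply: lipschitz_grad_quad_smooth => //; first exact: ltW.
  by move=> x y; rewrite (le_trans (hl x y))// ler_wpM2r// l2norm_ge0.
have lip s x y : `|F x s - F y s| <= L0 * l2norm (x - y).
  have [l lL hl] := lipF s.
  by rewrite (le_trans (hl x y))// ler_wpM2r// l2norm_ge0.
have fE : objective D F = (fun x => \int[D]_s F x s).
  by apply/funext => x; rewrite /objective unlock.
have q := quad_smooth_average (ltW L10) qF lip iF.
by rewrite fE (quad_smooth_grad q).
Qed.

End final.

(** Each [C] is chosen before the dimension, the horizon, the probability spaces and the objective,
    which is the content of the O-notation. In (i) it is uniform over tolerances up to [epsmax],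
    whose powers enter the constant. *)
Theorem theorem13 (R : realType) (L0 sigma gap0 G0 : R) :
  0 < L0 -> 0 < sigma ->
  (forall epsmax : R, exists C : R,
    forall (d T : nat) (dX dO dG : measure_display)
      (Xi : measurableType dX) (Omega : measurableType dO)
      (Gamma : measurableType dG)
      (D : probability Xi R) (P : probability Omega R)
      (Q : probability Gamma R)
      (F : 'rV[R]_d -> Xi -> R) (v : {RV Q >-> d.-tuple R})
      (u : nat -> {RV P >-> d.-tuple R}) (xi : nat -> {RV P >-> Xi})
      (tau : {RV P >-> nat}) (x0 : 'rV[R]_d) (epsf eta delta : R),
    (0 < d)%N ->
    admissible_objective D F sigma L0 ->
    std_gaussian v ->
    sampling D u xi tau T ->
    0 < epsf -> epsf <= epsmax ->
    1 / (d%:R * epsf) < T%:R ->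
    eta = epsf `^ (3 / 2)
          / (2 * Num.sqrt 2 * L0 ^+ 2 * d%:R `^ (3 / 2) * Num.sqrt T%:R) ->
    delta = epsf / (L0 * Num.sqrt d%:R) ->
    let f_delta := smoothed v delta (objective D F) in
    let x w t := iterate F delta eta x0
                   (fun n => rowof (u n w)) (fun n => xi n w) t in
    let g w t := feedback F delta eta x0
                   (fun n => rowof (u n w)) (fun n => xi n w) t in
    f_delta x0 - inf (range f_delta) <= gap0 ->
    ('E_P[fun w => (l2norm (g w 0%N) ^+ 2)%R] <= G0%:E)%E ->
    ('E_P[fun w => (l2norm (grad f_delta (x w (tau w))) ^+ 2)%R]
      <= (C * d%:R `^ (3 / 2) * epsf `^ (- (3 / 2))
            * T%:R `^ (- (1 / 2)))%:E)%E)
  /\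
  (forall L1 : R, 0 < L1 -> exists C : R,
    forall (d T : nat) (dX dO dG : measure_display)
      (Xi : measurableType dX) (Omega : measurableType dO)
      (Gamma : measurableType dG)
      (D : probability Xi R) (P : probability Omega R)
      (Q : probability Gamma R)
      (F : 'rV[R]_d -> Xi -> R) (v : {RV Q >-> d.-tuple R})
      (u : nat -> {RV P >-> d.-tuple R}) (xi : nat -> {RV P >-> Xi})
      (tau : {RV P >-> nat}) (x0 : 'rV[R]_d) (eta delta : R),
    (0 < d)%N ->
    admissible_objective D F sigma L0 ->
    smooth_samples F L1 ->
    std_gaussian v ->
    sampling D u xi tau T ->
    (2 < T)%N ->
    eta = 1 / (2 * L0 * d%:R `^ (4 / 3) * T%:R `^ (2 / 3)) ->
    delta = 1 / (d%:R `^ (5 / 6) * T%:R `^ (1 / 6)) ->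
    let f := objective D F in
    let f_delta := smoothed v delta f in
    let x w t := iterate F delta eta x0
                   (fun n => rowof (u n w)) (fun n => xi n w) t in
    let g w t := feedback F delta eta x0
                   (fun n => rowof (u n w)) (fun n => xi n w) t in
    f_delta x0 - inf (range f_delta) <= gap0 ->
    ('E_P[fun w => (l2norm (g w 0%N) ^+ 2)%R] <= G0%:E)%E ->
    ('E_P[fun w => (l2norm (grad f (x w (tau w))) ^+ 2)%R]
      <= (C * d%:R `^ (4 / 3) * T%:R `^ (- (1 / 3)))%:E)%E).
Proof.
move=> L00 sigma0; have c0 : 0 <= gauss_const R := le_trans ler01 (gauss_const_ge1 R).
split.
  move=> epsmax; pose E := `|epsmax|; pose s := Num.sqrt (2 : R).
  have s0 : 0 < s by rewrite sqrtr_gt0.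
  have s2 : s ^+ 2 = 2 by rewrite sqr_sqrtr.
  (* [B] depends only on the bound for [alpha * T], hence it can be fixed before [d] and [T]. *)
  have [B B0 hB] := recursion_bound (9 / 8 * gauss_const R * E).
  exists (4 * s * L0 ^+ 2 * gap0 + 2 * gauss_const R * B / s * (G0 * E ^+ 2 +
    18 * L0 ^+ 2 * gauss_const R ^+ 2 * E ^+ 2 + 6 * sigma ^+ 2 * gauss_const R * L0 ^+ 2)).
  move=> d T dX dO dG Xi Omega Gamma D P Q F v u xi tau x0 eps eta delta d0 adm gv smp.
  move=> eps0 epsE TE etaE deltaE; rewrite smoothedE => fd x g gap hG0.
  have T0 : (0 < T)%N.
    by rewrite -(ltr_nat R) (le_lt_trans _ TE)// divr_ge0// mulr_ge0// ltW.
  pose p := Num.sqrt (d%:R : R); pose q := Num.sqrt (T%:R : R); pose r := Num.sqrt eps.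
  have p2 : p ^+ 2 = d%:R by rewrite sqr_sqrtr.
  have q2 : q ^+ 2 = T%:R by rewrite sqr_sqrtr.
  have r2 : r ^+ 2 = eps by rewrite sqr_sqrtr// ltW.
  have p1 : 1 <= p by rewrite -[leLHS]sqrtr1 ler_wsqrtr// ler1n.
  have p0 : 0 < p := lt_le_trans ltr01 p1.
  have q0 : 0 < q by rewrite sqrtr_gt0 ltr0n.
  have r0 : 0 < r by rewrite sqrtr_gt0.
  have rE : r ^+ 2 <= E by rewrite r2 (le_trans epsE)// ler_norm.
  rewrite !powR_sqrtX3 ?(ltW eps0)// -/p -/q -/r -/s in etaE.
  rewrite -/p -r2 in deltaE.
  have eta0 : 0 < eta by rewrite etaE divr_gt0 ?mulr_gt0 ?exprn_gt0.
  have delta0 : 0 < delta by rewrite deltaE divr_gt0 ?mulr_gt0 ?exprn_gt0.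
  have lip := objective_lip adm.
  have [_ [m fm] _ _] := adm.
  have lb := range_inf_le (smooth_ge gv (ltW L00) delta0 lip fm).
  have G0_ge0 : 0 <= G0.
    rewrite -lee_fin; apply: le_trans hG0; apply: expectation_ge0 => w.
    exact: sqr_ge0.
  have m0 : (\int[P]_w (sqn (g w 0%N))%:E <= G0%:E)%E.
    move: hG0; rewrite unlock; under [X in (X <= _)%E -> _]eq_integral do rewrite l2norm_sqr.
    by [].
  pose alpha := 9 * L0 ^+ 2 * eta ^+ 2 * gauss_const R * d%:R / delta ^+ 2.
  pose M := 18 * L0 ^+ 2 * gauss_const R ^+ 2 * d%:R ^+ 2 +
    6 * sigma ^+ 2 * gauss_const R * d%:R / delta ^+ 2.
  have alpha0 : 0 <= alpha.
    by rewrite /alpha; do ?[exact: c0|exact: sqr_ge0|exact: ltW|exact: ler0n|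
      apply: addr_ge0|apply: divr_ge0|apply: mulr_ge0].
  have M0 : 0 <= M.
    by rewrite /M; do ?[exact: c0|exact: sqr_ge0|exact: ltW|exact: ler0n|
      apply: addr_ge0|apply: divr_ge0|apply: mulr_ge0].
  have aT : alpha * T%:R <= 9 / 8 * gauss_const R * E.
    have := contraction_nonsmooth p1 q0 r0 L00 c0 s2 s0 rE etaE deltaE.
    by rewrite p2 q2.
  have hmu := hB T alpha M G0 (fun t => \int[P]_w (sqn (g w t))%:E)%E T0 alpha0 aT M0 G0_ge0 m0
    (feedback_moment x0 adm gv smp eta0 delta0 L00).
  have desc y z := smooth_descent gv (ltW L00) delta0 lip y z d0.
  (* In (i) the target gradient is that of the smoothed function, so there is no smoothing bias. *)
  have bias0 y : sqn (sgrad v (objective D F) delta y - sgrad v (objective D F) delta y) <= 0.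
    by rewrite subrr /sqn big1// => i _; rewrite mxE expr0n.
  have Lh0 : 0 <= L0 / delta * gauss_const R.
    by do ?[exact: c0|exact: ltW|exact: ler0n|apply: divr_ge0|apply: mulr_ge0].
  have Lam0 : 0 <= 2 * p * (L0 / delta * gauss_const R).
    by do ?[exact: c0|exact: ltW|exact: ler0n|apply: divr_ge0|apply: mulr_ge0].
  have key := selected_gradient_bound adm gv smp eta0 delta0 L00 T0 Lh0 Lam0
    (sgrad_lip gv (ltW L00) delta0 lip) bias0 desc lb gap hmu.
  rewrite unlock; under eq_integral do rewrite l2norm_sqr (grad_smooth gv (ltW L00) delta0 lip).
  apply: (le_trans key); rewrite lee_fin.
  have := rate_nonsmooth sigma gap0 p1 q0 r0 L00 c0 s0 B0 G0_ge0 rE etaE deltaE.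
  rewrite p2 q2 => rate; rewrite powRN (powRN T%:R) !powR_sqrtX3 ?(ltW eps0)//.
  by rewrite div1r powR12_sqrt.
move=> L1 L10.
have [B B0 hB] := recursion_bound (9 / 4 * gauss_const R).
exists (4 * L0 * gap0 + L1 * B / L0 * (G0 + 18 * L0 ^+ 2 * gauss_const R ^+ 2 +
  6 * sigma ^+ 2 * gauss_const R) + 72 * L1 ^+ 2 * gauss_const R).
move=> d T dX dO dG Xi Omega Gamma D P Q F v u xi tau x0 eta delta d0 adm smF gv smp.
move=> T2 etaE deltaE f; rewrite smoothedE => fd x g gap hG0.
have T0 : (0 < T)%N by rewrite (leq_trans _ T2).
(* All exponents prescribed in (ii) are multiples of [1 / 6]. *)
pose p := (d%:R : R) `^ 6%:R^-1; pose q := (T%:R : R) `^ 6%:R^-1.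
have p6 : p ^+ 6 = d%:R by rewrite powR_rootK.
have q6 : q ^+ 6 = T%:R by rewrite powR_rootK.
have p1 : 1 <= p by apply: powR_root_ge1; rewrite ler1n.
have q1 : 1 <= q by apply: powR_root_ge1; rewrite ler1n.
have p0 : 0 < p := lt_le_trans ltr01 p1.
have q0 : 0 < q := lt_le_trans ltr01 q1.
have r43 : (4 / 3 : R) = 8%:R / 6%:R by field.
have r23 : (2 / 3 : R) = 4%:R / 6%:R by field.
have r13 : (1 / 3 : R) = 2%:R / 6%:R by field.
rewrite r43 r23 !powR_rootX -/p -/q in etaE.
rewrite (powR_rootX _ 5 6) (div1r 6%:R) -/p -/q in deltaE.
have eta0 : 0 < eta by rewrite etaE divr_gt0 ?mulr_gt0 ?exprn_gt0.
have delta0 : 0 < delta by rewrite deltaE divr_gt0 ?mulr_gt0 ?exprn_gt0.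
have lip := objective_lip adm.
have [_ [m fm] _ _] := adm.
have lb := range_inf_le (smooth_ge gv (ltW L00) delta0 lip fm).
have G0_ge0 : 0 <= G0.
  rewrite -lee_fin; apply: le_trans hG0; apply: expectation_ge0 => w.
  exact: sqr_ge0.
have m0 : (\int[P]_w (sqn (g w 0%N))%:E <= G0%:E)%E.
  move: hG0; rewrite unlock; under [X in (X <= _)%E -> _]eq_integral do rewrite l2norm_sqr.
  by [].
pose alpha := 9 * L0 ^+ 2 * eta ^+ 2 * gauss_const R * d%:R / delta ^+ 2.
pose M := 18 * L0 ^+ 2 * gauss_const R ^+ 2 * d%:R ^+ 2 +
  6 * sigma ^+ 2 * gauss_const R * d%:R / delta ^+ 2.
have alpha0 : 0 <= alpha.
  by rewrite /alpha; do ?[exact: c0|exact: sqr_ge0|exact: ltW|exact: ler0n|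
    apply: addr_ge0|apply: divr_ge0|apply: mulr_ge0].
have M0 : 0 <= M.
  by rewrite /M; do ?[exact: c0|exact: sqr_ge0|exact: ltW|exact: ler0n|
    apply: addr_ge0|apply: divr_ge0|apply: mulr_ge0].
have aT : alpha * T%:R <= 9 / 4 * gauss_const R.
  have := contraction_smooth (gauss_const R) p0 q0 L00 etaE deltaE.
  by rewrite p6 q6 => <-.
have hmu := hB T alpha M G0 (fun t => \int[P]_w (sqn (g w t))%:E)%E T0 alpha0 aT M0 G0_ge0 m0
  (feedback_moment x0 adm gv smp eta0 delta0 L00).
have qf : quad_smooth f (grad f) L1 := objective_quad_smooth L10 adm smF.
have desc y z : smooth v f delta z - smooth v f delta y - dotv (sgrad v f delta y) (z - y)
    <= L1 * sqn (z - y).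
  apply: le_trans (ler_norm _) _.
  exact: (quad_smooth_smooth gv (ltW L10) (ltW L00) delta0 lip qf).
have glip i y z : `|grad f y ord0 i - grad f z ord0 i| <= 6 * L1 * l2norm (y - z).
  have := quad_smooth_lipschitz (ltW L10) qf y z; apply: le_trans.
  by have := coord_le_l2norm (grad f y - grad f z) i; rewrite !mxE.
have Lh0 : 0 <= 6 * L1 by rewrite mulr_ge0 ?ler0n ?ltW.
have key := selected_gradient_bound adm gv smp eta0 delta0 L00 T0 Lh0 (ltW L10)
  glip (sgrad_bias gv (ltW L10) (ltW L00) delta0 lip qf) desc lb gap hmu.
rewrite unlock; under eq_integral do rewrite l2norm_sqr.
apply: (le_trans key); rewrite lee_fin.
have := rate_smooth sigma gap0 p1 q1 L00 L10 c0 B0 G0_ge0 etaE deltaE.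
rewrite p6 q6 => rate; rewrite powRN r43 r13 !powR_rootX; exact: rate.
Qed.
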